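(* Let $m\ge1$ and let $\bar\gamma=(\gamma_1,\dots,\gamma_m)$ with $\gamma_j>0$. For $j=1,\dots,m$ let $1\le\theta_j\le+\infty$, $1\le\tau_j<+\infty$, $r_j>0$, let $X(\varphi_j)$ be a symmetric space on $[0,1]$ with fundamental function $\varphi_j$, and let $\psi_j$ be a $\Phi$-function, such that $1<\alpha_{\psi_j}\le\beta_{\psi_j}<\alpha_{\varphi_j}\le\beta_{\varphi_j}<2$ and $$\Bigl[\sum_{s_j=0}^{\infty}\Bigl(\frac{\psi_j(2^{-s_j})}{\varphi_j(2^{-s_j})}\,2^{-s_jr_j}\Bigr)^{\varepsilon_j}\Bigr]^{1/\varepsilon_j}<+\infty,$$ where, with $\beta_j=\theta_j/\tau_j$, one puts $\varepsilon_j=\tau_j\beta_j'$, $\beta_j'=\frac{\beta_j}{\beta_j-1}$ if $\beta_j>1$, and $\varepsilon_j=+\infty$ if $\theta_j\le\tau_j$ (for $\varepsilon_j=+\infty$ the expression above is read as the supremum over $s_j$). Put $\mu_j(s)=\psi_j(2^{-s})/\varphi_j(2^{-s})$, $\bar\varepsilon=(\varepsilon_1,\dots,\varepsilon_m)$ and $Y^m(\bar\gamma,n)=\{\bar s\in\mathbb{Z}_+^m:\langle\bar s,\bar\gamma\rangle\ge n\}$. Then there is a constant $C>0$ independent of $n\in\mathbb{N}$ such that for all $n\in\mathbb{N}$: 1) if $1\le\tau_j<\theta_j<+\infty$ for all $j=1,\dots,m$, then $$E_n^{(\bar\gamma)}\bigl(S^{\bar r}_{X(\bar\varphi),\bar\theta}B\bigr)_{\bar\psi,\bar\tau}\le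 C\,\Bigl\|\Bigl\{\prod_{j=1}^m2^{-s_jr_j}\mu_j(s_j)\Bigr\}_{\bar s\in Y^m(\bar\gamma,n)}\Bigr\|_{l_{\bar\varepsilon}};$$ 2) if $1\le\theta_j\le\tau_j<+\infty$ for all $j=1,\dots,m$, then $$E_n^{(\bar\gamma)}\bigl(S^{\bar r}_{X(\bar\varphi),\bar\theta}B\bigr)_{\bar\psi,\bar\tau}\le C\,\sup\Bigl\{\prod_{j=1}^m2^{-s_jr_j}\mu_j(s_j):\ \bar s\in\mathbb{Z}_+^m,\ \langle\bar s,\bar\gamma\rangle\ge n\Bigr\}.$$
   Context: $\mathbb{T}^m=[0,2\pi]^m$, $I^m=[0,1]^m$, $\mathbb{Z}_+=\{0,1,2,\dots\}$, $\langle\bar y,\bar x\rangle=\sum_{j=1}^m y_jx_j$. Functions $f$ on $\mathbb{T}^m$ are measurable and $2\pi$-periodic in each variable. $\Phi$-function: a concave, non-decreasing, continuous function $\varphi$ on $[0,1]$ with $\varphi(0)=0$ (not identically zero). Put $\alpha_\varphi=\liminf_{t\to0}\varphi(2t)/\varphi(t)$ and $\beta_\varphi=\limsup_{t\to0}\varphi(2t)/\varphi(t)$. Rearrangement: for a nonnegative measurable $g$ on $[0,1]$, $g^*(t)=\inf\{\lambda>0:\mu\{x: g(x)>\lambda\}<t\}$, $\mu$ being Lebesgue measure. Symmetric space on $[0,1]$: a Banach space $X$ of Lebesgue measurable functions on $[0,1]$ such that (1) $|f|\le|g|$ a.e. and $g\in X$ imply $f\in X$ and $\|f\|_X\le\|g\|_X$;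 (2) if $g$ is measurable, $f\in X$ and $|f|,|g|$ are equimeasurable, then $g\in X$ and $\|g\|_X=\|f\|_X$. Its fundamental function is $\varphi(t)=\|\chi_{[0,t]}\|_X$, taken to be a $\Phi$-function; the space is then denoted $X(\varphi)$. Anisotropic symmetric space: for $\bar\varphi=(\varphi_1,\dots,\varphi_m)$, $X(\bar\varphi)$ is the space of functions $f$ on $\mathbb{T}^m$ with finite norm $\|f\|^*_{X(\bar\varphi)}=\|\cdots\|f^{*_1,\dots,*_m}\|_{X(\varphi_1)}\cdots\|_{X(\varphi_m)}$, where $f^{*_1,\dots,*_m}(t_1,\dots,t_m)$ is obtained from $|f(2\pi\bar x)|$, $\bar x\in I^m$, by taking the non-increasing rearrangement successively in $x_1$, then $x_2$, ..., then $x_m$, each time with the other variables fixed, and the norm of $X(\varphi_j)$ is applied in the variable $t_j$ (first $t_1$, ..., last $t_m$). $\overset{\circ}{X}(\bar\varphi)$ is the subset of $f\in X(\bar\varphi)$ with $\int_0^{2\pi}f(\bar x)\,dx_j=0$ for every $j$. Generalized anisotropic Lorentz space: $L^*_{\bar\psi,\bar\tau}(\mathbb{T}^m)$ is the set of $f$ with finite $$\|f\|^*_{\bar\psi,\bar\tau}=\Bigl[\int_0^1\psi_m^{\tau_m}(t_m)\Bigl[\cdots\Bigl[\int_0^1\psi_1^{\tau_1}(t_1)\bigl(f^{*_1,\dots,*_m}(t_1,\dots,t_m)\bigr)^{\tau_1}\frac{dt_1}{t_1}\Bigr]^{\tau_2/\tau_1}\cdots\Bigr]^{\tau_m/\tau_{m-1}}\frac{dt_m}{t_m}\Bigr]^{1/\tau_m}.$$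 Dyadic blocks: $a_{\bar n}(f)$ are the Fourier coefficients of $f$ with respect to $\{e^{i\langle\bar n,\bar x\rangle}\}_{\bar n\in\mathbb{Z}^m}$; $\rho(\bar s)=\{\bar k\in\mathbb{Z}^m: 2^{s_j-1}\le|k_j|<2^{s_j},\ j=1,\dots,m\}$; $\delta_{\bar s}(f,\bar x)=\sum_{\bar n\in\rho(\bar s)}a_{\bar n}(f)e^{i\langle\bar n,\bar x\rangle}$ (an empty sum is $0$). Mixed sequence norm: $\|\{a_{\bar s}\}\|_{l_{\bar\theta}}=\bigl\{\sum_{s_m}\bigl[\cdots\bigl[\sum_{s_1}|a_{\bar s}|^{\theta_1}\bigr]^{\theta_2/\theta_1}\cdots\bigr]^{\theta_m/\theta_{m-1}}\bigr\}^{1/\theta_m}$, sums over $s_j\in\mathbb{Z}_+$, with the $j$-th $\ell_{\theta_j}$-norm replaced by a supremum if $\theta_j=\infty$. For a family indexed only by $\bar s\in Y^m(\bar\gamma,n)$ the norm is that of its extension by $0$ to $\mathbb{Z}_+^m$. Nikol'skii--Besov class: $$S^{\bar r}_{X(\bar\varphi),\bar\theta}B=\Bigl\{f\in\overset{\circ}{X}(\bar\varphi):\ \|f\|^*_{X(\bar\varphi)}+\Bigl\|\Bigl\{\prod_{j=1}^m2^{s_jr_j}\|\delta_{\bar s}(f)\|^*_{X(\bar\varphi)}\Bigr\}_{\bar s\in\mathbb{Z}_+^m}\Bigr\|_{l_{\bar\theta}}\le1\Bigr\}.$$ Best approximation: $Q_n^{\bar\gamma}=\bigcup_{\bar s\in\mathbb{Z}_+^m,\,\langle\bar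 s,\bar\gamma\rangle<n}\rho(\bar s)$; $T(Q_n^{\bar\gamma})$ is the set of trigonometric polynomials $\sum_{\bar k\in Q_n^{\bar\gamma}}b_{\bar k}e^{i\langle\bar k,\bar x\rangle}$; $E_n^{(\bar\gamma)}(f)_{\bar\psi,\bar\tau}=\inf_{t\in T(Q_n^{\bar\gamma})}\|f-t\|^*_{\bar\psi,\bar\tau}$; and $E_n^{(\bar\gamma)}(S^{\bar r}_{X(\bar\varphi),\bar\theta}B)_{\bar\psi,\bar\tau}=\sup\{E_n^{(\bar\gamma)}(f)_{\bar\psi,\bar\tau}: f\in S^{\bar r}_{X(\bar\varphi),\bar\theta}B\}$. *)

(* Defs.v *)
From HB Require Import structures.
From mathcomp Require Import all_boot all_order all_algebra.
From mathcomp Require Import all_classical all_reals all_analysis.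
From mathcomp Require Import measurable_realfun.
From mathcomp Require Import complex.

Set Implicit Arguments.
Unset Strict Implicit.
Unset Printing Implicit Defensive.

Import Order.TTheory GRing.Theory Num.Def Num.Theory.
Import numFieldTopology.Exports numFieldNormedType.Exports.

Local Open Scope classical_set_scope.
Local Open Scope ring_scope.

Section tuple_measure.
Context {R : realType} (m : nat).
Variable mu : {sigma_finite_measure set (m.-tuple R) -> \bar R}.

Definition cons_pair (p : R * m.-tuple R) : m.+1.-tuple R :=
  [tuple of p.1 :: p.2].

Lemma measurable_cons_pair : measurable_fun [set: R * m.-tuple R] cons_pair.
Proof. exact: measurable_cons. Qed.

Definition cons_measure : set (m.+1.-tuple R) -> \bar R :=
  pushforward (lebesgue_measure \x mu)%E cons_pair.

HB.instance Definition _ := Measure.copy cons_measure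
  (measure_function_pushforward__canonical__measure_function_Measure
     (lebesgue_measure \x mu)%E measurable_cons_pair).

Let cons_measure_sigma_finite : sigma_finite setT cons_measure.
Proof.
have /sigma_finiteP[F [TF ndF Foo]] := sigma_finiteT (@lebesgue_measure R).
have /sigma_finiteP[G [TG ndG Goo]] := sigma_finiteT mu.
pose u (t : m.+1.-tuple R) : R * m.-tuple R :=
  (tnth t ord0, [tuple of behead t]).
have uK : cancel cons_pair u.
  by case=> x t; rewrite /u /cons_pair /=; congr pair; exact: val_inj.
exists (fun k => u @^-1` (F k `*` G k)).
  rewrite -preimage_bigcup (_ : \bigcup_k _ = setT) ?preimage_setT//.
  rewrite -subTset => -[x y] _.
  have [i _ Fx] : (\bigcup_k F k) x by rewrite -TF.
  have [j _ Gy] : (\bigcup_k G k) y by rewrite -TG.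
  exists (maxn i j) => //; split.
  - by move: x Fx; exact/subsetPset/ndF/leq_maxl.
  - by move: y Gy; exact/subsetPset/ndG/leq_maxr.
move=> k; have [mF Fk] := Foo k; have [mG Gk] := Goo k; split.
  rewrite -[X in measurable X]setTI.
  apply: (measurable_fun_pair (measurable_tnth ord0) (@measurable_behead _ _ _)).
    exact: measurableT.
  exact: measurableX.
rewrite /cons_measure /pushforward -comp_preimage.
rewrite (_ : u \o cons_pair = id); last by apply/funext => p; exact: uK.
rewrite preimage_id product_measure1E//.
by rewrite lte_mul_pinfty// ge0_fin_numE.
Qed.

HB.instance Definition _ := Measure_isSigmaFinite.Build _ _ _ cons_measure
  cons_measure_sigma_finite.

End tuple_measure.

(* Lebesgue measure on the Borel sets of R^m *)
Fixpoint lebesgue_tuple (R : realType) (m : nat) :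
    {sigma_finite_measure set (m.-tuple R) -> \bar R} :=
  match m with
  | 0%N => \d_[tuple]
  | m'.+1 => cons_measure (lebesgue_tuple R m')
  end.

Section measurability.
Context d (T : measurableType d) (R : realType).

(* Lebesgue rather than Borel measurability: the domain sigma-algebra is
   completed with respect to mu.  No completed measure is needed elsewhere:
   [lebesgue_measure] is an outer measure on all subsets of the line, and
   [integral] is a supremum over Borel simple functions minorizing the
   integrand, so both have the right value on Lebesgue measurable data. *)
Definition lebesgue_measurable_fun (mu : set T -> \bar R) (D : set T)
    (f : T -> R) : Prop :=
  measurable_fun (D : set (g_sigma_algebraType (completed_algebra_gen mu)))
    (f : g_sigma_algebraType (completed_algebra_gen mu) -> R).

End measurability.

Section real_functions.
Variable R : realType.
Implicit Types phi : R -> R.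

Definition unit_itv : set R := `[0, 1].

Definition Phi_function phi : Prop :=
  [/\ {in `[0, 1] & `[0, 1], forall s t (a : R), a \in `[0, 1] ->
         a * phi s + (1 - a) * phi t <= phi (a * s + (1 - a) * t)},
      {in `[0, 1] & `[0, 1], {homo phi : s t / s <= t}},
      {within unit_itv, continuous phi},
      phi 0 = 0
    & exists2 t : R, t \in `[0, 1] & phi t != 0].

Definition lower_dilation phi : \bar R :=
  limf_einf (fun t : R => (phi (2 * t) / phi t)%:E) 0^'+.

Definition upper_dilation phi : \bar R :=
  limf_esup (fun t : R => (phi (2 * t) / phi t)%:E) 0^'+.

(* Extended-real valued because the set may be empty, e.g. for t = 0 *)
Definition rearrangement (g : R -> \bar R) (t : R) : \bar R :=
  ereal_inf [set l%:E | l in [set l : R | 0 < l /\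
    (lebesgue_measure [set x | unit_itv x /\ (l%:E < g x)%E] < t%:E)%E]].

Definition equimeasurable (f g : R -> R) : Prop := forall l : R,
  lebesgue_measure [set x | unit_itv x /\ l < f x] =
  lebesgue_measure [set x | unit_itv x /\ l < g x].

(* Functions on [0, 1] are represented by functions on the real line whose
   values outside [0, 1] are irrelevant (by [sym_ideal]); they are not
   quotiented by almost everywhere equality. *)
Record symmetric_space := SymmetricSpace {
  sym_set : set (R -> R);
  sym_norm : (R -> R) -> R;
  sym_measurable : forall f, sym_set f ->
    lebesgue_measurable_fun lebesgue_measure unit_itv f;
  sym_set0 : sym_set (cst 0);
  sym_setD : forall f g, sym_set f -> sym_set g -> sym_set (f \+ g);
  sym_setZ : forall a f, sym_set f -> sym_set (a \*o f);
  sym_norm_definite : forall f, sym_set f -> sym_norm f = 0 ->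
    {ae lebesgue_measure, forall t, unit_itv t -> f t = 0};
  sym_normD : forall f g, sym_set f -> sym_set g ->
    sym_norm (f \+ g) <= sym_norm f + sym_norm g;
  sym_normZ : forall a f, sym_set f -> sym_norm (a \*o f) = `|a| * sym_norm f;
  sym_complete : forall u : (R -> R)^nat, (forall n, sym_set (u n)) ->
    (forall e, 0 < e -> exists N, forall p q, (N <= p)%N -> (N <= q)%N ->
       sym_norm (u p \- u q) < e) ->
    exists2 f, sym_set f & sym_norm (u n \- f) @[n --> \oo] --> 0;
  sym_ideal : forall f g,
    lebesgue_measurable_fun lebesgue_measure unit_itv f -> sym_set g ->
    {ae lebesgue_measure, forall t, unit_itv t -> `|f t| <= `|g t|} ->
    sym_set f /\ sym_norm f <= sym_norm g;
  sym_invariant : forall f g, sym_set f ->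
    lebesgue_measurable_fun lebesgue_measure unit_itv g ->
    equimeasurable (normr \o f) (normr \o g) ->
    sym_set g /\ sym_norm g = sym_norm f }.

Definition fundamental_function (X : symmetric_space) phi : Prop :=
  forall t : R, t \in `[0, 1] ->
    sym_set X \1_(`[0, t]%classic) /\ sym_norm X \1_(`[0, t]%classic) = phi t.

(* The norm of X on extended-real valued functions, +oo off X *)
Definition sym_enorm (X : symmetric_space) (g : R -> \bar R) : \bar R :=
  if `[< {ae lebesgue_measure, forall t, unit_itv t -> g t \is a fin_num} /\
         sym_set X (fine \o g) >]
  then (sym_norm X (fine \o g))%:E else +oo%E.

Definition lorentz_norm (psi : R -> R) (tau : R) (g : R -> \bar R) : \bar R :=
  ((\int[lebesgue_measure]_(t in unit_itv)
      ((psi t `^ tau)%:E * g t `^ tau * (t^-1)%:E)) `^ tau^-1)%E.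

End real_functions.

Section iteration.

Definition set_tnth T m (t : m.-tuple T) (j : 'I_m) (x : T) : m.-tuple T :=
  [tuple if i == j then x else tnth t i | i < m].

(* N_0 is applied in the variable 0, then N_1 in the variable 1, and so on.
   After all m steps the function is constant, and t0 is a mere base point. *)
Definition mixed_norm T U m (N : 'I_m -> (T -> U) -> U) (F : m.-tuple T -> U)
    (t0 : T) : U :=
  foldl (fun G j t => N j (fun x => G (set_tnth t j x))) F (enum 'I_m)
    [tuple of nseq m t0].

Definition iterated_rearrangement (R : realType) m (F : m.-tuple R -> \bar R) :
    m.-tuple R -> \bar R :=
  foldl (fun G j t => rearrangement (fun x => G (set_tnth t j x)) (tnth t j))
    F (enum 'I_m).

End iteration.

Section periodic_functions.
Variables (R : realType) (m : nat).
Implicit Types (f g : m.-tuple R -> R[i]) (X : 'I_m -> symmetric_space R).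

Definition period_itv : set R := `[0, 2 * pi].

Definition torus : set (m.-tuple R) :=
  [set x | forall j, period_itv (tnth x j)].

Definition periodic f : Prop :=
  forall x j, f (set_tnth x j (tnth x j + 2 * pi)) = f x.

Definition complex_measurable f : Prop :=
  lebesgue_measurable_fun (lebesgue_tuple R m) setT (fun x => complex.Re (f x)) /\
  lebesgue_measurable_fun (lebesgue_tuple R m) setT (fun x => complex.Im (f x)).

Definition complex_integral d (T : measurableType d)
    (mu : {measure set T -> \bar R}) (D : set T) (h : T -> R[i]) : R[i] :=
  (\int[mu]_(x in D) complex.Re (h x) +i* \int[mu]_(x in D) complex.Im (h x))%C.

Definition torus_rearrangement f : m.-tuple R -> \bar R :=
  iterated_rearrangement (fun x =>
    (Normc.normc (f [tuple 2 * pi * tnth x j | j < m]))%:E).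

Definition aniso_norm X f : \bar R :=
  mixed_norm (fun j => sym_enorm (X j)) (torus_rearrangement f) 0.

Definition aniso_space X : set (m.-tuple R -> R[i]) :=
  [set f | [/\ periodic f, complex_measurable f & (aniso_norm X f < +oo)%E]].

(* The one-dimensional integrals make sense for almost all values of the other
   variables only. *)
Definition aniso_space0 X : set (m.-tuple R -> R[i]) :=
  [set f | aniso_space X f /\ forall j, {ae lebesgue_tuple R m, forall x,
    complex_integral lebesgue_measure period_itv (fun y => f (set_tnth x j y))
    = 0}].

(* Nesting the norms (int psi_j^tau_j g^tau_j dt/t)^(1/tau_j) produces the
   exponents tau_(j+1)/tau_j of the iterated integrals. *)
Definition aniso_lorentz_norm (psi : 'I_m -> R -> R) (tau : 'I_m -> R) f
    : \bar R :=
  mixed_norm (fun j => lorentz_norm (psi j) (tau j)) (torus_rearrangement f) 0.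

Definition harmonic (k : m.-tuple int) (x : m.-tuple R) : R[i] :=
  let a := \sum_(j < m) (tnth k j)%:~R * tnth x j in (cos a +i* sin a)%C.

Definition fourier_coef f (k : m.-tuple int) : R[i] :=
  ((2 * pi) ^- m)%:C%C *
  complex_integral (lebesgue_tuple R m) torus
    (fun x => f x * (harmonic k x)^*%C).

(* Empty as soon as some s_j = 0, since 1/2 <= |k_j| < 1 has no solution *)
Definition dyadic_block (s : m.-tuple nat) : set (m.-tuple int) :=
  [set k | forall j, 2 ^ ((tnth s j)%:Z - 1) <= `|tnth k j|%:~R :> R /\
                     `|tnth k j|%:~R < 2 ^ (tnth s j)%:Z :> R].

Definition delta_block (s : m.-tuple nat) f (x : m.-tuple R) : R[i] :=
  \sum_(k \in dyadic_block s) fourier_coef f k * harmonic k x.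

Definition lseq_norm (theta : 'I_m -> \bar R) (a : m.-tuple nat -> \bar R)
    : \bar R :=
  mixed_norm (fun j => Lnorm counting (theta j)) a 0%N.

Definition besov_class X (r : 'I_m -> R) (theta : 'I_m -> \bar R) :
    set (m.-tuple R -> R[i]) :=
  [set f | aniso_space0 X f /\
    (aniso_norm X f + lseq_norm theta (fun s =>
       (\prod_(j < m) 2 `^ ((tnth s j)%:R * r j))%:E *
       aniso_norm X (delta_block s f)) <= 1)%E].

Definition weight (gamma : 'I_m -> R) (s : m.-tuple nat) : R :=
  \sum_(j < m) (tnth s j)%:R * gamma j.

Definition hyperbolic_cross (gamma : 'I_m -> R) (n : nat) :
    set (m.-tuple int) :=
  \bigcup_(s in [set s | weight gamma s < n%:R]) dyadic_block s.

Definition trig_polynomials (Q : set (m.-tuple int)) :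
    set (m.-tuple R -> R[i]) :=
  [set t | exists b : m.-tuple int -> R[i],
     t = fun x => \sum_(k \in Q) b k * harmonic k x].

Definition best_approx (gamma : 'I_m -> R) n psi tau f : \bar R :=
  ereal_inf [set aniso_lorentz_norm psi tau (f \- t) |
             t in trig_polynomials (hyperbolic_cross gamma n)].

Definition class_best_approx (gamma : 'I_m -> R) n psi tau
    (S : set (m.-tuple R -> R[i])) : \bar R :=
  ereal_sup [set best_approx gamma n psi tau f | f in S].

End periodic_functions.

Section exponents.
Variable R : realType.

(* tau * beta' with beta = theta / tau; for theta = +oo, beta' = 1 *)
Definition eps_exponent (theta : \bar R) (tau : R) : \bar R :=
  (if theta <= tau%:E then +oo
   else tau%:E * hoelder_conjugate (theta * tau^-1%:E))%E.

Definition phi_ratio (psi phi : R -> R) (s : nat) : R :=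
  psi (2 ^- s) / phi (2 ^- s).

End exponents.

(* Main.v *)
Require Import Defs.
From mathcomp Require Import all_boot all_order all_algebra.
From mathcomp Require Import all_classical all_reals all_analysis.
From mathcomp Require Import measurable_realfun complex ring lra zify.

Set Implicit Arguments.
Unset Strict Implicit.
Unset Printing Implicit Defensive.

Import Order.TTheory GRing.Theory Num.Def Num.Theory.
Import numFieldTopology.Exports numFieldNormedType.Exports.

Local Open Scope classical_set_scope.
Local Open Scope ring_scope.

(** The approximant of [f] is its partial Fourier sum over the hyperbolic cross,
    so that the remainder is the sum of the blocks [delta_block s f] with [s] in
    the complement [Y] of the cross.  The estimate of the remainder has three
    ingredients.

    The remainder as a sum of blocks.  The norm of [X] controls the iterated
    rearrangement pointwise, by products of reciprocals of fundamental functions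
    ([torus_rearr_le_aniso_norm]), and these are integrable since the upper
    dilation indices of the [phi j] are less than [2]
    ([integral_torus_le_aniso_norm]).  Hence [f] has Fourier coefficients, the
    series of its blocks converges absolutely almost everywhere because of the
    factors [2 ^ (- s_j r_j)], and its sum is [f] since integrable functions are
    determined by their Fourier coefficients ([torus_uniqueness]).  This bounds
    the modulus of the remainder almost everywhere by the sum of the moduli of
    the blocks in [Y] ([fourier_tail_bound]).

    The rearrangement of such a sum.  Iterated rearrangements are not
    subadditive, and the inner ones need not be measurable; but a sum is at
    most the supremum of its summands divided by weights [eps s] that add up to
    at most [1], and the rearrangement of a countable supremum is at most the
    supremum of the rearrangements dilated by such weights, by countable
    subadditivity of outer measure alone ([torus_rearr_sup_le]).  A
    trigonometric polynomial of degree less than [2 ^ s_j] in each variable is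
    moreover essentially constant at the scale [2 ^- s_j]; therefore its
    rearrangement at [2 ^- k_j] is bounded, up to a constant, by its norm over
    the product of the [phi j] at [2 ^- min (s_j, k_j)] ([nikolskii]).
    Multiplied by [psi j] at [2 ^- k_j], the reciprocal of [phi j] at
    [2 ^- min (s_j, k_j)] is the ratio [mu_j (s_j)] of [psi j] and [phi j] at
    [2 ^- s_j] times a factor that decays geometrically in the distance of [s_j]
    and [k_j]: for [s_j <= k_j] because the lower index of [psi j] exceeds [1],
    for [s_j > k_j] because the upper index of [psi j] is below the lower index
    of [phi j] ([psi_phi_decay]).  The decay absorbs the powers of [eps s] lost in
    the dilations when [eps s] itself decays slowly and geometrically in these
    distances ([block_superposition]).

    Sequence norms.  On dyadic cells the Lorentz norm becomes a mixed sequence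
    norm with exponents [tau j] ([mixed_lorentz_norm_le]), on which the geometric
    kernel acts boundedly ([lseq_convolution_le]).  The error is thus at most a
    constant times the [tau]-norm over [Y] of the product of the weight
    [2 ^ (- s_j r_j) mu_j (s_j)] and the sequence whose [theta]-norm the class
    bounds by [1] ([best_approx_le]).  If [tau j < theta j] for all [j], Hoelder's
    inequality with [1 / tau j = 1 / eps j + 1 / theta j] leaves the norm of the
    weight with exponents [eps j]; if [theta j <= tau j] for all [j], the supremum
    of the weight is taken out and the [tau]-norm is at most the [theta]-norm. *)

(** * Lebesgue outer measure on the line *)
Section lebesgue_outer_measure.
Context {R : realType}.
Implicit Types (A B : set R).
Local Notation leb := (@lebesgue_measure R).

Lemma le_lebesgue A B : A `<=` B -> (leb A <= leb B)%E.
Proof. exact: (@le_outer_measure _ _ ((@wlength R idfun)^*)%mu). Qed.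

Lemma lebesgue_sigma_subadditive (F : (set R)^nat) :
  (leb (\bigcup_n F n) <= \sum_(n <oo) leb (F n))%E.
Proof. exact: (@outer_measure_sigma_subadditive _ _ ((@wlength R idfun)^*)%mu). Qed.

Lemma lebesgueU2 A B : (leb (A `|` B) <= leb A + leb B)%E.
Proof. exact: (@outer_measureU2 _ _ ((@wlength R idfun)^*)%mu). Qed.

Lemma lebesgue_hull A :
  exists B, [/\ measurable B, A `<=` B & leb B = leb A].
Proof.
have [G [oG AG GA]] := outer_measure_Gdelta A.
exists (\bigcap_i G i); split => //.
by apply: bigcapT_measurable => i; exact: open_measurable.
Qed.

Lemma lebesgue_caratheodory A B : measurable B ->
  leb A = (leb (A `&` B) + leb (A `&` ~` B))%E.
Proof.
by move=> mB; apply: (@sub_caratheodory _ _ _ (@wlength R idfun)).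
Qed.

Lemma measurable_affine (c a : R) : measurable_fun [set: R] (fun x : R => c * x + a).
Proof. by apply: measurable_funD => //; apply: measurable_funM. Qed.

Lemma affine_preimage_ocitv (c a u v : R) : 0 < c ->
  (fun x : R => c * x + a) @^-1` `]u, v] = `](u - a) / c, (v - a) / c]%classic.
Proof.
move=> c0; apply/seteqP; split => x /=; rewrite !in_itv/=.
  by move=> /andP[h1 h2]; rewrite ltr_pdivrMr// ler_pdivlMr//; apply/andP; split; lra.
rewrite ltr_pdivrMr// ler_pdivlMr// => /andP[h1 h2]; apply/andP; split; lra.
Qed.

Lemma lebesgue_affine_measurable (c a : R) A : 0 < c -> measurable A ->
  (c%:E * leb [set x | A (c * x + a)%R] = leb A)%E.
Proof.
move=> c0 mA.
have mf : measurable_fun [set: R] ((fun x : R => c * x + a) : R -> measurableTypeR R).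
  exact: measurable_affine.
pose pf := measure_function_pushforward__canonical__measure_function_Measure leb mf.
pose m2 := measure_function_mscale__canonical__measure_function_Measure (NngNum (ltW c0)) pf.
have -> // : leb A = m2 A.
have h := @lebesgue_measure_unique R m2.
apply: h mA => // _ [[u v]] _ <-.
rewrite /m2/= /mscale/= /pushforward affine_preimage_ocitv//.
rewrite !lebesgue_measure_itv/= !lte_fin.
have -> : ((u - a) / c < (v - a) / c) = (u < v) by rewrite ltr_pM2r ?invr_gt0// ltrD2r.
case: ifP => _; last by rewrite mule0.
rewrite -!EFinD -EFinM; congr (_%:E); field.
by rewrite gt_eqF.
Qed.

(** Level sets of an iterated rearrangement need not be measurable, whence
    arbitrary sets; a measurable hull reduces the inequality to the
    measurable case. *)
Lemma lebesgue_affine (c a : R) A : 0 < c ->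
  (c%:E * leb [set x | A (c * x + a)%R] <= leb A)%E.
Proof.
move=> c0; have [B [mB AB <-]] := lebesgue_hull A.
rewrite -(lebesgue_affine_measurable a c0 mB) lee_pmul2l//.
by apply: le_lebesgue => x; exact: AB.
Qed.

End lebesgue_outer_measure.

(** * One-dimensional rearrangements *)

Lemma esumZl_le (R : realType) (T : choiceType) (D : set T) (k : R)
    (a : T -> \bar R) : 0 <= k -> (forall i, (0 <= a i)%E) ->
  (\esum_(i in D) (k%:E * a i) <= k%:E * \esum_(i in D) a i)%E.
Proof.
move=> k0 a0; apply: ge_ereal_sup => _ [A [fA AD] <-].
rewrite -ge0_mule_fsumr// lee_wpmul2l// ?lee_fin//.
by apply: ereal_sup_ubound; exists A.
Qed.

Section one_variable.
Context {R : realType}.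
Implicit Types (g h : R -> \bar R) (N : set R) (t l : R).
Local Notation leb := (@lebesgue_measure R).

Definition level g l : set R :=
  [set x | unit_itv x /\ (l%:E < g (2 * pi * x)%R)%E].

Definition rearr1 g t : \bar R := rearrangement (fun x => g (2 * pi * x)) t.

Lemma twopi_gt0 : 0 < 2 * pi :> R.
Proof. by rewrite mulr_gt0// pi_gt0. Qed.

Lemma unit_period (x : R) : unit_itv x -> period_itv (2 * pi * x).
Proof.
have p0 := twopi_gt0; rewrite /unit_itv /period_itv /= !in_itv/= => /andP[x0 x1].
by rewrite mulr_ge0 ?(ltW p0)//= ler_piMr// ltW.
Qed.

Lemma rearr1_ge0 g t : (0 <= rearr1 g t)%E.
Proof.
apply: le_ereal_inf_tmp => _ [l [l0 _] <-].
by rewrite lee_fin ltW.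
Qed.

Lemma rearr1_lt g t l : (rearr1 g t < l%:E)%E -> (leb (level g l) < t%:E)%E.
Proof.
move=> /ereal_inf_lt[_ [l' [l'0 h] <-]]; rewrite lte_fin => l'l.
apply: le_lt_trans h; apply: le_lebesgue => x [ux lx]; split => //.
by apply: le_lt_trans lx; rewrite lee_fin ltW.
Qed.

Lemma rearr1_le g t (x : \bar R) : (0 <= x)%E ->
  (forall l, (x < l%:E)%E -> (leb (level g l) < t%:E)%E) -> (rearr1 g t <= x)%E.
Proof.
move=> x0 h; rewrite leNgt; apply/negP => xl.
have [l xl' lr] : exists2 l, (x < l%:E)%E & (l%:E < rearr1 g t)%E.
  case: x x0 {h} xl => [x| |] //= _; last first.
    by rewrite ltNge leey.
  case E : (rearr1 g t) => [y| |] //.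
    by rewrite lte_fin => xy; exists ((x + y) / 2); rewrite lte_fin; lra.
  by move=> _; exists (x + 1); rewrite ?ltry// lte_fin; lra.
have := h l xl'; apply/negP; rewrite -leNgt.
have l0 : 0 < l by rewrite -lte_fin (le_lt_trans x0).
rewrite leNgt; apply/negP => hl.
have : (rearr1 g t <= l%:E)%E by apply: ereal_inf_lbound; exists l.
by rewrite leNgt lr.
Qed.

Lemma rearr1_antitone g t t' : t <= t' -> (rearr1 g t' <= rearr1 g t)%E.
Proof.
move=> tt'; apply: rearr1_le; first exact: rearr1_ge0.
by move=> l /rearr1_lt/lt_le_trans; apply; rewrite lee_fin.
Qed.

Lemma lebesgue_scaled_null N : leb N = 0 -> leb [set x | N (2 * pi * x)] = 0.
Proof.
move=> N0; have := lebesgue_affine 0 N twopi_gt0; rewrite N0.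
under [X in leb X]eq_set do rewrite addr0.
rewrite pmule_rle0 ?lte_fin ?twopi_gt0// => h.
by apply/eqP; rewrite eq_le h measure_ge0.
Qed.

Lemma lebesgue_bigcup_count (I : countType) (F : I -> set R) :
  (leb (\bigcup_i F i) <= \esum_(i in [set: I]) leb (F i))%E.
Proof.
pose G n := if @pickle_inv I n is Some i then F i else set0.
have -> : \bigcup_i F i = \bigcup_n G n.
  apply/seteqP; split => x [].
    by move=> i _ Fx; exists (pickle i) => //; rewrite /G pickleK_inv.
  by move=> n _; rewrite /G; case: pickle_inv => // i Fx; exists i.
apply: le_trans (lebesgue_sigma_subadditive _) _.
rewrite nneseries_esumT//.
rewrite (esumID (range (@pickle I)))// setTI.
rewrite [X in (_ + X)%E]esum1 ?adde0; last first.
  move=> n [_ nI]; rewrite /G; case E : pickle_inv => [i|]; last exact: measure0.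
  by exfalso; apply: nI; exists i => //; have := @pickle_invK I n; rewrite E.
rewrite (@reindex_esum _ _ _ setT (range pickle) (@pickle I) (fun n => leb (G n)))//.
  by apply: le_esum => i _; rewrite /G pickleK_inv.
split; [by move=> i; exists i|by move=> i j _ _ /(pcan_inj pickleK)|].
by move=> _ [i _ <-]; exists i.
Qed.

(** Rearrangement turns a countable supremum into a supremum of rearrangements
    once the measure [t] is distributed among the functions.  Only countable
    subadditivity of the outer measure enters, so that no measurability is
    required, and the inequality can be iterated. *)
Lemma rearr1_sup_le (I : countType) (i0 : I) g (h : I -> R -> \bar R)
    (c eps : I -> R) N t :
  leb N = 0 -> (forall i, 0 < c i) -> (forall i, 0 < eps i) ->
  (\esum_(i in [set: I]) (eps i)%:E < 1)%E -> 0 < t ->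
  (forall x, period_itv x -> ~ N x ->
     (g x <= ereal_sup (range (fun i => (c i)%:E * h i x)))%E) ->
  (rearr1 g t <=
     ereal_sup (range (fun i => (c i)%:E * rearr1 (h i) (eps i * t)%R)))%E.
Proof.
move=> N0 c0 e0 eps1 t0 gh; apply: rearr1_le.
  apply: le_trans (ereal_sup_ubound _); last by exists i0.
  by rewrite mule_ge0 ?rearr1_ge0// lee_fin ltW.
move=> l lsup.
have small i : (leb (level (h i) (l / c i)) <= (eps i * t)%:E)%E.
  apply/ltW/rearr1_lt.
  rewrite [l / c i]mulrC EFinM lte_pdivlMl//; apply: le_lt_trans lsup.
  by apply: ereal_sup_ubound; exists i.
have sub : level g l `<=` [set x | N (2 * pi * x)] `|`
    \bigcup_i level (h i) (l / c i).
  move=> x [ux lx]; have [Nx|Nx] := pselect (N (2 * pi * x)); [by left|right].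
  have := lt_le_trans lx (gh _ (unit_period ux) Nx).
  move=> /ereal_sup_gt[_ [i _ <-]] lh; exists i => //; split => //.
  by rewrite [l / c i]mulrC EFinM lte_pdivrMl.
apply: le_lt_trans (le_lebesgue sub) _; apply: le_lt_trans (lebesgueU2 _ _) _.
rewrite lebesgue_scaled_null// add0e.
apply: le_lt_trans (lebesgue_bigcup_count _) _.
apply: (@le_lt_trans _ _ (\esum_(i in [set: I]) ((eps i)%:E * t%:E)%E)).
  by apply: le_esum => i _; rewrite -EFinM.
rewrite -[X in (_ < X)%E]mul1e.
under eq_esum do rewrite muleC.
apply: le_lt_trans (esumZl_le _ (ltW t0) _) _; first by move=> i; rewrite lee_fin ltW.
by rewrite muleC lte_pmul2r// lte_fin.
Qed.

Lemma le_rearr1_ae N g h t : leb N = 0 ->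
  (forall x, period_itv x -> ~ N x -> (g x <= h x)%E) ->
  (rearr1 g t <= rearr1 h t)%E.
Proof.
move=> N0 gh; apply: rearr1_le; first exact: rearr1_ge0.
move=> l /rearr1_lt; apply: le_lt_trans.
have sub : level g l `<=` [set x | N (2 * pi * x)] `|` level h l.
  move=> x [ux lx]; have [Nx|Nx] := pselect (N (2 * pi * x)); [by left|right].
  by split => //; apply: lt_le_trans lx (gh _ (unit_period ux) Nx).
apply: le_trans (le_lebesgue sub) _; apply: le_trans (lebesgueU2 _ _) _.
by rewrite lebesgue_scaled_null// add0e.
Qed.

(** By periodicity the translate of a level set is cut at the end of the
    period into two pieces, which are translates of the parts of the level
    set on either side of [a]. A half-line splits outer measure additively. *)
Lemma lebesgue_level_translate g (a l : R) : 0 <= a <= 1 ->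
  (forall x, g (x + 2 * pi) = g x) ->
  (leb (level (fun x => g (x + 2 * pi * a)%R) l) <= leb (level g l))%E.
Proof.
move=> /andP[a0 a1] gp.
pose S := level g l.
pose A := [set x | (S `&` `[a, +oo[) (1 * x + a)].
pose B := [set x | (S `&` ~` `[a, +oo[) (1 * x + (a - 1))].
have sub : level (fun x => g (x + 2 * pi * a)%R) l `<=` [set 1] `|` (A `|` B).
  move=> x [/=]; rewrite /unit_itv /= in_itv/= => /andP[x0 x1] lx.
  have [->|x1'] := eqVneq x 1; [by left|right].
  have {x1 x1'} x1 : x < 1 by rewrite lt_neqAle x1'.
  have [xa|xa] := leP (x + a) 1; [left|right]; rewrite /A /B /= /S /level/= mul1r.
    split; last by rewrite in_itv/= andbT; lra.
    split; first by rewrite /unit_itv/= in_itv/=; apply/andP; split; lra.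
    by rewrite mulrDr.
  split; last by rewrite in_itv/= andbT => h; lra.
  split; first by rewrite /unit_itv/= in_itv/=; apply/andP; split; lra.
  by rewrite -gp (_ : 2 * pi * _ + _ = 2 * pi * x + 2 * pi * a)//; ring.
apply: le_trans (le_lebesgue sub) _; apply: le_trans (lebesgueU2 _ _) _.
rewrite lebesgue_measure_set1 add0e; apply: le_trans (lebesgueU2 _ _) _.
rewrite (lebesgue_caratheodory (level g l) (measurable_itv `[a, +oo[)).
apply: leeD.
  by have := lebesgue_affine a (S `&` `[a, +oo[) ltr01; rewrite mul1e.
by have := lebesgue_affine (a - 1) (S `&` ~` `[a, +oo[) ltr01; rewrite mul1e.
Qed.

Lemma rearr1_translate g (a t : R) : 0 <= a <= 1 ->
  (forall x, g (x + 2 * pi) = g x) ->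
  (rearr1 (fun x => g (x + 2 * pi * a)%R) t <= rearr1 g t)%E.
Proof.
move=> a01 gp; apply: rearr1_le; first exact: rearr1_ge0.
move=> l /rearr1_lt; apply: le_lt_trans; exact: lebesgue_level_translate.
Qed.

Definition cell_constant (M : nat) (G : R -> \bar R) := forall x y : R,
  Num.floor (M%:R * x) = Num.floor (M%:R * y) -> G (2 * pi * x) = G (2 * pi * y).

(** The level sets of a function that is constant on the cells of mesh [1/M]
    are unions of cells, so they have measure [0] or at least [1/M]. *)
Lemma rearr1_cell (M : nat) g t : (0 < M)%N -> cell_constant M g -> 0 < t ->
  (rearr1 g t <= rearr1 g (Num.max t M%:R^-1)%R)%E.
Proof.
move=> M0 gM t0; have [//|tM] := leP M%:R^-1 t.
have M0' : 0 < M%:R :> R by rewrite ltr0n.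
apply: rearr1_le; first exact: rearr1_ge0.
move=> l /rearr1_lt lM.
suff sub : level g l `<=` [set 1].
  by rewrite (le_lt_trans (le_lebesgue sub))// lebesgue_measure_set1 lte_fin.
move=> x gx; have [//|x1] := eqVneq x 1.
exfalso; move: lM; apply/negP; rewrite -leNgt.
have [/=] := gx; rewrite /unit_itv/= in_itv/= => /andP[x0 x1'] lx.
have {x1 x1'} x1 : x < 1 by rewrite lt_neqAle x1.
pose k := Num.floor (M%:R * x).
have k0 : 0 <= k by rewrite floor_ge0 mulr_ge0// ltW.
have kM : k < M%:Z by rewrite -(ltr_int R) (le_lt_trans (floor_le _))// -[ltRHS]mulr1 ltr_pM2l.
have sub : `[k%:~R / M%:R, (k%:~R + 1) / M%:R[%classic `<=` level g l.
  move=> y /=; rewrite in_itv/= ler_pdivrMr// ltr_pdivlMr// => /andP[ky yk].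
  split.
    rewrite /unit_itv/= in_itv/=.
    have : k%:~R + 1 <= M%:R :> R by rewrite -[1]/(1%:~R) -intrD -[M%:R]/(M%:Z%:~R) ler_int; lia.
    have : 0 <= k%:~R :> R by rewrite ler0z.
    move=> k0' kM'; apply/andP; split.
      by rewrite -(pmulr_lge0 _ M0') (le_trans k0')// mulrC.
    by rewrite -(ler_pM2r M0') mul1r (le_trans (ltW yk)).
  rewrite (gM y x)// -/k; apply: floor_def.
  by rewrite mulrC ky intrD.
rewrite (le_trans _ (le_lebesgue sub))// lebesgue_measure_itv/= lte_fin.
rewrite ltr_pM2r ?invr_gt0// ltrDl ltr01 -EFinD -mulrBl [k%:~R + 1]addrC addrK.
by rewrite mul1r.
Qed.

Lemma nneseriesS_le (h : (\bar R)^nat) : (forall i, (0 <= h i)%E) ->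
  (h 0%N + \sum_(i <oo) h i.+1 <= \sum_(i <oo) h i)%E.
Proof.
move=> h0; rewrite [leRHS]nneseries_recl// leeD2l//.
apply: lime_le; first by apply: is_cvg_nneseries.
near=> n.
rewrite -(big_add1 _ _ 0 n.+1 xpredT h).
by apply: nneseries_lim_ge.
Unshelve. all: by end_near. Qed.
Local Notation per := (@period_itv R).

Lemma lebesgue_period : leb per = (2 * pi)%:E.
Proof.
rewrite /period_itv lebesgue_measure_itv/= lte_fin twopi_gt0.
by rewrite -EFinD subr0.
Qed.

(** A point between the levels [b i] and [b i.+1] is charged the value
    [b i.+1] and lies in the [i]-th superlevel set; the points above all of
    the levels form a null set. *)
Lemma integral_le_levels g (b e : R ^nat) :
  measurable_fun [set: R] g -> (forall x, 0 <= g x)%E -> (forall i, 0 <= b i) ->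
  (forall i, leb (level g (b i)) <= (e i)%:E)%E -> e @ \oo --> 0 ->
  (\int[leb]_(x in per) g x <= (2 * pi)%:E *
     ((b 0%N)%:E + \sum_(i <oo) (b i.+1 * e i)%:E))%E.
Proof.
move=> mg g0 b0 be e0.
have e_ge0 i : 0 <= e i by rewrite -lee_fin (le_trans _ (be i)).
have mper : measurable (per : set R) by exact: measurable_itv.
pose E i := per `&` [set x | ((b i)%:E < g x)%E].
have mE i : measurable (E i) by apply: emeasurable_fun_o_infty => //; exact: measurable_funTS.
have lE i : (leb (E i) <= (2 * pi * e i)%:E)%E.
  have p0 := twopi_gt0.
  rewrite EFinM; apply: (@le_trans _ _ ((2 * pi)%:E * leb (level g (b i))))%E; last first.
    by rewrite lee_pmul2l ?be ?lte_fin ?twopi_gt0//.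
  rewrite -(lebesgue_affine_measurable 0 p0 (mE i)) lee_pmul2l//.
  apply: le_lebesgue => x [/=]; rewrite addr0 => px lx; split => //.
  move: px; rewrite /period_itv /unit_itv/= !in_itv/= pmulr_rge0// => /andP[-> /=].
  by rewrite -[leRHS]mulr1 ler_pM2l.
have neg : leb (\bigcap_i E i) = 0.
  apply/eqP; rewrite eq_le measure_ge0 andbT; apply/lee_addgt0Pr => d d0; rewrite add0e.
  have p0 := twopi_gt0.
  have [i _ /(_ i (leqnn i)) /= hi] : \forall i \near \oo, e i < d / (2 * pi).
    by apply: (cvgr_lt 0) e0 _ _; rewrite divr_gt0.
  apply: le_trans (le_lebesgue (@bigcap_inf _ _ i _ _ _)) _ => //.
  by rewrite (le_trans (lE i))// lee_fin mulrC -ler_pdivlMr// ltW.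
pose S x := ((b 0%N)%:E + \sum_(i <oo) (b i.+1)%:E * (\1_(E i) x)%:E)%E.
have S0 x : (0 <= S x)%E.
  rewrite adde_ge0 ?lee_fin//; apply: nneseries_ge0 => i _ _.
  by rewrite -EFinM lee_fin mulr_ge0.
have mind i : measurable_fun per (fun x => (\1_(E i) x)%:E).
  by apply/measurable_EFinP; exact: measurable_indic.
have mterm i : measurable_fun per (fun x => (b i.+1)%:E * (\1_(E i) x)%:E)%E.
  by apply: measurable_funeM; apply/measurable_EFinP; exact: measurable_indic.
have msum : measurable_fun per (fun x => \sum_(i <oo) (b i.+1)%:E * (\1_(E i) x)%:E)%E.
  by apply: ge0_emeasurable_sum => // k x _ _; rewrite -EFinM lee_fin mulr_ge0.
have mS : measurable_fun per S by apply: emeasurable_funD.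
apply: (@le_trans _ _ (\int[leb]_(x in per) S x)%E).
  apply: ae_ge0_le_integral => //; first exact: measurable_funTS.
  exists (\bigcap_i E i); split => //; first exact: bigcapT_measurable.
  move=> x /= /not_implyP[px gS]; apply: contrapT => nE; apply: gS.
  have [g0'|g0'] := leP (g x) (b 0%N)%:E.
    apply: (le_trans g0'); rewrite leeDl//; apply: nneseries_ge0 => i _ _.
    by rewrite -EFinM lee_fin mulr_ge0.
  have [i [Ei nEi]] : exists i, E i x /\ ~ E i.+1 x.
    apply: contrapT => h; apply: nE => i _; elim: i => [//|i IH].
    by apply: contrapT => h2; apply: h; exists i.
  have gb : (g x <= (b i.+1)%:E)%E by rewrite leNgt; apply/negP => ?; apply: nEi.
  apply: (le_trans gb); rewrite /S.
  apply: (@le_trans _ _ (\sum_(i <oo) (b i.+1)%:E * (\1_(E i) x)%:E)%E); last first.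
    by rewrite leeDr// lee_fin.
  apply: (@le_trans _ _ (\sum_(0 <= i < i.+1) (b i.+1)%:E * (\1_(E i) x)%:E)%E); last first.
    by apply: nneseries_lim_ge => k _; rewrite -EFinM lee_fin mulr_ge0.
  rewrite big_nat_recr//= indicE mem_set// mule1 leeDr//.
  by apply: sume_ge0 => k _; rewrite -EFinM lee_fin mulr_ge0.
rewrite ge0_integralD//; last first.
- by move=> x _; apply: nneseries_ge0 => i _ _; rewrite -EFinM lee_fin mulr_ge0.
- by move=> x _; rewrite lee_fin.
rewrite integral_cst// [X in (_ * X)%E]lebesgue_period.
rewrite integral_nneseries//; last by move=> k x _; rewrite -EFinM lee_fin mulr_ge0.
rewrite muleDr ?fin_num_adde_defr// muleC leeD2l//.
rewrite -nneseriesZl//; last by move=> i _; rewrite lee_fin mulr_ge0.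
apply: lee_nneseries => [i _ _|i _].
  by apply: integral_ge0 => x _; rewrite -EFinM lee_fin mulr_ge0.
rewrite ge0_integralZl_EFin//; last exact: mind.
have -> : (\int[leb]_(x in per) (\1_(E i) x)%:E)%E = leb (E i).
  rewrite (integral_indic leb mper (mE i)); congr (leb _).
  by apply: setIidl => x [].
rewrite -EFinM mulrCA EFinM.
by rewrite lee_wpmul2l// lee_fin.
Qed.

(** If [S] is the supremum, the set where [g] is slightly above [S / w i]
    has measure less than [2 ^- i], so the layers cost at most a multiple of
    [S] times the sum of [2 ^- i / w i]. In the form of a supremum the bound
    survives further rearrangements. *)
Lemma integral_le_rearr1 g (w : R ^nat) (K : R) :
  measurable_fun [set: R] g -> (forall x, 0 <= g x)%E -> (forall i, 0 < w i) ->
  (\sum_(i <oo) (2^-1 ^+ i / w i)%:E <= K%:E)%E ->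
  (\int[leb]_(x in per) g x <= (4 * pi * K)%:E *
     ereal_sup (range (fun i => (w i)%:E * rearr1 g (2^-1 ^+ i)%R)))%E.
Proof.
move=> mg g0 w0 wK.
set S := ereal_sup _.
have term_ge0 i : 0 <= 2^-1 ^+ i / w i :> R by rewrite divr_ge0 ?exprn_ge0// ltW.
have K1 : 1 / w 0%N <= K.
  rewrite -lee_fin (le_trans _ wK)//.
  apply: (@le_trans _ _ (\sum_(0 <= i < 1) (2^-1 ^+ i / w i)%:E)%E).
    by rewrite big_nat1 expr0.
  by apply: nneseries_lim_ge => k _; rewrite lee_fin.
have K0 : 0 < K by apply: lt_le_trans K1; rewrite divr_gt0.
have S0 : (0 <= S)%E.
  apply: le_trans (ereal_sup_ubound _); last by exists 0%N.
  by rewrite mule_ge0 ?rearr1_ge0// lee_fin ltW.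
have p0 := pi_gt0 R.
have pK : 0 < 4 * pi * K by rewrite !mulr_gt0.
case ES : S S0 => [s| |] //; last by rewrite gt0_muley ?leey// lte_fin.
rewrite lee_fin => s0.
rewrite -EFinM; apply/lee_addgt0Pr => d d0.
pose s' := s + d / (4 * pi * K).
have ss' : s < s' by rewrite ltrDl divr_gt0.
have s'0 : 0 <= s' by rewrite ltW// (le_lt_trans s0).
pose b i := s' / w i.
have hb i : (leb (level g (b i)) <= (2^-1 ^+ i)%:E)%E.
  apply/ltW/rearr1_lt; rewrite /b mulrC EFinM lte_pdivlMl//.
  apply: (@le_lt_trans _ _ S); last by rewrite ES lte_fin.
  by apply: ereal_sup_ubound; exists i.
have e0 : (fun i => 2^-1 ^+ i : R) @ \oo --> (0 : R).
  by apply: cvg_expr; rewrite ger0_norm ?invr_ge0// invf_lt1// ltr1n.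
have b0 i : 0 <= b i by rewrite divr_ge0// ltW.
apply: le_trans (integral_le_levels mg g0 b0 hb e0) _.
have -> : ((4 * pi * K * s)%:E + d%:E = (2 * pi)%:E * ((2 * s')%:E * K%:E))%E.
  have aux (p : R) : 0 < p -> 4 * p * K * s + d = 2 * p * (2 * (s + d / (4 * p * K)) * K).
    by move=> p_gt0; field; rewrite !gt_eqF.
  by rewrite -EFinD -!EFinM (aux _ p0).
rewrite lee_pmul2l ?lte_fin ?mulr_gt0//.
apply: (@le_trans _ _ (\sum_(i <oo) (2 * s')%:E * (2^-1 ^+ i / w i)%:E)%E); last first.
  rewrite nneseriesZl//; last by move=> i _; rewrite lee_fin.
  by rewrite lee_wpmul2l// lee_fin mulr_ge0.
have h_ge0 i : (0 <= (2 * s')%:E * (2^-1 ^+ i / w i)%:E)%E.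
  by rewrite -EFinM lee_fin !mulr_ge0// ?exprn_ge0// invr_ge0 ltW.
apply: le_trans (nneseriesS_le h_ge0); apply: leeD.
  by rewrite -EFinM lee_fin /b expr0 mulrA mulr1 ler_wpM2r ?invr_ge0 ?ltW//; lra.
apply: lee_nneseries => i _; first by rewrite lee_fin mulr_ge0// exprn_ge0.
rewrite -EFinM lee_fin /b exprS le_eqVlt; apply/orP; left; apply/eqP; field.
by rewrite gt_eqF.
Qed.

End one_variable.

(** * Products and sections of the torus *)

Section tuples.
Context {R : realType}.
Implicit Types (m : nat).
Local Notation leb := (@lebesgue_measure R).
Local Notation per := (@period_itv R).

Lemma tnth_cons0 m (x : R) (x' : m.-tuple R) : tnth (cons_pair (x, x')) ord0 = x.
Proof. by rewrite /cons_pair tnth0. Qed.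

Lemma tnth_consS m (x : R) (x' : m.-tuple R) j :
  tnth (cons_pair (x, x')) (lift ord0 j) = tnth x' j.
Proof. by rewrite /cons_pair tnthS. Qed.

Lemma forall_ordS m (P : 'I_m.+1 -> Prop) :
  (forall j, P j) <-> P ord0 /\ forall j, P (lift ord0 j).
Proof.
split=> [h|[h0 hS] j]; first by split.
by case: (unliftP ord0 j) => [i|] ->.
Qed.

Lemma torus_cons m (x : R) (x' : m.-tuple R) :
  torus (cons_pair (x, x')) <-> per x /\ torus x'.
Proof.
rewrite /torus /= forall_ordS tnth_cons0.
by split=> -[h0 hS]; split => // j; move: (hS j); rewrite tnth_consS.
Qed.

Lemma measurable_torus m : measurable (@torus R m).
Proof.
have -> : @torus R m = \bigcap_(j in [set: 'I_m]) ((fun x => tnth x j) @^-1` per).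
  by apply/seteqP; split => x h j; [move=> _|]; exact: h.
apply: fin_bigcap_measurable => // j _.
by rewrite -[X in measurable X]setTI; apply: measurable_tnth => //; exact: measurable_itv.
Qed.

Section tonelli.
Variables (m : nat) (F : m.+1.-tuple R -> \bar R).
Hypotheses (mF : measurable_fun setT F) (F0 : forall x, (0 <= F x)%E).

Lemma measurable_fun_cons : measurable_fun setT (F \o (@cons_pair R m)).
Proof. by apply: measurableT_comp => //; exact: measurable_cons_pair. Qed.

Lemma measurable_fun_section1 (x : R) : measurable_fun setT (fun x' => F (cons_pair (x, x'))).
Proof. exact: (measurable_fun_pair2 x measurable_fun_cons). Qed.

Lemma measurable_fun_section2 x' : measurable_fun setT (fun x : R => F (cons_pair (x, x'))).
Proof. exact: (measurable_fun_pair1 x' measurable_fun_cons). Qed.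

Lemma integral_lebesgue_tuple_prod :
  (\int[lebesgue_tuple R m.+1]_x F x =
   \int[(leb \x lebesgue_tuple R m)%E]_p F (cons_pair p))%E.
Proof.
pose mu : {measure set (measurableTypeR R * m.-tuple R) -> \bar R} :=
  (leb \x lebesgue_tuple R m)%E.
have := @ge0_integral_pushforward _ _ (measurableTypeR R * m.-tuple R)%type _ R
  (@cons_pair R m) (@measurable_cons_pair R m) mu _ _ measurableT mF (fun x _ => F0 x).
by rewrite preimage_setT => <-.
Qed.

Lemma tonelli_tuple1 :
  (\int[lebesgue_tuple R m.+1]_x F x =
   \int[leb]_x \int[lebesgue_tuple R m]_x' F (cons_pair (x, x')))%E.
Proof.
rewrite integral_lebesgue_tuple_prod fubini_tonelli1//.
exact: measurable_fun_cons.
Qed.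

Lemma tonelli_tuple2 :
  (\int[lebesgue_tuple R m.+1]_x F x =
   \int[lebesgue_tuple R m]_x' \int[leb]_x F (cons_pair (x, x')))%E.
Proof.
rewrite integral_lebesgue_tuple_prod fubini_tonelli2//.
exact: measurable_fun_cons.
Qed.

Lemma measurable_fun_tonelli1 :
  measurable_fun setT (fun x : R => \int[lebesgue_tuple R m]_x' F (cons_pair (x, x')))%E.
Proof.
exact: (@measurable_fun_fubini_tonelli_F _ _ (measurableTypeR R) _ R
  (lebesgue_tuple R m) (F \o @cons_pair R m) measurable_fun_cons (fun p => F0 _)).
Qed.

Lemma measurable_fun_tonelli2 :
  measurable_fun setT (fun x' => \int[leb]_x F (cons_pair (x, x')))%E.
Proof.
exact: (@measurable_fun_fubini_tonelli_G _ _ (measurableTypeR R) _ R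
  leb (F \o @cons_pair R m) measurable_fun_cons (fun p => F0 _)).
Qed.

End tonelli.

Lemma tonelli_torus m (F : m.+1.-tuple R -> \bar R) :
  measurable_fun setT F -> (forall x, (0 <= F x)%E) ->
  (\int[lebesgue_tuple R m.+1]_(x in @torus R m.+1) F x =
   \int[lebesgue_tuple R m]_(x' in @torus R m)
      \int[leb]_(x in per) F (cons_pair (x, x')))%E.
Proof.
move=> mF F0; rewrite [LHS]integral_mkcond tonelli_tuple2; last 2 first.
- by apply/(measurable_restrictT _ _).1 => //; [exact: measurable_torus|exact: measurable_funTS].
- by move=> x; exact: erestrict_ge0.
rewrite [RHS]integral_mkcond; apply: eq_integral => x' _.
rewrite [RHS]patchE; have [tx'|tx'] := pselect (torus x'); last first.
  rewrite memNset//; apply: integral0_eq => x _.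
  by rewrite patchE memNset// torus_cons => -[].
rewrite mem_set// [RHS]integral_mkcond; apply: eq_integral => x _.
rewrite !patchE; have [px|px] := pselect (per x).
  by rewrite !mem_set//; apply/torus_cons.
by rewrite !memNset// torus_cons => -[].
Qed.

(** Almost all sections of a null set are null.  This is how an inequality
    valid almost everywhere passes through the successive rearrangements. *)
Lemma null_sections m (N : set (m.+1.-tuple R)) : measurable N ->
  lebesgue_tuple R m.+1 N = 0 ->
  exists N', [/\ measurable N', lebesgue_tuple R m N' = 0 &
    forall x', ~ N' x' -> leb [set x | N (cons_pair (x, x'))] = 0].
Proof.
move=> mN N0.
pose F := (fun x => (\1_N x)%:E) : m.+1.-tuple R -> \bar R.
have mF : measurable_fun setT F by apply/measurable_EFinP; exact: measurable_indic.
have F0 x : (0 <= F x)%E by rewrite lee_fin.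
have mG := measurable_fun_tonelli2 mF F0.
set G := (X in measurable_fun _ X) in mG.
have GE x' : G x' = leb [set x | N (cons_pair (x, x'))].
  have mS : measurable [set x : measurableTypeR R | N (cons_pair (x, x'))].
    rewrite -[X in measurable X]setTI.
    apply: (measurable_fun_pair1 x' (@measurable_cons_pair R m)) => //.
  by have := integral_indic leb measurableT mS; rewrite setIT => <-.
exists [set x' | (0 < G x')%E]; split.
- rewrite -[X in measurable X]setTI; apply: emeasurable_fun_o_infty => //.
- apply/eqP; rewrite eq_le measure_ge0 andbT.
  have : ae_eq (lebesgue_tuple R m) setT G (cst 0%E).
    apply/(ae_eq_integral_abs _ measurableT mG).
    rewrite -[RHS]N0 -[in RHS](setIT N) -integral_indic// tonelli_tuple2//.
    by apply: eq_integral => x' _; rewrite gee0_abs// GE measure_ge0.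
  case=> A [mA A0 sub]; rewrite -[X in (_ <= X)%E]A0; apply: le_measure; rewrite ?inE//.
    by rewrite -[X in measurable X]setTI; apply: emeasurable_fun_o_infty.
  by move=> x' /= G0; apply: sub => /= /(_ Logic.I) G0'; move: G0; rewrite G0' ltxx.
- move=> x' h; apply/eqP; rewrite eq_le measure_ge0 andbT leNgt -GE.
  exact/negP.
Qed.

End tuples.

(** * Iterated rearrangements *)

Section iterated.
Context {R : realType}.
Implicit Types (m : nat).
Local Notation leb := (@lebesgue_measure R).
Local Notation per := (@period_itv R).

(** Peeling off the first variable makes the inner rearrangement a function
    of the remaining ones. The dimension can then be handled by induction,
    and no measurability of this function has to be carried along. *)
Fixpoint torus_rearr m : (m.-tuple R -> \bar R) -> ('I_m -> R) -> \bar R :=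
  match m with
  | 0%N => fun F t => F [tuple]
  | m'.+1 => fun F t =>
      torus_rearr (fun x' => rearr1 (fun x => F (cons_pair (x, x'))) (t ord0))
        (fun j => t (lift ord0 j))
  end.

Lemma torus_rearr_ge0 m (F : m.-tuple R -> \bar R) t :
  (forall x, (0 <= F x)%E) -> (0 <= torus_rearr F t)%E.
Proof.
elim: m F t => [|m IH] F t F0 /=; first exact: F0.
by apply: IH => x'; exact: rearr1_ge0.
Qed.

Lemma lebesgue_tuple0_nonnull (N : set (0.-tuple R)) x :
  measurable N -> lebesgue_tuple R 0 N = 0 -> ~ N x.
Proof.
move=> mN; rewrite /lebesgue_tuple /= diracE => /eqP + Nx.
by rewrite mem_set ?onee_eq0// -(tuple0 x).
Qed.

Lemma le_torus_rearr_ae m (N : set (m.-tuple R)) (F G : m.-tuple R -> \bar R) t :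
  measurable N -> lebesgue_tuple R m N = 0 ->
  (forall x, torus x -> ~ N x -> (F x <= G x)%E) ->
  (torus_rearr F t <= torus_rearr G t)%E.
Proof.
elim: m N F G t => [|m IH] N F G t mN N0 FG /=.
  by apply: FG; [case|exact: lebesgue_tuple0_nonnull].
have [N' [mN' N'0 N'N]] := null_sections mN N0.
apply: (IH N') => // x' tx' /N'N Nx'.
apply: (le_rearr1_ae _ Nx') => x px Nx.
by apply: FG => //; apply/torus_cons.
Qed.

Lemma le_torus_rearr m (F G : m.-tuple R -> \bar R) t :
  (forall x, (F x <= G x)%E) -> (torus_rearr F t <= torus_rearr G t)%E.
Proof.
by move=> FG; apply: (@le_torus_rearr_ae _ set0) => //; rewrite measure0.
Qed.

Lemma torus_rearr_antitone m (F : m.-tuple R -> \bar R) t t' :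
  (forall j, t j <= t' j) -> (torus_rearr F t' <= torus_rearr F t)%E.
Proof.
elim: m F t t' => [|m IH] F t t' tt' //=.
apply: le_trans (IH _ _ _ _) _; first by move=> j; exact: tt'.
by apply: le_torus_rearr => x'; exact: rearr1_antitone.
Qed.

(** The same weights [eps] serve in each variable: after one rearrangement
    there is again a supremum over [I], with every [H i] replaced by its
    rearrangement. Applying the weights once per variable is what dilates
    all of the arguments. *)
Lemma torus_rearr_sup_le m (I : countType) (i0 : I) (N : set (m.-tuple R))
    (F : m.-tuple R -> \bar R) (H : I -> m.-tuple R -> \bar R)
    (c eps : I -> R) t :
  measurable N -> lebesgue_tuple R m N = 0 ->
  (forall i, 0 < c i) -> (forall i, 0 < eps i) ->
  (\esum_(i in [set: I]) (eps i)%:E < 1)%E -> (forall j, 0 < t j) ->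
  (forall x, torus x -> ~ N x ->
     (F x <= ereal_sup (range (fun i => (c i)%:E * H i x)))%E) ->
  (torus_rearr F t <=
     ereal_sup (range (fun i =>
       (c i)%:E * torus_rearr (H i) (fun j => eps i * t j)%R)))%E.
Proof.
move=> + + c0 e0 e1; elim: m N F H t => [|m IH] N F H t mN N0 t0 FH /=.
  by apply: FH; [case|exact: lebesgue_tuple0_nonnull].
have [N' [mN' N'0 N'N]] := null_sections mN N0.
apply: (IH N') => // x' tx' /N'N Nx'.
apply: (rearr1_sup_le i0 Nx') => // x px Nx.
by apply: FH => //; apply/torus_cons.
Qed.

(** The rearrangement in one variable inherits the periodicity in the
    others. *)
Lemma torus_rearr_translate m (F : m.-tuple R -> \bar R) (a t : 'I_m -> R) :
  (forall x j, F (set_tnth x j (tnth x j + 2 * pi)) = F x) ->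
  (forall j, 0 <= a j <= 1) ->
  (torus_rearr (fun x => F [tuple (tnth x j + 2 * pi * a j)%R | j < m]) t <=
   torus_rearr F t)%E.
Proof.
elim: m F a t => [|m IH] F a t Fp a01 /=.
  by rewrite (tuple0 [tuple _ | _ < _]).
pose G x' := rearr1 (fun x => F (cons_pair (x, x'))) (t ord0).
apply: le_trans (_ : _ <= torus_rearr (fun x' =>
  G [tuple (tnth x' j + 2 * pi * a (lift ord0 j))%R | j < m])
    (fun j => t (lift ord0 j)))%E _.
  apply: le_torus_rearr => x'.
  have E : (fun x : R => F [tuple (tnth (cons_pair (x, x')) j + 2 * pi * a j)%R | j < m.+1]) =
    (fun x => (fun y => F (cons_pair (y,
      [tuple (tnth x' j + 2 * pi * a (lift ord0 j))%R | j < m]))) (x + 2 * pi * a ord0)%R).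
    apply/funext => x; congr F; apply: eq_from_tnth => j.
    rewrite tnth_mktuple; case: (unliftP ord0 j) => [i|] ->.
      by rewrite !tnth_consS tnth_mktuple.
    by rewrite !tnth_cons0.
  rewrite E; apply: rearr1_translate => // y.
  rewrite -(Fp (cons_pair (y, _)) ord0); congr F; apply: eq_from_tnth => j.
  rewrite tnth_mktuple; case: (unliftP ord0 j) => [i|] ->.
    by rewrite !tnth_consS.
  by rewrite !tnth_cons0 eqxx.
apply: IH => // x' j; rewrite /G; congr (rearr1 _ _); apply/funext => x.
rewrite -(Fp (cons_pair (x, x')) (lift ord0 j)); congr F; apply: eq_from_tnth => i.
rewrite tnth_mktuple; case: (unliftP ord0 i) => [k|] ->.
  by rewrite !tnth_consS !tnth_mktuple (inj_eq lift_inj).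
by rewrite !tnth_cons0.
Qed.

(** The rearrangement in one variable is still constant on the cells of the
    others. *)
Lemma torus_rearr_cell m (M : 'I_m -> nat) (F : m.-tuple R -> \bar R) t :
  (forall j, (0 < M j)%N) -> (forall j, 0 < t j) ->
  (forall x y : m.-tuple R,
     (forall j, Num.floor ((M j)%:R * tnth x j) = Num.floor ((M j)%:R * tnth y j)) ->
     F [tuple 2 * pi * tnth x j | j < m] = F [tuple 2 * pi * tnth y j | j < m]) ->
  (torus_rearr F t <= torus_rearr F (fun j => Num.max (t j) (M j)%:R^-1)%R)%E.
Proof.
have consE n (x : R) (x' : n.-tuple R) :
    [tuple (2 * pi * tnth (cons_pair (x, x')) j)%R | j < n.+1] =
    cons_pair ((2 * pi * x)%R, [tuple (2 * pi * tnth x' j)%R | j < n]).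
  apply: eq_from_tnth => j; rewrite tnth_mktuple.
  case: (unliftP ord0 j) => [i|] ->; last by rewrite !tnth_cons0.
  by rewrite !tnth_consS tnth_mktuple.
have scaleK n (x' : n.-tuple R) :
    x' = [tuple (2 * pi * tnth [tuple (tnth x' j / (2 * pi))%R | j < n] j)%R | j < n].
  apply: eq_from_tnth => j; rewrite !tnth_mktuple mulrC divfK//.
  by rewrite gt_eqF ?twopi_gt0.
elim: m M F t => [|m IH] M F t M0 t0 Fc //=.
apply: le_trans (_ : _ <= torus_rearr (fun x' =>
  rearr1 (fun x => F (cons_pair (x, x'))) (Num.max (t ord0) (M ord0)%:R^-1)%R)
    (fun j => t (lift ord0 j)))%E _.
  apply: le_torus_rearr => x'; apply: rearr1_cell => // x y xy.
  rewrite (scaleK _ x') -!consE; apply: Fc => j.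
  by case: (unliftP ord0 j) => [i|] ->; rewrite ?tnth_consS ?tnth_cons0.
apply: (IH (fun j => M (lift ord0 j))) => // x y xy.
congr (rearr1 _ _); apply/funext => z.
have -> : z = (2 * pi * (z / (2 * pi)))%R.
  by rewrite mulrC divfK// gt_eqF ?twopi_gt0.
rewrite -!consE; apply: Fc => j.
by case: (unliftP ord0 j) => [i|] ->; rewrite ?tnth_consS ?tnth_cons0.
Qed.

End iterated.

(** * Integration against the iterated rearrangement *)

Section geometric.
Context {R : realType}.

(** It lets a geometric decay [q ^ d] be shared among [n] factors [eta ^ d],
    some of which pay for the summability of weights. *)
Lemma exists_root_ge (q : R) n : 0 < q < 1 -> exists2 eta : R, 0 < eta < 1 & q <= eta ^+ n.
Proof.
move=> /andP[q0 q1].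
have n0 : 0 < n.+1%:R :> R by rewrite ltr0n.
have [d [d0 d1 dn]] : exists d : R, [/\ 0 < d, d < 1 & n%:R * d <= 1 - q].
  exists ((1 - q) / n.+1%:R); split.
  - by rewrite divr_gt0// subr_gt0.
  - by rewrite ltr_pdivrMr// mul1r (@lt_le_trans _ _ 1)// ?ler1n//; lra.
  - rewrite mulrCA ler_piMr// ?subr_ge0 1?ltW//.
    by rewrite ltr_pdivrMr// mul1r ltr_nat.
exists (1 - d); first by apply/andP; split; lra.
(* Bernoulli's inequality *)
suff bern k : 1 - k%:R * d <= (1 - d) ^+ k by apply: le_trans (bern n); lra.
elim: k => [|k IH]; first by rewrite mul0r subr0 expr0.
apply: (@le_trans _ _ ((1 - d) * (1 - k%:R * d))).
  rewrite -[k.+1]addn1 natrD; have : 0 <= k%:R * d * d by rewrite !mulr_ge0// ltW.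
  nra.
by rewrite exprS ler_wpM2l//; lra.
Qed.

Lemma nneseries_geometric (a q : R) : 0 <= a -> 0 <= q < 1 ->
  (\sum_(i <oo) (a * q ^+ i)%:E = (a / (1 - q))%:E)%E.
Proof.
move=> a0 /andP[q0 q1].
have h : series (geometric a q) @ \oo --> a / (1 - q).
  by apply: cvg_geometric_series; rewrite ger0_norm.
apply: cvg_lim => //.
have -> : (fun n => (\sum_(0 <= i < n) (a * q ^+ i)%:E)%E) = EFin \o series (geometric a q).
  by apply/funext => n; rewrite sumEFin.
by apply: cvg_EFin => //; exact: nearW.
Qed.

End geometric.

Section torus_integral.
Context {R : realType}.
Local Notation leb := (@lebesgue_measure R).
Local Notation per := (@period_itv R).

(** A function whose iterated rearrangement is at most [A] times the product
    of the [kappa_j] is integrable with a norm controlled by [A].  The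
    integration in the first variable is bounded by a countable supremum of
    rearrangements, to which the remaining rearrangements can be applied
    without any knowledge about their measurability. *)
Lemma integral_torus_le_rearr m (b K : R) : 0 < b < 2 -> 0 < K ->
  exists2 C : R, 0 < C & forall (kappa : 'I_m -> R -> R) (F : m.-tuple R -> \bar R) (A : R),
  (forall j v, 0 < v -> 0 < kappa j v) ->
  (forall j e v, 0 < e <= 1 -> 0 < v -> kappa j (e * v) <= e^-1 * kappa j v) ->
  (forall j i, kappa j (2^-1 ^+ i) <= K * b ^+ i) ->
  measurable_fun setT F -> (forall x, (0 <= F x)%E) -> 0 <= A ->
  (forall v, (forall j, 0 < v j <= 1) ->
     (torus_rearr F v <= (A * \prod_j kappa j (v j))%:E)%E) ->
  (\int[lebesgue_tuple R m]_(x in @torus R m) F x <= (C * A)%:E)%E.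
Proof.
move=> /andP[b0 b2] K0; elim: m => [|m [C C0 IH]].
  exists 1 => // kappa F A _ _ _ mF F0 A0 /(_ (fun=> 1)).
  rewrite big_ord0 mulr1 mul1r /= => h.
  rewrite [X in (X <= _)%E](_ : _ = F [tuple]); last first.
    rewrite /lebesgue_tuple/= integral_dirac//; last exact: measurable_funTS.
      by rewrite diracE mem_set ?mul1e//; case.
    exact: measurable_torus.
  by apply: h => -[].
(* [theta * b < 1] lets the weights [theta ^ i] beat the growth of [kappa] at
   [2 ^- i], and [theta > 1 / 2] makes [2 ^- i / theta ^ i] summable *)
have [theta /andP[th1 th2]] : exists theta, 2^-1 < theta < b^-1.
  exists ((2^-1 + b^-1) / 2).
  have b2' : 2^-1 < b^-1 by rewrite ltf_pV2 ?posrE.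
  by have [h1 h2] := midf_lt b2'; rewrite h1 h2.
have th0 : 0 < theta by rewrite (lt_trans _ th1)// invr_gt0.
have thb : 0 < theta * b < 1.
  by rewrite mulr_gt0//= -ltr_pdivlMr// mul1r.
(* the decay [(theta * b) ^ i] that is left pays for the factor [eta ^ - (i * m)]
   lost in dilating the other [m] variables *)
have [eta /andP[eta0 eta1] etam] := exists_root_ge m thb.
pose c := (1 - eta) / 2.
have c0 : 0 < c by rewrite divr_gt0// subr_gt0.
pose q := 2^-1 / theta.
have q1 : 0 <= q < 1.
  by rewrite divr_ge0 ?invr_ge0 ?ltW//= ltr_pdivrMr// mul1r.
pose K1 := 1 / (1 - q).
have K10 : 0 < K1 by rewrite divr_gt0// subr_gt0; case/andP: q1.
pose C1 := 4 * pi * K1.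
have C10 : 0 < C1 by rewrite /C1 mulr_gt0// mulr_gt0 ?pi_gt0.
have CK0 : 0 < C1 * K * c ^- m.
  by rewrite mulr_gt0 ?invr_gt0 ?exprn_gt0// mulr_gt0.
exists (C * (C1 * K * c ^- m)); first by rewrite mulr_gt0.
move=> kappa F A k0 ke kb mF F0 A0 hF.
rewrite tonelli_torus//.
pose G x' := (\int[leb]_(x in per) F (cons_pair (x, x')))%E.
have mper : measurable per by exact: measurable_itv.
have mG : measurable_fun setT G.
  have -> : G = fun x' => (\int[leb]_x
      ((F \_ [set x | per (thead x)]) (cons_pair (x, x'))))%E.
    apply/funext => x'; rewrite /G integral_mkcond; apply: eq_integral => x _.
    rewrite !patchE; have [px|px] := pselect (per x); first by rewrite !mem_set.
    by rewrite !memNset.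
  apply: measurable_fun_tonelli2 => //; last by move=> x; exact: erestrict_ge0.
  apply/(measurable_restrictT _ _).1; last exact: measurable_funTS.
  rewrite -[X in measurable X]setTI; apply: (measurable_tnth ord0) => //.
have G0 x' : (0 <= G x')%E by apply: integral_ge0.
rewrite -mulrA; apply: (IH _ G _ (fun j => k0 (lift ord0 j))
  (fun j => ke (lift ord0 j)) (fun j => kb (lift ord0 j)) mG G0).
  by rewrite mulr_ge0// ltW.
move=> v v01.
have mFx x' : measurable_fun setT (fun x : R => F (cons_pair (x, x'))).
  exact: measurable_fun_section2.
have w0 i : 0 < theta ^+ i by rewrite exprn_gt0.
have sumK : (\sum_(i <oo) (2^-1 ^+ i / theta ^+ i)%:E <= K1%:E)%E.
  rewrite -(nneseries_geometric ler01 q1); apply: lee_nneseries => i _.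
    by rewrite lee_fin divr_ge0// ltW.
  by rewrite lee_fin mul1r expr_div_n.
pose H i := fun x' => rearr1 (fun x : R => F (cons_pair (x, x'))) (2^-1 ^+ i).
have GH x' : (G x' <= ereal_sup (range (fun i => (C1 * theta ^+ i)%:E * H i x')))%E.
  apply: le_trans (integral_le_rearr1 (mFx x') (fun x => F0 _) w0 sumK) _.
  rewrite -lee_pdivlMl//; apply: ge_ereal_sup => _ [i _ <-].
  rewrite lee_pdivlMl//; apply: ereal_sup_ubound; exists i => //.
  by rewrite muleA -EFinM.
have eps_gt0 i : 0 < c * eta ^+ i by rewrite mulr_gt0// exprn_gt0.
have eps_le1 i : c * eta ^+ i <= 1.
  rewrite mulr_ile1 ?exprn_ile1// ?ltW// ?exprn_gt0// /c; lra.
have sum_eps : (\esum_(i in [set: nat]) (c * eta ^+ i)%:E < 1)%E.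
  rewrite -nneseries_esumT; last by move=> i; rewrite lee_fin ltW.
  have eta01 : 0 <= eta < 1 by rewrite eta1 ltW.
  rewrite (nneseries_geometric (ltW c0) eta01).
  rewrite lte_fin /c mulrAC divff ?mul1r ?invf_lt1 ?ltr1n//.
  by rewrite gt_eqF// subr_gt0.
have mset0 : lebesgue_tuple R m set0 = 0 by rewrite measure0.
have v0 j : 0 < v j by case/andP: (v01 j).
have Cth i : 0 < C1 * theta ^+ i by rewrite mulr_gt0.
apply: le_trans (torus_rearr_sup_le 0%N measurable0 mset0 Cth eps_gt0
  sum_eps v0 (fun x _ _ => GH x)) _.
apply: ge_ereal_sup => _ [i _ <-].
clearbody c C1 K1.
have i01 : 0 < (2^-1 : R) ^+ i <= 1.
  by rewrite exprn_gt0 ?invr_gt0//= exprn_ile1 ?invr_ge0 ?invf_le1 ?ler1n.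
pose vi (j : 'I_m.+1) : R := if unlift ord0 j is Some k then c * eta ^+ i * v k else 2^-1 ^+ i.
have vi0 : vi ord0 = 2^-1 ^+ i by rewrite /vi unlift_none.
have viS j : vi (lift ord0 j) = c * eta ^+ i * v j by rewrite /vi liftK.
have := hF vi; rewrite /= vi0; under [X in torus_rearr _ X]eq_fun do rewrite viS.
move=> /(_ _)/le_trans h; rewrite -lee_pdivlMl//; apply: h.
  apply/forall_ordS; rewrite vi0; split=> // j; rewrite viS.
  have /andP[_ v1] := v01 j; rewrite mulr_gt0//=.
  by apply: mulr_ile1 => //; exact: ltW.
rewrite big_ord_recl vi0.
rewrite (eq_bigr (fun k => kappa (lift ord0 k) (c * eta ^+ i * v k))); last first.
  by move=> k _; rewrite viS.
rewrite -EFinM lee_fin ler_pdivlMl//.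
apply: (@le_trans _ _ (C1 * theta ^+ i * (A * ((K * b ^+ i) *
    \prod_j ((c * eta ^+ i)^-1 * kappa (lift ord0 j) (v j)))))).
  apply: ler_wpM2l; first exact: ltW.
  apply: ler_wpM2l => //; apply: ler_pM => //.
  - by apply: ltW; apply: k0; case/andP: i01.
  - by apply: prodr_ge0 => j _; apply: ltW; apply: k0; exact: mulr_gt0.
  - apply: ler_prod => j _; apply/andP; split.
      by apply: ltW; apply: k0; exact: mulr_gt0.
    by apply: ke => //; rewrite eps_gt0 eps_le1.
rewrite big_split/= prodr_const card_ord.
have -> : C1 * theta ^+ i * (A * (K * b ^+ i * ((c * eta ^+ i)^-1 ^+ m *
     \prod_j kappa (lift ord0 j) (v j)))) =
   ((theta * b) ^+ i * (eta ^+ i) ^- m) *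
   (C1 * K * c ^- m * A * \prod_j kappa (lift ord0 j) (v j)).
  rewrite exprMn exprVn exprMn invfM; ring.
rewrite ler_piMl//.
  apply: mulr_ge0; first by rewrite mulr_ge0// ltW.
  by apply: prodr_ge0 => j _; apply: ltW; exact: k0.
rewrite ler_pdivrMr ?exprn_gt0// mul1r -exprM mulnC exprM.
case/andP: thb => thb0 thb1.
by apply: lerXn2r; rewrite ?nnegrE ?exprn_ge0// ltW.
Qed.

End torus_integral.

(** * Mixed norms and Phi-functions *)

Section recursion.

Lemma foldl_set_tnthS (T U : Type) m (op : 'I_m.+1 -> (T -> U) -> T -> U)
    (G : m.+1.-tuple T -> U) (s : seq 'I_m) (t : m.+1.-tuple T) :
  foldl (fun G j t => op j (fun x => G (set_tnth t j x)) (tnth t j)) G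
    [seq lift ord0 j | j <- s] t =
  foldl (fun G j t => op (lift ord0 j) (fun x => G (set_tnth t j x)) (tnth t j))
    (fun t' => G [tuple of thead t :: t']) s [tuple of behead t].
Proof.
elim: s G => [|j s IH] G /=; first by rewrite -tuple_eta.
rewrite IH; congr (foldl _ _ _ _); apply/funext => t'.
rewrite tnthS; congr (op _ _ _); apply/funext => x; congr G.
apply: eq_from_tnth => i; rewrite tnth_mktuple.
case: (unliftP ord0 i) => [k|] ->.
  by rewrite !tnthS tnth_mktuple (inj_eq lift_inj).
by rewrite !tnth0.
Qed.

Lemma foldl_set_tnth_enum (T U : Type) m (op : 'I_m.+1 -> (T -> U) -> T -> U)
    (G : m.+1.-tuple T -> U) (t : m.+1.-tuple T) :
  foldl (fun G j t => op j (fun x => G (set_tnth t j x)) (tnth t j)) G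
    (enum 'I_m.+1) t =
  foldl (fun G j t => op (lift ord0 j) (fun x => G (set_tnth t j x)) (tnth t j))
    (fun t' => op ord0 (fun x => G [tuple of x :: t']) (thead t))
    (enum 'I_m) [tuple of behead t].
Proof.
rewrite enum_ordSl /= foldl_set_tnthS; congr (foldl _ _ _ _).
apply/funext => t'; rewrite tnth0; congr (op _ _ _); apply/funext => x; congr G.
apply: eq_from_tnth => i; rewrite tnth_mktuple.
by case: (unliftP ord0 i) => [k|] ->; rewrite ?tnthS ?tnth0.
Qed.

(** Once the norm in the first variable has been taken, the result no longer
    depends on this variable, and the remaining norms act on a function of
    one variable less. *)
Lemma mixed_normS (T U : Type) m (N : 'I_m.+1 -> (T -> U) -> U)
    (F : m.+1.-tuple T -> U) (t0 : T) :
  mixed_norm N F t0 =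
  mixed_norm (fun j => N (lift ord0 j))
    (fun t' => N ord0 (fun x => F [tuple of x :: t'])) t0.
Proof.
rewrite /mixed_norm (foldl_set_tnth_enum (fun j g _ => N j g)).
by congr (foldl _ _ _ _); apply: val_inj.
Qed.

Lemma mixed_norm0 (T U : Type) (N : 'I_0 -> (T -> U) -> U)
    (F : 0.-tuple T -> U) (t0 : T) : mixed_norm N F t0 = F [tuple].
Proof.
rewrite /mixed_norm (_ : enum 'I_0 = [::]) /=; first by congr F; apply: val_inj.
by apply: size0nil; rewrite size_enum_ord.
Qed.

End recursion.

Section bridge.
Context {R : realType}.

Lemma iterated_rearrangementE m (F : m.-tuple R -> \bar R) t :
  iterated_rearrangement (fun x => F [tuple (2 * pi * tnth x j)%R | j < m]) t =
  torus_rearr F (tnth t).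
Proof.
rewrite /iterated_rearrangement.
elim: m F t => [|m IH] F t.
  rewrite (_ : enum 'I_0 = [::]) /=; last by apply: size0nil; rewrite size_enum_ord.
  by rewrite (tuple0 [tuple _ | _ < _]).
rewrite (foldl_set_tnth_enum (fun j => @rearrangement R)) /=.
rewrite [X in torus_rearr _ X](_ : _ = tnth [tuple of behead t]); last first.
  by apply/funext => j; rewrite [in LHS](tuple_eta t) tnthS.
rewrite -IH; congr (foldl _ _ _ _); apply/funext => t'.
rewrite /rearr1 (_ : tnth t ord0 = thead t)//; congr rearrangement.
apply/funext => x; congr F; apply: eq_from_tnth => i; rewrite tnth_mktuple.
case: (unliftP ord0 i) => [k|] ->; first by rewrite !tnth_consS tnth_mktuple.
by rewrite !tnth_cons0.
Qed.

Lemma torus_rearrangementE m (f : m.-tuple R -> R[i]) t :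
  torus_rearrangement f t = torus_rearr (fun x => (Normc.normc (f x))%:E) (tnth t).
Proof. exact: iterated_rearrangementE. Qed.

End bridge.

Section phi_functions.
Context {R : realType}.
Implicit Types (phi psi : R -> R).

Lemma Phi_ge0 phi t : Phi_function phi -> 0 <= t <= 1 -> 0 <= phi t.
Proof.
move=> [_ nd _ p0 _] t01; rewrite -[leLHS]p0; apply: nd; rewrite ?in_itv/= ?lexx ?ler01//.
by case/andP: t01.
Qed.

Lemma Phi_nondecreasing phi s t : Phi_function phi -> 0 <= s -> s <= t -> t <= 1 ->
  phi s <= phi t.
Proof.
move=> [_ nd _ p0 _] s0 st t1; apply: nd => //; rewrite in_itv/=; apply/andP; split => //.
  exact: le_trans t1.
exact: le_trans st.
Qed.

(** Concavity between [0], where [phi] vanishes, and [t]. *)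
Lemma Phi_scale phi e t : Phi_function phi -> 0 <= e <= 1 -> 0 <= t <= 1 ->
  e * phi t <= phi (e * t).
Proof.
move=> [cc _ _ p0 _] e01 t01.
have := cc t 0 _ _ e; rewrite !in_itv/= lexx ler01 e01 t01 => /(_ isT isT isT).
by rewrite p0 !mulr0 !addr0.
Qed.

Lemma Phi_gt0 phi t : Phi_function phi -> 0 < t <= 1 -> 0 < phi t.
Proof.
move=> hphi /andP[t0 t1]; have [_ nd _ p0 [u]] := hphi.
rewrite in_itv/= => u01 pu; have /andP[u0 u1] := u01.
have pu0 : 0 < phi u by rewrite lt_def pu Phi_ge0.
have pu1 : phi u <= phi 1 by apply: Phi_nondecreasing.
have := Phi_scale hphi (_ : 0 <= t <= 1) (_ : 0 <= 1 <= 1).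
rewrite mulr1 ler01 lexx (ltW t0) t1 => /(_ isT isT); apply: lt_le_trans.
by rewrite mulr_gt0// (lt_le_trans pu0).
Qed.

Lemma pow2_01 k : 0 < (2 ^- k : R) <= 1.
Proof. by rewrite invr_gt0 exprn_gt0//= invf_le1 ?exprn_gt0// exprn_ege1// ler1n. Qed.

Lemma lower_dilation_gt phi (a : R) : (a%:E < lower_dilation phi)%E ->
  exists2 d : R, 0 < d & forall t, 0 < t < d -> a <= phi (2 * t) / phi t.
Proof.
rewrite /lower_dilation limf_einfE => /ereal_sup_gt[_ [V nV <-]] aV.
have [d d0 dV] : exists2 d : R, 0 < d & forall t, 0 < t < d -> V t.
  move: nV; rewrite /= /at_right => -[/= d d0 dV]; exists d => // t /andP[t0 td].
  by apply: dV => //=; rewrite sub0r normrN gtr0_norm.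
exists d => // t td; rewrite -lee_fin (le_trans (ltW aV))//.
by apply: ereal_inf_lbound; exists t => //; exact: dV.
Qed.

Lemma upper_dilation_lt phi (a : R) : (upper_dilation phi < a%:E)%E ->
  exists2 d : R, 0 < d & forall t, 0 < t < d -> phi (2 * t) / phi t <= a.
Proof.
rewrite /upper_dilation limf_esupE => /ereal_inf_lt[_ [V nV <-]] aV.
have [d d0 dV] : exists2 d : R, 0 < d & forall t, 0 < t < d -> V t.
  move: nV; rewrite /= /at_right => -[/= d d0 dV]; exists d => // t /andP[t0 td].
  by apply: dV => //=; rewrite sub0r normrN gtr0_norm.
exists d => // t td; rewrite -lee_fin (le_trans _ (ltW aV))//.
by apply: ereal_sup_ubound; exists t => //; exact: dV.
Qed.

Lemma pow2_small (d : R) : 0 < d -> exists N, forall k, (N <= k)%N -> 0 < (2 ^- k : R) < d.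
Proof.
move=> d0.
have e0 : (fun i => 2^-1 ^+ i : R) @ \oo --> (0 : R).
  by apply: cvg_expr; rewrite ger0_norm ?invr_ge0// invf_lt1// ltr1n.
have [N _ hN] : \forall i \near \oo, (2^-1 : R) ^+ i < d by apply: (cvgr_lt 0) e0 _ _.
exists N => k Nk; have := hN k Nk; rewrite /= exprVn => ->.
by rewrite andbT; case/andP: (pow2_01 k).
Qed.

(** The finitely many quotients before [N], bounded by [B], cost only a
    constant factor. *)
Lemma eventually_geometric (u : nat -> R) (q B : R) (N : nat) :
  (forall k, 0 < u k) -> 0 < q < 1 -> 1 <= B ->
  (forall k, u k.+1 <= B * u k) -> (forall k, (N <= k)%N -> u k.+1 <= q * u k) ->
  exists2 C : R, 0 < C & forall s k, (s <= k)%N -> u k <= C * q ^+ (k - s) * u s.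
Proof.
move=> u0 /andP[q0 q1] B1 uB uq.
have B0 : 0 < B by rewrite (lt_le_trans _ B1).
have Bq1 : 1 <= B / q by rewrite ler_pdivlMr// mul1r (le_trans (ltW q1)).
exists ((B / q) ^+ N); first by rewrite exprn_gt0// divr_gt0.
suff h s k : u (k + s)%N <= (B / q) ^+ (minn N k) * q ^+ k * u s.
  move=> s k sk; rewrite -{1}(subnK sk); apply: le_trans (h _ _) _.
  apply: ler_wpM2r; first exact: ltW.
  apply: ler_wpM2r; first by rewrite exprn_ge0// ltW.
  by rewrite ler_weXn2l// geq_minl.
elim: k => [|k IH]; first by rewrite minn0 !expr0 !mul1r add0n.
have [Nk|kN] := leqP N k.
  have Nks : (N <= k + s)%N by rewrite (leq_trans Nk)// leq_addr.
  rewrite addSn; apply: le_trans (uq _ Nks) _.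
  rewrite (minn_idPl (leqW Nk)) exprS mulrCA -!mulrA ler_pM2l//.
  by rewrite mulrA (le_trans IH)// (minn_idPl Nk).
rewrite addSn; apply: le_trans (uB _) _.
rewrite (minn_idPr kN) (minn_idPr (ltnW kN)) in IH *.
apply: (@le_trans _ _ (B * ((B / q) ^+ k * q ^+ k * u s))); first by rewrite ler_pM2l.
rewrite [(B / q) ^+ k.+1]exprS [q ^+ k.+1]exprS.
have -> : B / q * (B / q) ^+ k * (q * q ^+ k) = (B / q * q) * ((B / q) ^+ k * q ^+ k) by ring.
by rewrite divfK ?gt_eqF// -!mulrA.
Qed.

End phi_functions.

(** * Fundamental functions *)

Section weak_type.
Context {R : realType}.

Lemma normc_ge0 (z : R[i]) : 0 <= Normc.normc z.
Proof. by case: z => a b; exact: sqrtr_ge0. Qed.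

(** Comparison with [c] times the indicator of the interval from [0] to [v]. *)
Lemma sym_enorm_ge (X : symmetric_space R) phi (g : R -> \bar R) c v :
  fundamental_function X phi -> 0 <= c -> 0 <= v <= 1 ->
  (forall t, 0 <= t <= v -> (c%:E <= g t)%E) ->
  ((c * phi v)%:E <= sym_enorm X g)%E.
Proof.
move=> hX c0 v01 cg; rewrite /sym_enorm.
case: ifPn => [/asboolP[gfin Xg]|_]; last by rewrite leey.
have [Xv nv] := hX v v01.
have -> : c * phi v = sym_norm X (c \*o \1_(`[0, v]%classic)).
  by rewrite sym_normZ// nv ger0_norm.
have Xcv := sym_setZ c Xv.
rewrite lee_fin; apply: (sym_ideal (sym_measurable Xcv) Xg _).2.
case: gfin => N [mN N0 sub]; exists N; split => // t /= ht; apply: sub => /= h; apply: ht => ut.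
have gt := h ut; rewrite indicE.
have [tv|tv] := boolP (t \in `[0, v]%classic); last by rewrite mulr0 normr0.
rewrite mulr1 ger0_norm//.
have := cg t; move: tv; rewrite inE /= in_itv/= => tv /(_ tv).
by rewrite -{1}(fineK gt) lee_fin => h'; rewrite (le_trans h')// ler_norm.
Qed.

Lemma mixed_sym_enorm_ge m (X : 'I_m -> symmetric_space R) (phi : 'I_m -> R -> R)
    (F : m.-tuple R -> \bar R) c v t0 :
  (forall j, fundamental_function (X j) (phi j)) -> (forall j, Phi_function (phi j)) ->
  0 <= c -> (forall j, 0 <= v j <= 1) ->
  (forall t, (forall j, 0 <= tnth t j <= v j) -> (c%:E <= F t)%E) ->
  ((c * \prod_j phi j (v j))%:E <= mixed_norm (fun j => sym_enorm (X j)) F t0)%E.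
Proof.
elim: m X phi F c v => [|m IH] X phi F c v hX hphi c0 v01 cF.
  by rewrite big_ord0 mulr1 mixed_norm0; apply: cF => -[].
rewrite mixed_normS big_ord_recl mulrA.
apply: (IH _ (fun j => phi (lift ord0 j)) _ _ (fun j => v (lift ord0 j))) => //.
  by rewrite mulr_ge0// Phi_ge0.
move=> t tv; apply: sym_enorm_ge => // x xv; apply: cF.
by apply/forall_ordS; rewrite tnth0; split => // j; rewrite tnthS.
Qed.

(** The iterated rearrangement decreases in each variable, so it is bounded
    below by [torus_rearr F v] on the box with upper corner [v], whose
    indicator has norm [prod_j phi_j (v_j)]. *)
Lemma torus_rearr_le_aniso_norm m (X : 'I_m -> symmetric_space R)
    (phi : 'I_m -> R -> R) (f : m.-tuple R -> R[i]) (A : R) v :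
  (forall j, fundamental_function (X j) (phi j)) -> (forall j, Phi_function (phi j)) ->
  (aniso_norm X f <= A%:E)%E -> (forall j, 0 < v j <= 1) ->
  (torus_rearr (fun x => (Normc.normc (f x))%:E) v <=
     (A * \prod_j (phi j (v j))^-1)%:E)%E.
Proof.
move=> hX hphi fA v01.
have p0 j : 0 < phi j (v j) by exact: Phi_gt0.
have P0 : 0 < \prod_j phi j (v j) by apply: prodr_gt0 => j _.
rewrite prodfV leNgt; apply/negP => lt.
have [c cA cF] : exists2 c, A / \prod_j phi j (v j) < c &
    (c%:E <= torus_rearr (fun x => (Normc.normc (f x))%:E) v)%E.
  move: lt; case: torus_rearr => [r| |] //.
    by rewrite lte_fin => ?; exists r.
  by move=> _; exists (A / \prod_j phi j (v j) + 1); rewrite ?leey// ltrDl.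
have A0 : 0 <= A.
  rewrite -lee_fin (le_trans _ fA)//.
  have : ((0 * \prod_j phi j 1)%:E <= aniso_norm X f)%E.
    apply: mixed_sym_enorm_ge => //; first by move=> j; rewrite ler01 lexx.
    move=> t _; rewrite torus_rearrangementE; apply: torus_rearr_ge0 => x.
    by rewrite lee_fin normc_ge0.
  by rewrite mul0r.
have c0 : 0 <= c by rewrite (le_trans _ (ltW cA))// divr_ge0// ltW.
have : ((c * \prod_j phi j (v j))%:E <= aniso_norm X f)%E.
  apply: mixed_sym_enorm_ge => //.
    by move=> j; have /andP[/ltW -> ->] := v01 j.
  move=> t tv; rewrite torus_rearrangementE (le_trans cF)//.
  by apply: torus_rearr_antitone => j; case/andP: (tv j).
move=> /le_trans/(_ fA); apply/negP; rewrite -ltNge lte_fin.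
by rewrite -ltr_pdivrMr.
Qed.

End weak_type.

(** * Decay at dyadic points *)

Section ratio.
Context {R : realType}.
Implicit Types (phi psi : R -> R).

(** The distance between two natural numbers. *)
Definition dst (s k : nat) : nat := (s - k + (k - s))%N.

Lemma ereal_between (x y : \bar R) : (x < y)%E ->
  exists2 b : R, (x < b%:E)%E & (b%:E < y)%E.
Proof.
case: x y => [x| |] [y| |] //=.
- by rewrite lte_fin => xy; exists ((x + y) / 2); rewrite lte_fin; lra.
- by move=> _; exists (x + 1); rewrite ?ltry// lte_fin; lra.
- by move=> _; exists (y - 1); rewrite ?ltNyr// lte_fin; lra.
- by move=> _; exists 0; rewrite ?ltNyr ?ltry.
Qed.

Lemma Phi_double phi t : Phi_function phi -> 0 < t -> 2 * t <= 1 ->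
  phi t <= phi (2 * t) <= 2 * phi t.
Proof.
move=> hphi t0 t1; apply/andP; split.
  by apply: Phi_nondecreasing => //; lra.
have := Phi_scale hphi (_ : 0 <= 2^-1 <= 1) (_ : 0 <= 2 * t <= 1).
rewrite invr_ge0 ler0n invf_le1// ler1n/= t1 mulr_ge0 ?(ltW t0)// mulKf//.
by move=> /(_ isT isT); rewrite ler_pdivrMl.
Qed.

Lemma pow2S k : 2 * 2 ^- k.+1 = 2 ^- k :> R.
Proof. by rewrite exprS invfM mulVKf. Qed.

Lemma Phi_pow2 phi k : Phi_function phi ->
  phi (2 ^- k.+1) <= phi (2 ^- k) <= 2 * phi (2 ^- k.+1).
Proof.
move=> hphi; rewrite -(pow2S k); apply: Phi_double => //.
by rewrite pow2S; case/andP: (pow2_01 (R := R) k).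
Qed.

Lemma Phi_pow2_gt0 phi k : Phi_function phi -> 0 < phi (2 ^- k).
Proof. by move=> hphi; apply: Phi_gt0 => //; exact: pow2_01. Qed.

(** At small dyadic points [psi] grows at least by a factor [a > 1] from
    each point to the next larger one. *)
Lemma psi_geometric psi : Phi_function psi -> (1 < lower_dilation psi)%E ->
  exists C q, [/\ 0 < C, 0 < q < 1 &
    forall s k, (s <= k)%N -> psi (2 ^- k) <= C * q ^+ (k - s) * psi (2 ^- s)].
Proof.
move=> hpsi lpsi.
have [a a1 /lower_dilation_gt[d d0 da]] := ereal_between lpsi.
rewrite lte_fin in a1.
have a0 : 0 < a by rewrite (lt_trans _ a1).
have [N hN] := pow2_small d0.
have q01 : 0 < a^-1 < 1 by rewrite invr_gt0 a0 invf_lt1.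
have u0 k : 0 < psi (2 ^- k) by exact: Phi_pow2_gt0.
have [||C C0 h] := @eventually_geometric _ _ _ _ N u0 q01 (lexx 1).
- by move=> k; rewrite mul1r; case/andP: (Phi_pow2 k hpsi).
- move=> k Nk; have := da (2 ^- k.+1) (hN _ (leqW Nk)).
  by rewrite pow2S ler_pdivlMr// ler_pdivlMl.
by exists C, a^-1; split.
Qed.

(** Consecutive quotients of [2 ^- k / phi (2 ^- k)] are eventually at most
    [b / 2 < 1]. *)
Lemma phi_geometric phi : Phi_function phi -> (upper_dilation phi < 2%:E)%E ->
  exists K b, [/\ 0 < K, 0 < b < 2 & forall i, (phi (2 ^- i))^-1 <= K * b ^+ i].
Proof.
move=> hphi uphi.
have [b' ub' b'2] := ereal_between uphi; rewrite lte_fin in b'2.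
have [b b2 /upper_dilation_lt[d d0 da]] :
    exists2 b : R, 0 < b < 2 & (upper_dilation phi < b%:E)%E.
  exists (Num.max b' 1); first by rewrite lt_max ltr01 orbT gt_max b'2 ltr1n.
  by rewrite (lt_le_trans ub')// lee_fin le_max lexx.
have /andP[b0 b2'] := b2.
have [N hN] := pow2_small d0.
have u0 k : 0 < (phi (2 ^- k))^-1 / 2 ^+ k.
  by rewrite divr_gt0 ?exprn_gt0// invr_gt0 Phi_pow2_gt0.
have q01 : 0 < b / 2 < 1 by rewrite divr_gt0//= ltr_pdivrMr// mul1r.
have p0 k : 0 < phi (2 ^- k) by exact: Phi_pow2_gt0.
have [||C C0 h] := @eventually_geometric _ _ _ _ N u0 q01 (lexx 1).
- move=> k; have /andP[_] := Phi_pow2 k hphi; move: (p0 k) (p0 k.+1).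
  move: (phi (2 ^- k)) (phi (2 ^- k.+1)) => x y x0 y0 xy.
  rewrite mul1r exprS invfM mulrA ler_pM2r ?invr_gt0 ?exprn_gt0//.
  by rewrite -invfM lef_pV2 ?posrE ?mulr_gt0// mulrC.
- move=> k Nk; have := da (2 ^- k.+1) (hN _ (leqW Nk)); rewrite pow2S.
  move: (p0 k) (p0 k.+1).
  move: (phi (2 ^- k)) (phi (2 ^- k.+1)) => x y x0 y0.
  rewrite exprS ler_pdivrMr// => h.
  have -> : b / 2 * (x^-1 / 2 ^+ k) = b / x * (2 * 2 ^+ k)^-1.
    by rewrite invfM; ring.
  rewrite ler_pM2r ?invr_gt0 ?mulr_gt0 ?exprn_gt0//.
  by rewrite ler_pdivlMr// mulrC ler_pdivrMr.
exists (C * (phi (2 ^- 0))^-1), b; split => //; first by rewrite mulr_gt0// invr_gt0.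
move=> i; have := h 0%N i (leq0n i).
rewrite subn0 expr0 divr1 ler_pdivrMr ?exprn_gt0// => /le_trans; apply.
have n0 : 2 ^+ i != 0 :> R by rewrite expf_neq0.
rewrite expr_div_n; set y := (phi _)^-1.
by rewrite (_ : C * (b ^+ i / 2 ^+ i) * y * 2 ^+ i = C * y * b ^+ i)//; field.
Qed.

(** Two numbers [b < c] between the dilation indices bound the quotients of
    [psi] from above and those of [phi] from below, so that [phi / psi]
    eventually decreases by the factor [b / c] from one dyadic point to the
    next smaller one. *)
Lemma ratio_geometric phi psi : Phi_function phi -> Phi_function psi ->
  (upper_dilation psi < lower_dilation phi)%E ->
  exists C q, [/\ 0 < C, 0 < q < 1 &
    forall s k, (s <= k)%N -> phi_ratio psi phi s <= C * q ^+ (k - s) * phi_ratio psi phi k].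
Proof.
move=> hphi hpsi dil.
have [b /upper_dilation_lt[d d0 db] bl] := ereal_between dil.
have [c bc /lower_dilation_gt[d' d'0 dc]] := ereal_between bl.
rewrite lte_fin in bc.
have [N hN] := pow2_small d0; have [N' hN'] := pow2_small d'0.
have p0 k : 0 < phi (2 ^- k) by exact: Phi_pow2_gt0.
have s0 k : 0 < psi (2 ^- k) by exact: Phi_pow2_gt0.
have b0 : 0 < b.
  rewrite (lt_le_trans _ (db _ (hN N.+1 (leqW (leqnn N)))))//.
  by rewrite pow2S divr_gt0.
have c0 : 0 < c by rewrite (lt_trans b0).
have q01 : 0 < b / c < 1 by rewrite divr_gt0//= ltr_pdivrMr// mul1r.
have u0 k : 0 < phi (2 ^- k) / psi (2 ^- k) by rewrite divr_gt0.
have step k x : phi (2 ^- k.+1) * psi (2 ^- k) <= x * (phi (2 ^- k) * psi (2 ^- k.+1)) ->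
    phi (2 ^- k.+1) / psi (2 ^- k.+1) <= x * (phi (2 ^- k) / psi (2 ^- k)).
  move=> h; rewrite ler_pdivrMr// mulrA mulrAC ler_pdivlMr//.
  by rewrite -[in leRHS]mulrA.
have [|||C C0 h] := @eventually_geometric _ _ _ 2 (maxn N N') u0 q01.
- by rewrite ler1n.
- move=> i; apply: step.
  have /andP[h1 _] := Phi_pow2 i hphi; have /andP[_ h2] := Phi_pow2 i hpsi.
  by rewrite mulrCA; apply: ler_pM => //; exact: ltW.
- move=> i; rewrite geq_max => /andP[Ni Ni']; apply: step.
  have := db _ (hN _ (leqW Ni)); have := dc _ (hN' _ (leqW Ni')).
  rewrite pow2S ler_pdivrMr// ler_pdivlMr// => h1 h2.
  have -> : b / c * (phi (2 ^- i) * psi (2 ^- i.+1)) =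
      phi (2 ^- i) * (b * psi (2 ^- i.+1)) / c by ring.
  rewrite ler_pdivlMr//.
  have -> : phi (2 ^- i.+1) * psi (2 ^- i) * c = (c * phi (2 ^- i.+1)) * psi (2 ^- i) by ring.
  by apply: ler_pM => //; rewrite ?mulr_ge0// ltW.
exists C, (b / c); split => // s k sk.
have {h} := h s k sk.
rewrite /phi_ratio ler_pdivrMr//.
set D := C * _ => h1.
have h2 : phi (2 ^- k) * psi (2 ^- s) <= D * phi (2 ^- s) * psi (2 ^- k).
  rewrite -ler_pdivlMr// (le_trans h1)//.
  by rewrite -[X in X <= _](_ : D * phi (2 ^- s) * psi (2 ^- k) / psi (2 ^- s) = _)//; ring.
have -> : D * (psi (2 ^- k) / phi (2 ^- k)) = D * psi (2 ^- k) / phi (2 ^- k) by ring.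
rewrite ler_pdivrMr// mulrAC ler_pdivlMr// mulrC (le_trans h2)//.
by rewrite mulrAC.
Qed.

(** The estimate that drives the discrete convolution: for [s <= k] it
    expresses the decay of [psi], for [s >= k] the growth of [psi / phi]. *)
Lemma psi_phi_decay phi psi : Phi_function phi -> Phi_function psi ->
  (1 < lower_dilation psi)%E -> (upper_dilation psi < lower_dilation phi)%E ->
  exists C q, [/\ 0 < C, 0 < q < 1 &
    forall s k, psi (2 ^- k) / phi (2 ^- minn s k) <=
      C * q ^+ dst s k * phi_ratio psi phi s].
Proof.
move=> hphi hpsi lpsi dil.
have [C1 [q1 [C10 /andP[q10 q11] h1]]] := psi_geometric hpsi lpsi.
have [C2 [q2 [C20 /andP[q20 q21] h2]]] := ratio_geometric hphi hpsi dil.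
have p0 k : 0 < phi (2 ^- k) by exact: Phi_pow2_gt0.
have s0 k : 0 < psi (2 ^- k) by exact: Phi_pow2_gt0.
have r0 k : 0 < phi_ratio psi phi k by rewrite divr_gt0.
exists (C1 + C2), (Num.max q1 q2); split; first exact: addr_gt0.
  by rewrite lt_max q10 gt_max q11 q21.
have mono C q n : 0 < C -> C <= C1 + C2 -> 0 < q -> q <= Num.max q1 q2 ->
    C * q ^+ n <= (C1 + C2) * Num.max q1 q2 ^+ n.
  move=> C0 CC q0 qq; apply: ler_pM => //; rewrite ?exprn_ge0 ?(ltW C0) ?(ltW q0)//.
  by apply: lerXn2r; rewrite // nnegrE ?(le_trans (ltW q0) qq)// ltW.
move=> s k; have [sk|ks] := leqP s k.
  rewrite ler_pdivrMr// /phi_ratio mulrA divfK ?gt_eqF//.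
  apply: le_trans (h1 _ _ sk) _; rewrite ler_pM2r// /dst (eqP sk) add0n.
  by apply: mono; rewrite ?le_max ?lexx// lerDl ltW.
apply: le_trans (h2 _ _ (ltnW ks)) _; rewrite ler_pM2r// /dst (eqP (ltnW ks)) addn0.
by apply: mono; rewrite ?le_max ?lexx ?orbT// lerDr ltW.
Qed.

End ratio.

(** * Sums over multi-indices *)

Section tuple_sums.
Context {R : realType}.

Lemma esum_tupleS (T : choiceType) m (f : m.+1.-tuple T -> \bar R) :
  (forall s, (0 <= f s)%E) ->
  \esum_(s in [set: m.+1.-tuple T]) f s =
  \esum_(s' in [set: m.-tuple T]) \esum_(k in [set: T]) f [tuple of k :: s'].
Proof.
move=> f0; rewrite esum_esum//.
rewrite (@reindex_esum _ _ _ ([set: m.-tuple T] `*`` (fun=> [set: T])) setT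
  (fun p => [tuple of p.2 :: p.1]) f)//.
split=> //.
  by move=> [s' k] [t' l] _ _ /= /(congr1 val)/= [-> /val_inj ->].
move=> s _; exists ([tuple of behead s], thead s) => //=.
by rewrite -tuple_eta.
Qed.

Lemma esum_tuple_prod (T : choiceType) m (u : 'I_m -> T -> R) (B : 'I_m -> R) :
  (forall j s, 0 <= u j s) -> (forall j, 0 < B j) ->
  (forall j, (\esum_(s in [set: T]) (u j s)%:E <= (B j)%:E)%E) ->
  (\esum_(s in [set: m.-tuple T]) (\prod_j u j (tnth s j))%:E <= (\prod_j B j)%:E)%E.
Proof.
elim: m u B => [|m IH] u B u0 B0 uB.
  rewrite big_ord0 (_ : [set: 0.-tuple T] = [set [tuple]]); last first.
    by apply/seteqP; split => // s _; rewrite /= (tuple0 s).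
  by rewrite esum_set1 big_ord0 ?lee_fin.
rewrite esum_tupleS; last by move=> s; rewrite lee_fin prodr_ge0.
rewrite big_ord_recl.
apply: (@le_trans _ _ (\esum_(s' in [set: m.-tuple T])
    ((B ord0)%:E * (\prod_j u (lift ord0 j) (tnth s' j))%:E)%E)).
  apply: le_esum => s' _.
  apply: (@le_trans _ _ (\esum_(k in [set: T]) ((\prod_j u (lift ord0 j) (tnth s' j))%:E * (u ord0 k)%:E)%E)).
    apply: le_esum => k _; rewrite big_ord_recl tnth0 -EFinM mulrC.
    by rewrite (eq_bigr (fun j => u (lift ord0 j) (tnth s' j)))// => j _; rewrite tnthS.
  have P0 : 0 <= \prod_j u (lift ord0 j) (tnth s' j) by apply: prodr_ge0.
  apply: le_trans (esumZl_le _ P0 _) _; first by move=> k; rewrite lee_fin.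
  by rewrite muleC lee_wpmul2r// uB.
apply: le_trans (esumZl_le _ (ltW (B0 ord0)) _) _; first by move=> s'; rewrite lee_fin prodr_ge0.
by rewrite EFinM lee_pmul2l ?lte_fin//;
  apply: (IH (fun j => u (lift ord0 j)) (fun j => B (lift ord0 j))).
Qed.

Lemma esum_subset_le (T : choiceType) (A B : set T) (f : T -> \bar R) :
  A `<=` B -> (forall t, (0 <= f t)%E) -> (\esum_(t in A) f t <= \esum_(t in B) f t)%E.
Proof.
move=> AB f0; apply: ge_ereal_sup => _ [F [fF FA] <-].
by apply: ereal_sup_ubound; exists F => //; split => //; exact: subset_trans AB.
Qed.

Lemma le_esum_term (T : choiceType) (f : T -> \bar R) t :
  (forall t, (0 <= f t)%E) -> (f t <= \esum_(t in [set: T]) f t)%E.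
Proof.
by move=> f0; rewrite -[leLHS](@esum_set1 _ _ t f)//; apply: esum_subset_le.
Qed.

Lemma esum_geometric (q : R) : 0 <= q < 1 ->
  \esum_(i in [set: nat]) (q ^+ i)%:E = ((1 - q)^-1)%:E.
Proof.
move=> q01; rewrite -nneseries_esumT; last first.
  by move=> i; rewrite lee_fin exprn_ge0//; case/andP: q01.
under eq_eseriesr do rewrite -[_ ^+ _]mul1r.
by rewrite nneseries_geometric ?ler01// div1r.
Qed.

Lemma esum_dst (q : R) k : 0 < q < 1 ->
  (\esum_(s in [set: nat]) (q ^+ dst s k)%:E <= (2 / (1 - q))%:E)%E.
Proof.
move=> /andP[q0 q1]; have d0 : 0 < 1 - q by rewrite subr_gt0.
rewrite (esumID [set s | (s <= k)%N])//; last by move=> s _; rewrite lee_fin exprn_ge0// ltW.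
have q01 : 0 <= q < 1 by rewrite ltW.
rewrite !setTI.
have le1 (A : set nat) (e : nat -> nat) : {in A &, injective e} ->
   (forall s, A s -> dst s k = e s) ->
   (\esum_(s in A) (q ^+ dst s k)%:E <= (1 / (1 - q))%:E)%E.
  move=> inj Ae; rewrite div1r -(esum_geometric q01).
  apply: (@le_trans _ _ (\esum_(s in A) ((fun i => (q ^+ i)%:E) (e s)))).
    by apply: le_esum => s As; rewrite Ae.
  rewrite -(@reindex_esum _ _ _ A (e @` A) e (fun i => (q ^+ i)%:E)); last first.
    exact: inj_bij.
  by apply: esum_subset_le => // i; rewrite lee_fin exprn_ge0// ltW.
have -> : (2 / (1 - q))%:E = ((1 / (1 - q))%:E + (1 / (1 - q))%:E)%E.
  by rewrite -EFinD -mulrDl.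
apply: leeD.
- apply: (le1 _ (fun s => k - s)%N).
    by move=> s t; rewrite !inE /= => sk tk; lia.
  by move=> s /= sk; rewrite /dst (eqP sk).
- apply: (le1 _ (fun s => s - k)%N).
    by move=> s t; rewrite !inE /= => /negP + /negP; rewrite -!ltnNge => sk tk; lia.
  by move=> s /= /negP; rewrite -ltnNge => sk; rewrite /dst (eqP (ltnW sk)) addn0.
Qed.

End tuple_sums.

(** * Sequence norms *)

Section sequence_norms.
Context {R : realType}.
Implicit Types (a b : nat -> \bar R) (p : R).
Local Notation lp p a := (Lnorm counting p%:E a).

Lemma poweRK p (x : \bar R) : p != 0 -> (0 <= x)%E -> ((x `^ p) `^ p^-1 = x)%E.
Proof. by move=> p0 x0; rewrite -poweRrM mulfV// poweRe1. Qed.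

Lemma le_poweR p (x y : \bar R) : 0 <= p -> (0 <= x)%E -> (x <= y)%E -> (x `^ p <= y `^ p)%E.
Proof.
move=> p0 x0 xy; apply: gt0_ler_poweR => //; rewrite in_itv/= leey andbT//.
exact: le_trans x0 xy.
Qed.

Lemma le_poweR_inv p (x y : \bar R) : 0 < p -> (0 <= x)%E -> (0 <= y)%E ->
  (x `^ p <= y `^ p)%E -> (x <= y)%E.
Proof.
move=> p0 x0 y0 xy; rewrite -(poweRK (lt0r_neq0 p0) x0) -(poweRK (lt0r_neq0 p0) y0).
by apply: le_poweR => //; rewrite ?invr_ge0 ?(ltW p0)// poweR_ge0.
Qed.

Lemma sup_poweR_le (I : Type) (i0 : I) p (u : I -> \bar R) (x : \bar R) : 0 < p ->
  (forall i, (0 <= u i)%E) -> (forall i, (u i `^ p <= x)%E) ->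
  (ereal_sup (range u) `^ p <= x)%E.
Proof.
move=> p0 u0 ux; have x0 : (0 <= x)%E by rewrite (le_trans _ (ux i0))// poweR_ge0.
have s0 : (0 <= ereal_sup (range u))%E.
  by apply: le_trans (u0 i0) _; apply: ereal_sup_ubound; exists i0.
rewrite -[leRHS](poweRK (p := p^-1)) ?gt_eqF ?invr_gt0// invrK.
apply: le_poweR => //; first exact: ltW.
apply: ge_ereal_sup => _ [i _ <-]; rewrite -(poweRK (lt0r_neq0 p0) (u0 i)).
by apply: le_poweR => //; rewrite ?invr_ge0 ?(ltW p0)// poweR_ge0.
Qed.

Lemma lpE p a : 0 < p -> (forall k, (0 <= a k)%E) ->
  lp p a = ((\esum_(k in [set: nat]) a k `^ p) `^ p^-1)%E.
Proof.
move=> p0 a0; rewrite Lnorm_counting// nneseries_esumT; last by move=> k; rewrite poweR_ge0.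
by congr (_ `^ _)%E; apply: eq_esum => k _; rewrite gee0_abs.
Qed.

Lemma lp_power p a : 0 < p -> (forall k, (0 <= a k)%E) ->
  (lp p a `^ p = \esum_(k in [set: nat]) a k `^ p)%E.
Proof.
move=> p0 a0; rewrite lpE// -poweRrM mulVf ?gt_eqF// poweRe1//.
by apply: esum_ge0 => k _; rewrite poweR_ge0.
Qed.

Lemma le_lp p a b : 0 < p -> (forall k, (0 <= a k)%E) -> (forall k, (a k <= b k)%E) ->
  (lp p a <= lp p b)%E.
Proof.
move=> p0 a0 ab; have b0 k : (0 <= b k)%E by rewrite (le_trans (a0 k)).
apply: (le_poweR_inv p0); rewrite ?Lnorm_ge0// !lp_power//.
by apply: le_esum => k _; apply: le_poweR => //; exact: ltW.
Qed.

Lemma lp_ge_term p a k : 0 < p -> (forall k, (0 <= a k)%E) -> (a k <= lp p a)%E.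
Proof.
move=> p0 a0; apply: (le_poweR_inv p0); rewrite ?Lnorm_ge0// lp_power//.
by apply: (le_esum_term (f := fun k => (a k `^ p)%E)) => i; rewrite poweR_ge0.
Qed.

Lemma lpZ_le p a (c : R) : 0 < p -> 0 <= c -> (forall k, (0 <= a k)%E) ->
  (lp p (fun k => c%:E * a k) <= c%:E * lp p a)%E.
Proof.
move=> p0 c0 a0; have ca0 k : (0 <= c%:E * a k)%E by rewrite mule_ge0.
apply: (le_poweR_inv p0); rewrite ?Lnorm_ge0 ?mule_ge0 ?Lnorm_ge0//.
rewrite poweRM ?Lnorm_ge0// !lp_power// poweR_EFin.
apply: le_trans (esumZl_le _ (powR_ge0 c p) _); last by move=> k; rewrite poweR_ge0.
by apply: le_esum => k _; rewrite poweRM// poweR_EFin.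
Qed.

Lemma lpZ p a (c : R) : 0 < p -> 0 < c -> (forall k, (0 <= a k)%E) ->
  (lp p (fun k => c%:E * a k) = c%:E * lp p a)%E.
Proof.
move=> p0 c0 a0; have ca0 k : (0 <= c%:E * a k)%E by rewrite mule_ge0// lee_fin ltW.
apply/eqP; rewrite eq_le lpZ_le ?(ltW c0)//=.
rewrite -lee_pdivlMl//; have ci : 0 <= c^-1 by rewrite invr_ge0 ltW.
apply: le_trans (lpZ_le p0 ci ca0); apply: le_lp => // k.
by rewrite muleA -EFinM mulVf ?gt_eqF// mul1e.
Qed.

(** A supremum of countably many sequences, damped by the squares of summable
    weights: half of the damping pays for replacing the supremum by a sum, the
    other half is kept. *)
Lemma lp_sup_le (I : countType) (i0 : I) p (w : I -> R) (W : R) (c : I -> nat -> \bar R) :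
  1 <= p -> (forall i, 0 < w i <= 1) -> 1 <= W ->
  (\esum_(i in [set: I]) (w i)%:E <= W%:E)%E -> (forall i k, (0 <= c i k)%E) ->
  (lp p (fun k => ereal_sup (range (fun i => (w i ^+ 2)%:E * c i k))) <=
   W%:E * ereal_sup (range (fun i => (w i)%:E * lp p (c i))))%E.
Proof.
move=> p1 w01 W1 wW c0.
have p0 : 0 < p by rewrite (lt_le_trans _ p1).
have w0 i : 0 <= w i by case/andP: (w01 i) => /ltW.
have sup0 k : (0 <= ereal_sup (range (fun i => (w i ^+ 2)%:E * c i k)))%E.
  apply: le_trans (ereal_sup_ubound _); last by exists i0.
  by rewrite mule_ge0// lee_fin exprn_ge0.
set S := ereal_sup (range (fun i => (w i)%:E * lp p (c i)))%E.
have S0 : (0 <= S)%E.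
  apply: le_trans (ereal_sup_ubound _); last by exists i0.
  by rewrite mule_ge0 ?lee_fin ?Lnorm_ge0.
have WS0 : (0 <= W%:E * S)%E by rewrite mule_ge0// lee_fin (le_trans ler01).
apply: (le_poweR_inv p0); rewrite ?Lnorm_ge0// lp_power//.
have wp i : w i `^ p <= w i.
  have /andP[wi0 wi1] := w01 i.
  by rewrite -[leRHS](powRr1 (w0 i)); apply: ger_powR; rewrite ?wi0.
apply: (@le_trans _ _ (\esum_(k in [set: nat]) \esum_(i in [set: I])
    (((w i ^+ 2)%:E * c i k) `^ p))%E).
  apply: le_esum => k _; apply: (sup_poweR_le i0 p0) => i.
    by rewrite mule_ge0// lee_fin exprn_ge0.
  by apply: (le_esum_term (f := fun i => (((w i ^+ 2)%:E * c i k) `^ p)%E)) => j; rewrite poweR_ge0.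
have -> : \esum_(k in [set: nat]) \esum_(i in [set: I]) (((w i ^+ 2)%:E * c i k) `^ p)%E =
          \esum_(i in [set: I]) \esum_(k in [set: nat]) (((w i ^+ 2)%:E * c i k) `^ p)%E.
  rewrite !esum_esum//; try by move=> *; rewrite poweR_ge0.
  rewrite (@reindex_esum _ _ _ ([set: nat] `*`` (fun=> [set: I])) _ (fun x => (x.2, x.1)))//.
  split=> //; first by move=> [x1 x2] [y1 y2] _ _ /= [-> ->].
  by move=> [x1 x2] _; exists (x2, x1).
apply: (@le_trans _ _ (\esum_(i in [set: I]) ((w i)%:E * S `^ p))%E).
  apply: le_esum => i _; have /andP[wi0 wi1] := w01 i.
  rewrite (_ : \esum_(k in _) _ = lp p (fun k => (w i ^+ 2)%:E * c i k)%E `^ p)%E; last first.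
    by rewrite lp_power// => k; rewrite mule_ge0// lee_fin exprn_ge0.
  apply: (@le_trans _ _ (((w i)%:E * ((w i)%:E * lp p (c i))) `^ p)%E).
    apply: le_poweR; rewrite ?Lnorm_ge0 ?(ltW p0)// muleA -EFinM -expr2.
    by apply: lpZ_le; rewrite ?exprn_ge0.
  have wl0 : (0 <= (w i)%:E * lp p (c i))%E by rewrite mule_ge0 ?lee_fin ?Lnorm_ge0.
  rewrite poweRM ?lee_fin// poweR_EFin; apply: lee_pmul; rewrite ?lee_fin ?powR_ge0 ?poweR_ge0//.
  by apply: le_poweR => //; [exact: ltW|apply: ereal_sup_ubound; exists i].
apply: (@le_trans _ _ (W%:E * S `^ p)%E).
  have Sp0 : (0 <= S `^ p)%E by rewrite poweR_ge0.
  case ES : (S `^ p)%E Sp0 => [x| |] // Sp0.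
    under eq_esum do rewrite muleC.
    apply: le_trans (esumZl_le _ _ _) _; rewrite -?lee_fin//.
    by rewrite muleC lee_wpmul2r.
  by rewrite gt0_muley ?leey// lte_fin (lt_le_trans ltr01).
rewrite poweRM//; last by rewrite lee_fin (le_trans ler01).
rewrite poweR_EFin lee_wpmul2r ?poweR_ge0// lee_fin.
by rewrite -[leLHS](powRr1 (le_trans ler01 W1)) ler_powR.
Qed.

(** A discrete convolution with a two-sided geometric kernel is bounded on
    [l_p]; so is its version with a supremum, as the power of a supremum is
    at most the sum of the powers. *)
Lemma lp_convolution_le p (q : R) (a : nat -> \bar R) : 1 <= p -> 0 < q < 1 ->
  (forall k, (0 <= a k)%E) ->
  (lp p (fun k => ereal_sup (range (fun s => (q ^+ dst s k)%:E * a s))) <=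
   (2 / (1 - q))%:E * lp p a)%E.
Proof.
move=> p1 /andP[q0 q1] a0.
have p0 : 0 < p by rewrite (lt_le_trans _ p1).
have D1 : 1 <= 2 / (1 - q) by rewrite ler_pdivlMr ?subr_gt0//; lra.
have t0 s k : (0 <= (q ^+ dst s k)%:E * a s)%E by rewrite mule_ge0// lee_fin exprn_ge0// ltW.
have sup0 k : (0 <= ereal_sup (range (fun s => (q ^+ dst s k)%:E * a s)))%E.
  by apply: le_trans (t0 0%N k) _; apply: ereal_sup_ubound; exists 0%N.
have Dl0 : (0 <= (2 / (1 - q))%:E * lp p a)%E.
  by rewrite mule_ge0 ?Lnorm_ge0// lee_fin (le_trans ler01).
apply: (le_poweR_inv p0); rewrite ?Lnorm_ge0// lp_power//.
apply: (@le_trans _ _ (\esum_(k in [set: nat]) \esum_(s in [set: nat])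
    (((q ^+ dst s k)%:E * a s) `^ p))%E).
  apply: le_esum => k _; apply: (sup_poweR_le 0%N p0) => // s.
  by apply: (le_esum_term (f := fun s => (((q ^+ dst s k)%:E * a s) `^ p)%E)) => j; rewrite poweR_ge0.
have -> : \esum_(k in [set: nat]) \esum_(s in [set: nat]) (((q ^+ dst s k)%:E * a s) `^ p)%E =
          \esum_(s in [set: nat]) \esum_(k in [set: nat]) (((q ^+ dst s k)%:E * a s) `^ p)%E.
  rewrite !esum_esum//; try by move=> *; rewrite poweR_ge0.
  rewrite (@reindex_esum _ _ _ ([set: nat] `*`` (fun=> [set: nat])) _ (fun x => (x.2, x.1)))//.
  split=> //; first by move=> [x1 x2] [y1 y2] _ _ /= [-> ->].
  by move=> [x1 x2] _; exists (x2, x1).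
apply: (@le_trans _ _ (\esum_(s in [set: nat]) ((2 / (1 - q))%:E * a s `^ p))%E).
  apply: le_esum => s _.
  apply: (@le_trans _ _ (\esum_(k in [set: nat]) (a s `^ p * (q ^+ dst k s)%:E))%E).
    apply: le_esum => k _; rewrite poweRM//; last by rewrite lee_fin exprn_ge0// ltW.
    rewrite muleC; apply: lee_wpmul2l; first exact: poweR_ge0.
    have dst_sym : dst k s = dst s k by rewrite /dst addnC.
    have qd0 : 0 <= q ^+ dst s k by rewrite exprn_ge0// ltW.
    rewrite poweR_EFin lee_fin dst_sym -[leRHS](powRr1 qd0); apply: ger_powR => //.
    by rewrite exprn_gt0//= exprn_ile1// ltW.
  have ap0 : (0 <= a s `^ p)%E by rewrite poweR_ge0.
  have qdst : (\esum_(k in [set: nat]) (q ^+ dst k s)%:E <= (2 / (1 - q))%:E)%E.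
    by apply: esum_dst; rewrite q0.
  case: (a s `^ p)%E ap0 => [x| |] // x0.
    apply: le_trans (esumZl_le _ _ _) _; rewrite -?lee_fin//.
      by move=> k; rewrite lee_fin exprn_ge0// ltW.
    by rewrite muleC lee_wpmul2r.
  by rewrite gt0_muley ?leey// lte_fin (lt_le_trans ltr01).
apply: le_trans (esumZl_le _ _ _) _.
- by rewrite (le_trans ler01).
- by move=> s; rewrite poweR_ge0.
rewrite poweRM ?Lnorm_ge0//; last by rewrite lee_fin (le_trans ler01).
rewrite lp_power// poweR_EFin lee_wpmul2r//; first by apply: esum_ge0 => k _; rewrite poweR_ge0.
rewrite lee_fin.
by rewrite -[leLHS](powRr1 (le_trans ler01 D1)) ler_powR.
Qed.

End sequence_norms.

(** * Mixed sequence norms *)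

Section mixed_sequence_norms.
Context {R : realType}.
Implicit Types (p : R).
Local Notation lp p a := (Lnorm counting p%:E a).
Local Notation lseq p a := (lseq_norm (fun j => (p j)%:E) a).

Lemma lseq_normS m (theta : 'I_m.+1 -> \bar R) (a : m.+1.-tuple nat -> \bar R) :
  lseq_norm theta a = lseq_norm (fun j => theta (lift ord0 j))
    (fun k' => Lnorm counting (theta ord0) (fun k => a [tuple of k :: k'])).
Proof. exact: mixed_normS. Qed.

Lemma lseq_norm0 (theta : 'I_0 -> \bar R) a : lseq_norm theta a = a [tuple].
Proof. exact: mixed_norm0. Qed.

Lemma lseq_ge0 m (p : 'I_m -> R) a : (forall k, (0 <= a k)%E) -> (0 <= lseq p a)%E.
Proof.
elim: m p a => [|m IH] p a a0; first by rewrite lseq_norm0.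
by rewrite lseq_normS; apply: (IH (fun j => p (lift ord0 j))) => k; exact: Lnorm_ge0.
Qed.

Lemma le_lseq m (p : 'I_m -> R) a b : (forall j, 0 < p j) -> (forall k, (0 <= a k)%E) ->
  (forall k, (a k <= b k)%E) -> (lseq p a <= lseq p b)%E.
Proof.
elim: m p a b => [|m IH] p a b p0 a0 ab; first by rewrite !lseq_norm0.
rewrite !lseq_normS; apply: (IH (fun j => p (lift ord0 j))) => // k.
  exact: Lnorm_ge0.
by apply: le_lp.
Qed.

Lemma lseq_ge_term m (p : 'I_m -> R) a k : (forall j, 0 < p j) ->
  (forall k, (0 <= a k)%E) -> (a k <= lseq p a)%E.
Proof.
elim: m p a k => [|m IH] p a k p0 a0; first by rewrite lseq_norm0 (tuple0 k).
rewrite lseq_normS (tuple_eta k).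
pose b (k' : m.-tuple nat) := lp (p ord0) (fun k => a [tuple of k :: k']).
apply: (@le_trans _ _ (b [tuple of behead k])).
  exact: (lp_ge_term (a := fun l => a [tuple of l :: [tuple of behead k]])).
by apply: (IH (fun j => p (lift ord0 j)) b) => // k'; exact: Lnorm_ge0.
Qed.

Lemma lseqZ_le m (p : 'I_m -> R) a (c : R) : (forall j, 0 < p j) -> 0 <= c ->
  (forall k, (0 <= a k)%E) ->
  (lseq p (fun k => c%:E * a k) <= c%:E * lseq p a)%E.
Proof.
elim: m p a => [|m IH] p a p0 c0 a0; first by rewrite !lseq_norm0.
rewrite !lseq_normS.
apply: le_trans (IH (fun j => p (lift ord0 j))
   (fun k' => lp (p ord0) (fun k => a [tuple of k :: k'])) _ c0 _) => //.
  apply: (@le_lseq _ (fun j => p (lift ord0 j))) => // k'; first exact: Lnorm_ge0.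
  exact: lpZ_le.
by move=> k'; exact: Lnorm_ge0.
Qed.

Lemma dst_prod_esum m (q : R) (k : m.-tuple nat) : 0 < q < 1 ->
  (\esum_(s in [set: m.-tuple nat]) (\prod_j q ^+ dst (tnth s j) (tnth k j))%:E <=
   ((2 / (1 - q)) ^+ m)%:E)%E.
Proof.
move=> q01; have /andP[q0 q1] := q01.
have := @esum_tuple_prod R nat m (fun j s => q ^+ dst s (tnth k j)) (fun=> 2 / (1 - q)).
rewrite prodr_const card_ord; apply.
- by move=> j s; rewrite exprn_ge0// ltW.
- by move=> j; rewrite divr_gt0// subr_gt0.
- by move=> j; exact: esum_dst.
Qed.

(** In the induction the kernel in the remaining variables is bounded by a
    square. One factor is spent on moving the supremum over these variables
    out of the innermost norm, the other one is the kernel of the induction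
    hypothesis. *)
Lemma lseq_convolution_le m (p : 'I_m -> R) (q : R) : (forall j, 1 <= p j) -> 0 < q < 1 ->
  exists2 C : R, 0 < C & forall a : m.-tuple nat -> \bar R, (forall k, (0 <= a k)%E) ->
  (lseq p (fun k => ereal_sup (range (fun s =>
     (\prod_j q ^+ dst (tnth s j) (tnth k j))%:E * a s))) <= C%:E * lseq p a)%E.
Proof.
elim: m p q => [|m IH] p q p1 /andP[q0 q1].
  exists 1 => // a a0; rewrite !lseq_norm0 mul1e.
  by apply: ge_ereal_sup => _ [s _ <-]; rewrite big_ord0 mul1e (tuple0 s).
have q01 : 0 < q < 1 by rewrite q0.
have [eta eta01 etaq] := exists_root_ge 2 q01.
have [C C0 IHC] := IH (fun j => p (lift ord0 j)) eta (fun j => p1 _) eta01.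
have /andP[eta0 eta1] := eta01.
pose W := (2 / (1 - eta)) ^+ m.
have W1 : 1 <= W.
  by apply: exprn_ege1; rewrite ler_pdivlMr ?subr_gt0// mul1r; lra.
pose D := 2 / (1 - q).
have D0 : 0 < D by rewrite divr_gt0// subr_gt0.
have W0 : 0 < W by rewrite (lt_le_trans ltr01).
exists (C * (W * D)); first by rewrite mulr_gt0// mulr_gt0.
have p0 j : 0 < p j by rewrite (lt_le_trans ltr01).
move=> a a0; rewrite !lseq_normS.
pose B (k' : m.-tuple nat) := lp (p ord0) (fun k => a [tuple of k :: k']).
pose wt (s' k' : m.-tuple nat) := \prod_j eta ^+ dst (tnth s' j) (tnth k' j).
have B0 k' : (0 <= B k')%E by exact: Lnorm_ge0.
have wt0 s' k' : 0 < wt s' k' by apply: prodr_gt0 => j _; rewrite exprn_gt0.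
apply: (@le_trans _ _ (lseq (fun j => p (lift ord0 j))
   (fun k' => (W * D)%:E * ereal_sup (range (fun s' => (wt s' k')%:E * B s'))))%E); last first.
  have supB k' : (0 <= ereal_sup (range (fun s' => (wt s' k')%:E * B s')))%E.
    apply: le_trans (ereal_sup_ubound _); last by exists k'.
    by rewrite mule_ge0// lee_fin ltW.
  have WD0 : 0 <= W * D by rewrite mulr_ge0// ltW.
  apply: le_trans (@lseqZ_le _ (fun j => p (lift ord0 j)) _ _ (fun j => p0 _) WD0 supB) _.
  rewrite [C * _]mulrC [in leRHS]EFinM -muleA.
  apply: lee_wpmul2l; first by rewrite lee_fin.
  exact: IHC.
apply: (@le_lseq _ (fun j => p (lift ord0 j))) => // k'; first exact: Lnorm_ge0.
pose c (s' : m.-tuple nat) k := ereal_sup (range (fun s0 => (q ^+ dst s0 k)%:E * a [tuple of s0 :: s']))%E.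
have c0 s' k : (0 <= c s' k)%E.
  apply: le_trans (ereal_sup_ubound _); last by exists k.
  by rewrite mule_ge0// lee_fin exprn_ge0// ltW.
apply: (@le_trans _ _ (lp (p ord0) (fun k => ereal_sup (range (fun s' => ((wt s' k' ^+ 2)%:E * c s' k)%E))))).
  apply: le_lp => //.
    move=> k; apply: le_trans (ereal_sup_ubound _); last by exists [tuple of k :: k'].
    by rewrite mule_ge0// lee_fin prodr_ge0// => j _; rewrite exprn_ge0// ltW.
  move=> k; apply: ge_ereal_sup => _ [s _ <-].
  apply: le_trans (ereal_sup_ubound _); last by exists [tuple of behead s].
  rewrite big_ord_recl tnth0 (_ : tnth s ord0 = thead s)// EFinM muleAC.
  rewrite [leRHS]muleC; apply: lee_pmul => //.
  - by rewrite mule_ge0// lee_fin exprn_ge0// ltW.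
  - by rewrite lee_fin prodr_ge0// => j _; rewrite exprn_ge0// ltW.
  - by apply: ereal_sup_ubound; exists (thead s) => //; rewrite -tuple_eta.
  - rewrite lee_fin /wt -prodrXl; apply: ler_prod => j _.
    apply/andP; split; first by rewrite exprn_ge0// ltW.
    rewrite tnthS (_ : tnth s (lift ord0 j) = tnth [tuple of behead s] j); last first.
      by rewrite {1}(tuple_eta s) tnthS.
    rewrite -exprM mulnC exprM; apply: lerXn2r; rewrite // nnegrE.
      exact: ltW.
    by rewrite exprn_ge0// ltW.
apply: le_trans (lp_sup_le k' (p1 ord0) (w := fun s' => wt s' k') _ W1 _ c0) _.
- move=> s'; rewrite wt0 /= /wt.
  have : \prod_(j < m) eta ^+ dst (tnth s' j) (tnth k' j) <= \prod_(j < m) 1.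
    by apply: ler_prod => j _; apply/andP; split;
      [rewrite exprn_ge0|rewrite exprn_ile1]; rewrite // ltW.
  by rewrite prodr_const expr1n.
- exact: dst_prod_esum.
rewrite EFinM -muleA; apply: lee_wpmul2l; first by rewrite lee_fin ltW.
apply: ge_ereal_sup => _ [s' _ <-].
apply: (@le_trans _ _ ((wt s' k')%:E * (D%:E * B s'))%E).
  apply: lee_wpmul2l; first by rewrite lee_fin ltW.
  exact: lp_convolution_le.
rewrite muleCA; apply: lee_wpmul2l; first by rewrite lee_fin ltW.
by apply: ereal_sup_ubound; exists s'.
Qed.

End mixed_sequence_norms.

(** * Hoelder's inequality and Lorentz norms *)

Section hoelder_sequences.
Context {R : realType}.
Implicit Types (p : R).
Local Notation lp p a := (Lnorm counting p%:E a).
Local Notation lseq p a := (lseq_norm (fun j => (p j)%:E) a).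

(** If [x] is the [l_q] norm, each term is at most [x], hence its [p]-th
    power is at most [x ^ (p - q)] times its [q]-th power. *)
Lemma lp_antitone p q (a : nat -> \bar R) : 0 < q -> q <= p -> (forall k, (0 <= a k)%E) ->
  (lp p a <= lp q a)%E.
Proof.
move=> q0 qp a0; have p0 : 0 < p by rewrite (lt_le_trans q0).
have term k := lp_ge_term k q0 a0.
have [Eoo|Eoo] := eqVneq (lp q a) +oo%E; first by rewrite Eoo leey.
have E : lp q a = (fine (lp q a))%:E by rewrite fineK// ge0_fin_numE ?Lnorm_ge0// ltey.
have := Lnorm_ge0 counting q%:E a; rewrite E; move: (fine _) E => x E.
rewrite lee_fin le_eqVlt => /predU1P[x0|x0].
  have {}a0 k : a k = 0%E.
    by apply/eqP; rewrite eq_le a0 andbT (le_trans (term k))// E -x0.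
  rewrite -x0 (_ : a = cst 0%E) ?Lnorm0//; last exact/funext.
  by rewrite eqe gt_eqF.
apply: (le_poweR_inv p0); rewrite ?Lnorm_ge0 ?lee_fin ?(ltW x0)//.
rewrite lp_power//.
have xpq : (x `^ p = x `^ (p - q) * x `^ q) by rewrite -powRD ?subrK// gt_eqF ?implybT.
apply: (@le_trans _ _ (\esum_(k in [set: nat]) ((x `^ (p - q))%:E * a k `^ q)%E)).
  apply: le_esum => k _.
  have ak : a k \is a fin_num by rewrite ge0_fin_numE// (le_lt_trans (term k))// E ltry.
  have := term k; have := a0 k; rewrite -(fineK ak) E !lee_fin => y0 yx.
  have [y00|y00] := eqVneq (fine (a k)) 0.
    by rewrite y00 !powR0 ?gt_eqF// mulr0.
  have -> : (fine (a k) `^ p = fine (a k) `^ (p - q) * fine (a k) `^ q).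
    by rewrite -powRD ?subrK// y00 implybT.
  rewrite ler_wpM2r ?powR_ge0//; apply: ge0_ler_powR; rewrite ?subr_ge0// nnegrE//.
  exact: ltW.
apply: le_trans (esumZl_le _ (powR_ge0 _ _) _) _; first by move=> k; rewrite poweR_ge0.
by rewrite -lp_power// E !poweR_EFin -EFinM -xpq.
Qed.

(** Hoelder's inequality for the [p]-th powers, with the conjugate exponents
    [e / p] and [q / p]. *)
Lemma hoelder_lp p (e q : R) (a b : nat -> \bar R) : 0 < p -> 0 < e -> 0 < q ->
  p^-1 = e^-1 + q^-1 -> (forall k, (0 <= a k)%E) -> (forall k, (0 <= b k)%E) ->
  (lp p (fun k => a k * b k) <= lp e a * lp q b)%E.
Proof.
move=> p0 e0 q0 peq a0 b0.
have ta k := lp_ge_term k e0 a0; have tb k := lp_ge_term k q0 b0.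
have zero (c : nat -> \bar R) r : 0 < r -> (forall k, (0 <= c k)%E) -> lp r c = 0%E ->
    forall k, c k = 0%E.
  move=> r0 c0 cr k; apply/eqP; rewrite eq_le c0 andbT -cr.
  exact: lp_ge_term.
have lp0 : lp p (fun _ : nat => 0%E : \bar R) = 0%E.
  by apply: Lnorm0; rewrite eqe gt_eqF.
have [A0|A0] := eqVneq (lp e a) 0%E.
  by rewrite A0 mul0e (_ : (fun k => _) = fun=> 0%E) ?lp0//; apply/funext => k; rewrite (zero _ _ e0 a0 A0) mul0e.
have [B0|B0] := eqVneq (lp q b) 0%E.
  by rewrite B0 mule0 (_ : (fun k => _) = fun=> 0%E) ?lp0//; apply/funext => k; rewrite (zero _ _ q0 b0 B0) mule0.
have {}A0 : (0 < lp e a)%E by rewrite lt_def A0 Lnorm_ge0.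
have {}B0 : (0 < lp q b)%E by rewrite lt_def B0 Lnorm_ge0.
have [Aoo|Aoo] := eqVneq (lp e a) +oo%E; first by rewrite Aoo gt0_mulye// leey.
have [Boo|Boo] := eqVneq (lp q b) +oo%E; first by rewrite Boo gt0_muley// leey.
have af k : a k \is a fin_num.
  by rewrite ge0_fin_numE// (le_lt_trans (ta k))// ltey.
have bf k : b k \is a fin_num.
  by rewrite ge0_fin_numE// (le_lt_trans (tb k))// ltey.
have aE : a = EFin \o (fine \o a) by apply/funext => k /=; rewrite fineK.
have bE : b = EFin \o (fine \o b) by apply/funext => k /=; rewrite fineK.
pose f k := fine (a k) `^ p; pose g k := fine (b k) `^ p.
have fa0 k : 0 <= fine (a k) by rewrite fine_ge0.
have fb0 k : 0 <= fine (b k) by rewrite fine_ge0.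
have ep0 : 0 < e / p by rewrite divr_gt0.
have qp0 : 0 < q / p by rewrite divr_gt0.
have conj : (e / p)^-1 + (q / p)^-1 = 1.
  by rewrite !invf_div -mulrDr -peq mulfV// gt_eqF.
have H := @hoelder _ _ R counting f g (e / p) (q / p) _ _ ep0 qp0 conj.
have ab0 k : (0 <= a k * b k)%E by rewrite mule_ge0.
apply: (le_poweR_inv p0); rewrite ?Lnorm_ge0 ?mule_ge0 ?Lnorm_ge0// poweRM ?Lnorm_ge0//.
have normP r (c : nat -> \bar R) : 0 < r -> (forall k, (0 <= c k)%E) ->
    (forall k, c k \is a fin_num) ->
    (lp (r / p) (EFin \o (fun k => (fine (c k) `^ p)%R)) = lp r c `^ p)%E.
  move=> r0 c0 cf; rewrite !lpE ?divr_gt0//; last by move=> k; rewrite lee_fin powR_ge0.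
  rewrite invf_div -poweRrM [r^-1 * p]mulrC; congr (_ `^ _)%E.
  apply: eq_esum => k _; rewrite -[in RHS](fineK (cf k)) /=.
  by rewrite -powRrM mulrC divfK// gt_eqF.
rewrite -(normP e a)// -(normP q b)//; apply: le_trans _ (H _ _) => //.
rewrite lp_power//.
rewrite Lnorm1 ge0_integral_count// nneseries_esumT//.
apply: le_esum => k _ /=.
rewrite poweRM// -{1}(fineK (af k)) -{1}(fineK (bf k)) /= -EFinM ger0_norm//.
by rewrite mulr_ge0// powR_ge0.
Qed.

Lemma lseq_antitone m (p q : 'I_m -> R) (a : m.-tuple nat -> \bar R) :
  (forall j, 0 < q j) -> (forall j, q j <= p j) -> (forall k, (0 <= a k)%E) ->
  (lseq p a <= lseq q a)%E.
Proof.
elim: m p q a => [|m IH] p q a q0 qp a0; first by rewrite !lseq_norm0.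
rewrite !lseq_normS.
apply: le_trans (IH (fun j => p (lift ord0 j)) (fun j => q (lift ord0 j)) _ _ _ _) _ => //.
  by move=> k; exact: Lnorm_ge0.
apply: (@le_lseq _ _ (fun j => q (lift ord0 j))) => // k; first exact: Lnorm_ge0.
exact: lp_antitone.
Qed.

Lemma hoelder_lseq m (p e q : 'I_m -> R) (a b : m.-tuple nat -> \bar R) :
  (forall j, 0 < p j) -> (forall j, 0 < e j) -> (forall j, 0 < q j) ->
  (forall j, (p j)^-1 = (e j)^-1 + (q j)^-1) ->
  (forall k, (0 <= a k)%E) -> (forall k, (0 <= b k)%E) ->
  (lseq p (fun k => a k * b k) <= lseq e a * lseq q b)%E.
Proof.
elim: m p e q a b => [|m IH] p e q a b p0 e0 q0 peq a0 b0; first by rewrite !lseq_norm0.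
rewrite !lseq_normS.
apply: le_trans (IH (fun j => p (lift ord0 j)) (fun j => e (lift ord0 j))
  (fun j => q (lift ord0 j)) _ _ _ _ _ _ _ _) => //; last 2 first.
- by move=> k; exact: Lnorm_ge0.
- by move=> k; exact: Lnorm_ge0.
apply: (@le_lseq _ _ (fun j => p (lift ord0 j))) => // k; first exact: Lnorm_ge0.
exact: hoelder_lp.
Qed.

End hoelder_sequences.

Section lorentz.
Context {R : realType}.
Local Notation leb := (@lebesgue_measure R).
Local Notation lp p a := (Lnorm counting p%:E a).
Local Notation lseq p a := (lseq_norm (fun j => (p j)%:E) a).

(** The integral of a non-negative function is a supremum over simple
    functions, hence monotone without any measurability assumption. *)
Lemma ge0_le_integral_nonmeasurable d (T : measurableType d)
    (mu : {measure set T -> \bar R}) (D : set T) (f g : T -> \bar R) :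
  (forall x, D x -> (0 <= f x)%E) -> (forall x, D x -> (f x <= g x)%E) ->
  (\int[mu]_(x in D) f x <= \int[mu]_(x in D) g x)%E.
Proof.
move=> f0 fg.
rewrite !ge0_integralE//; last by move=> x Dx; rewrite (le_trans (f0 x Dx))// fg.
apply: le_ereal_sup => _ [h hf <-]; exists h => // x.
apply: le_trans (hf x) _; rewrite !patchE.
by case: ifPn => // /set_mem Dx; exact: fg.
Qed.

Lemma dyadic_interval (t : R) : 0 < t <= 1 ->
  exists k : nat, 2 ^- k.+1 < t <= 2 ^- k.
Proof.
move=> /andP[t0 t1]; have [N hN] := pow2_small t0.
have ex : exists k, 2 ^- k.+1 < t by exists N; case/andP: (hN _ (leqW (leqnn N))).
case: (ex_minnP ex) => k kt kmin; exists k; rewrite kt /=.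
case: k kt kmin => [|k] kt kmin; first by rewrite expr0 invr1.
by rewrite leNgt; apply/negP => h; have := kmin _ h; rewrite ltnn.
Qed.

(** On the [k]-th dyadic cell [1 / t] is at most the reciprocal of the
    length of the cell, which therefore contributes at most
    [(psi (2 ^- k) * a k) ^ tau]. The cells exhaust the unit interval up to
    the point [0]. *)
Lemma lorentz_norm_le (psi : R -> R) (tau : R) (g : R -> \bar R) (a : nat -> \bar R) :
  Phi_function psi -> 0 < tau -> (forall t, (0 <= g t)%E) -> (forall k, (0 <= a k)%E) ->
  (forall k t, 2 ^- k.+1 < t <= 2 ^- k -> (g t <= a k)%E) ->
  (lorentz_norm psi tau g <= lp tau (fun k => (psi (2 ^- k))%:E * a k))%E.
Proof.
move=> hpsi tau0 g0 a0 ga.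
have ps0 k : 0 < psi (2 ^- k) by exact: Phi_pow2_gt0.
have pa0 k : (0 <= (psi (2 ^- k))%:E * a k)%E by rewrite mule_ge0// lee_fin ltW.
have int0 : (0 <= \int[leb]_(t in @unit_itv R)
      ((psi t `^ tau)%:E * g t `^ tau * (t^-1)%:E))%E.
  apply: integral_ge0 => t; rewrite /unit_itv/= in_itv/= => /andP[t0 _].
  by rewrite !mule_ge0// ?poweR_ge0// lee_fin ?powR_ge0// invr_ge0.
apply: (le_poweR_inv tau0); rewrite ?Lnorm_ge0 ?poweR_ge0// lp_power//.
rewrite /lorentz_norm -poweRrM mulVf ?gt_eqF// poweRe1//.
pose J k : set R := `]2 ^- k.+1, 2 ^- k]%classic.
pose H k t := (((psi (2 ^- k))%:E * a k) `^ tau * (2 ^+ k.+1 * \1_(J k) t)%:E)%E.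
have H0 k t : (0 <= H k t)%E by rewrite mule_ge0 ?poweR_ge0// lee_fin mulr_ge0.
have mJ k : measurable (J k) by exact: measurable_itv.
have mH k : measurable_fun (@unit_itv R) (H k).
  apply: measurable_funeM; apply/measurable_EFinP; apply: measurable_funM => //.
have munit : measurable (@unit_itv R) by exact: measurable_itv.
apply: (@le_trans _ _ (\int[leb]_(t in @unit_itv R) \sum_(k <oo) H k t)%E).
  apply: ge0_le_integral_nonmeasurable => t; rewrite /unit_itv/= in_itv/= => /andP[t0 t1].
    by rewrite !mule_ge0// ?poweR_ge0// lee_fin ?powR_ge0// invr_ge0.
  move: t0; rewrite le_eqVlt => /predU1P[<-|t0].
    rewrite invr0 mule0; exact: nneseries_ge0.
  have [k kt] : exists k : nat, 2 ^- k.+1 < t <= 2 ^- k by apply: dyadic_interval; rewrite t0.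
  apply: (@le_trans _ _ (H k t)); last first.
    rewrite nneseries_esumT//.
    exact: (le_esum_term (f := fun k => H k t)).
  rewrite /H indicE mem_set ?mulr1; last by rewrite /J /= in_itv.
  have /andP[kt1 kt2] := kt.
  apply: lee_pmul.
  - by rewrite mule_ge0// ?poweR_ge0// lee_fin powR_ge0.
  - by rewrite lee_fin invr_ge0 ltW.
  - rewrite poweRM//; last by rewrite lee_fin ltW.
    rewrite poweR_EFin; apply: lee_pmul; rewrite ?lee_fin ?powR_ge0 ?poweR_ge0//.
      apply: ge0_ler_powR; rewrite ?nnegrE ?(ltW tau0) ?(ltW (ps0 _))//.
        by apply: Phi_ge0 => //; rewrite (ltW t0).
      apply: Phi_nondecreasing => //; first exact: ltW.
      by case/andP: (pow2_01 (R := R) k).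
    apply: le_poweR => //; first exact: ltW.
    exact: ga.
  - by rewrite lee_fin invf_ple ?posrE ?exprn_gt0// ltW.
rewrite integral_nneseries// -nneseries_esumT; last by move=> k; rewrite poweR_ge0.
apply: lee_nneseries => [k _|k _]; first by move=> *; apply: integral_ge0 => t _.
have mJind : measurable_fun (@unit_itv R) (fun t => (\1_(J k) t : R)%:E).
  by apply/measurable_EFinP; exact: measurable_indic.
have mJr : measurable_fun (@unit_itv R) (fun t => (2 ^+ k.+1 * \1_(J k) t : R)%:E).
  by apply/measurable_EFinP; apply: measurable_funM.
rewrite /H ge0_integralZl//; last by rewrite poweR_ge0.
rewrite -[leRHS]mule1; apply: lee_wpmul2l; first exact: poweR_ge0.
under eq_integral do rewrite EFinM.
rewrite ge0_integralZl_EFin//.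
rewrite (integral_indic leb munit (mJ k)).
apply: (@le_trans _ _ ((2 ^+ k.+1)%:E * leb (J k))%E).
  by apply: lee_wpmul2l; rewrite ?lee_fin//; apply: le_lebesgue => x [].
rewrite /J lebesgue_measure_itv/= lte_fin.
have -> : (2 ^- k.+1 < 2 ^- k :> R).
  by rewrite ltf_pV2 ?posrE ?exprn_gt0// exprS ltr_pMl ?exprn_gt0// ltr1n.
rewrite -EFinD -EFinM lee_fin mulrBr mulfV ?expf_neq0// exprS mulfK ?expf_neq0//.
Qed.

(** A bound that is constant on the cells of all variables turns, after the
    norm in the first variable, into such a bound for the remaining ones;
    thus the inner norms need not be measurable functions. *)
Lemma mixed_lorentz_norm_le m (psi : 'I_m -> R -> R) (tau : 'I_m -> R)
    (F : m.-tuple R -> \bar R) (a : m.-tuple nat -> \bar R) t0 :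
  (forall j, Phi_function (psi j)) -> (forall j, 0 < tau j) ->
  (forall t, (0 <= F t)%E) -> (forall k, (0 <= a k)%E) ->
  (forall k t, (forall j, 2 ^- (tnth k j).+1 < tnth t j <= 2 ^- (tnth k j)) ->
     (F t <= a k)%E) ->
  (mixed_norm (fun j => lorentz_norm (psi j) (tau j)) F t0 <=
   lseq tau (fun k => (\prod_j psi j (2 ^- tnth k j))%:E * a k))%E.
Proof.
elim: m psi tau F a => [|m IH] psi tau F a hpsi tau0 F0 a0 Fa.
  by rewrite mixed_norm0 lseq_norm0 big_ord0 mul1e; apply: Fa => -[].
rewrite mixed_normS lseq_normS.
pose b (k' : m.-tuple nat) := lp (tau ord0) (fun k => (psi ord0 (2 ^- k))%:E * a [tuple of k :: k'])%E.
apply: (@le_trans _ _ (lseq (fun j => tau (lift ord0 j))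
   (fun k' => (\prod_j psi (lift ord0 j) (2 ^- tnth k' j))%:E * b k'))%E).
  apply: (IH (fun j => psi (lift ord0 j)) (fun j => tau (lift ord0 j))) => //.
  - by move=> t; exact: poweR_ge0.
  - by move=> k; exact: Lnorm_ge0.
  move=> k' t' kt'; apply: lorentz_norm_le => // k t kt; apply: Fa.
  by apply/forall_ordS; rewrite !tnth0; split => // j; rewrite !tnthS.
have P0 (k' : m.-tuple nat) : 0 < \prod_j psi (lift ord0 j) (2 ^- tnth k' j).
  by apply: prodr_gt0 => j _; exact: Phi_pow2_gt0.
apply: (@le_lseq _ _ (fun j => tau (lift ord0 j))) => // k'.
  by rewrite mule_ge0 ?Lnorm_ge0// lee_fin ltW.
have t0' k : (0 <= (psi ord0 (2 ^- k))%:E * a [tuple of k :: k'])%E.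
  by rewrite mule_ge0// lee_fin ltW// Phi_pow2_gt0.
rewrite /b -lpZ//; apply: le_lp => // k.
  by rewrite mule_ge0// lee_fin ltW.
rewrite big_ord_recl tnth0 muleA -EFinM mulrC.
rewrite [X in (_ <= (_ * X)%:E * _)%E](eq_bigr (fun j => psi (lift ord0 j) (2 ^- tnth k' j)))//.
by move=> j _; rewrite tnthS.
Qed.

End lorentz.

(** * The complex exponential *)

Section exponential.
Context {R : realType}.
Local Notation normc := (@Normc.normc R).

Definition cexp (x : R) : R[i] := (cos x +i* sin x)%C.

Lemma cexpD x y : cexp (x + y) = cexp x * cexp y.
Proof.
rewrite /cexp cosD sinD /GRing.mul/=; congr (_ +i* _)%C.
exact: addrC.
Qed.

Lemma cexp0 : cexp 0 = 1.
Proof. by rewrite /cexp cos0 sin0. Qed.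

Lemma normc_cexp x : normc (cexp x) = 1.
Proof. by rewrite /= cos2Dsin2 sqrtr1. Qed.

Lemma cexp_neq0 x : cexp x != 0.
Proof.
apply/eqP => h; have := normc_cexp x; rewrite h Normc.normc0 => /eqP.
by rewrite eq_sym oner_eq0.
Qed.

Lemma cexpN x : cexp (- x) = (cexp x)^-1.
Proof.
by apply: (mulfI (cexp_neq0 x)); rewrite -cexpD subrr cexp0 mulfV// cexp_neq0.
Qed.

Lemma cexpMn x n : cexp (n%:R * x) = cexp x ^+ n.
Proof.
elim: n => [|n IH]; first by rewrite mul0r cexp0 expr0.
by rewrite exprS -IH -cexpD -addn1 natrD mulrDl mul1r addrC.
Qed.

Lemma cexp2pi : cexp (2 * pi) = 1.
Proof.
rewrite /cexp mulrC mulr_natr.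
by rewrite -[pi *+ 2]add0r sinD2pi cosD2pi sin0 cos0.
Qed.

Lemma normc_sum (I : Type) (s : seq I) (P : pred I) (F : I -> R[i]) :
  normc (\sum_(i <- s | P i) F i) <= \sum_(i <- s | P i) normc (F i).
Proof.
elim/big_rec2: _ => [|i y z _ h]; first by rewrite Normc.normc0.
by rewrite (le_trans (le_normcD _ _))// lerD2l.
Qed.

Lemma normcX (z : R[i]) n : normc (z ^+ n) = normc z ^+ n.
Proof.
elim: n => [|n IH]; first by rewrite !expr0 Normc.normc1.
by rewrite !exprS Normc.normcM IH.
Qed.

Lemma sin_linear_lower_bound :
  exists2 c : R, 0 < c & forall x, 0 <= x <= pi / 2 -> c * x <= sin x.
Proof.
have p0 := pi_gt0 R.
pose c0 : R := cos (pi / 4); pose s0 : R := sin (pi / 4).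
have c00 : 0 < c0 by apply: cos_gt0_pihalf; apply/andP; split; lra.
have s00 : 0 < s0 by apply: sin_gt0_pihalf; apply/andP; split; lra.
have cdecr (x y : R) : 0 <= x -> x <= y -> y <= pi / 2 -> cos y <= cos x.
  move=> x0 xy y1.
  have [<-|xy'] := eqVneq x y; first by [].
  have hx : 0 <= sin ((y + x) / 2) by apply: sin_ge0_pi; apply/andP; split; lra.
  have hy : 0 <= sin ((y - x) / 2) by apply: sin_ge0_pi; apply/andP; split; lra.
  have -> : x = (y + x) / 2 - (y - x) / 2 by lra.
  have {1}-> : y = (y + x) / 2 + (y - x) / 2 by lra.
  by rewrite cosB cosD; have := mulr_ge0 hx hy; lra.
have sincr (x y : R) : 0 <= x -> x <= y -> y <= pi / 2 -> sin x <= sin y.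
  move=> x0 xy y1; have := @cdecr (pi / 2 - y) (pi / 2 - x).
  by rewrite !cosB cos_pihalf sin_pihalf !mul0r !mul1r !add0r; apply; lra.
exists (Num.min c0 (s0 / (pi / 2))); first by rewrite lt_min c00 divr_gt0// divr_gt0.
move=> x /andP[x0 x1]; have [x4|x4] := leP x (pi / 4).
  apply: (@le_trans _ _ (c0 * x)); first by rewrite ler_wpM2r// ge_min lexx.
  move: x0; rewrite le_eqVlt => /predU1P[<-|x0]; first by rewrite mulr0 sin0.
  have dsin (y : R) : y \in `]0, x[ -> is_derive y 1 sin (cos y).
    by move=> _; apply: is_derive_sin.
  have csin : {within `[0, x], continuous (@sin R)}.
    by apply: derivable_within_continuous => y _; apply: derivable_sin.
  have [y] := MVT x0 dsin csin.
  rewrite in_itv/= => /andP[y0 yx]; rewrite sin0 !subr0 => ->.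
  by rewrite ler_pM2r//; apply: cdecr; lra.
apply: (@le_trans _ _ (s0 / (pi / 2) * x)); first by rewrite ler_wpM2r// ge_min lexx orbT.
apply: (@le_trans _ _ s0).
  by rewrite -mulrA ler_piMr ?(ltW s00)// ler_pdivrMl ?divr_gt0// mulr1.
by apply: sincr; lra.
Qed.

Lemma normc_cexpB1 x : normc (cexp x - 1) = 2 * `|sin (x / 2)|.
Proof.
have hx : x = x / 2 + x / 2 by lra.
rewrite /cexp /=.
have -> : (cos x - 1) ^+ 2 + (sin x - 0) ^+ 2 = (2 * sin (x / 2)) ^+ 2.
  rewrite {1 2}hx cosD sinD.
  have h := cos2Dsin2 (x / 2); move: h; set s := sin _; set c := cos _ => h.
  rewrite subr0.
  have -> : c * c - s * s - 1 = - (2 * s ^+ 2) by rewrite -[X in _ - _ - X]h; ring.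
  have -> : (- (2 * s ^+ 2)) ^+ 2 + (s * c + c * s) ^+ 2 = (2 * s) ^+ 2 * (c ^+ 2 + s ^+ 2) by ring.
  by rewrite h mulr1.
by rewrite sqrtr_sqr normrM ger0_norm.
Qed.

Lemma cexp_root_neq1 (M k : nat) : (0 < k < M)%N -> cexp (2 * pi / M%:R) ^+ k != 1.
Proof.
move=> /andP[k0 kM]; rewrite -cexpMn -subr_eq0; apply/eqP => h.
have := normc_cexpB1 (k%:R * (2 * pi / M%:R)); rewrite h Normc.normc0.
have M0n : (0 < M)%N by rewrite (leq_trans k0)// ltnW.
have M0 : 0 < M%:R :> R by rewrite ltr0n.
rewrite (_ : k%:R * (2 * pi / M%:R) / 2 = k%:R / M%:R * pi); last by field; rewrite gt_eqF.
have : 0 < sin (k%:R / M%:R * pi : R).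
  apply: sin_gt0_pi; rewrite mulr_gt0 ?pi_gt0 ?divr_gt0 ?ltr0n//=.
  by rewrite gtr_pMl ?pi_gt0// ltr_pdivrMr// mul1r ltr_nat.
by move=> s0 /esym/eqP; rewrite mulf_eq0 normr_eq0 pnatr_eq0 (gt_eqF s0).
Qed.

Lemma cexp_root_sum (M a b : nat) : (a < M)%N -> (b < M)%N ->
  \sum_(l < M) (cexp (2 * pi / M%:R) ^+ a / cexp (2 * pi / M%:R) ^+ b) ^+ l =
  if a == b then M%:R else 0.
Proof.
move=> aM bM; set z := cexp _.
have M0 : (0 < M)%N by rewrite (leq_trans _ aM).
have M0' : M%:R != 0 :> R by rewrite pnatr_eq0 -lt0n.
have z0 : z != 0 by exact: cexp_neq0.
have zM : z ^+ M = 1.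
  by rewrite -cexpMn mulrC divfK// cexp2pi.
case: eqVneq => [->|ab].
  by rewrite divff ?expf_neq0//; under eq_bigr do rewrite expr1n; rewrite sumr_const card_ord.
have u1 : z ^+ a / z ^+ b != 1.
  apply: contra_neq ab => h.
  have {}h : z ^+ a = z ^+ b by apply: (mulIf (invr_neq0 (expf_neq0 b z0))); rewrite h mulfV// expf_neq0.
  wlog ab : a b aM bM h / (a <= b)%N.
    by move=> W; have [/W|/ltnW/W] := leqP a b; [exact|move=> W'; apply/esym/W'].
  apply/eqP; rewrite eqn_leq ab /= leqNgt; apply/negP => ab'.
  have bM' : (0 < b - a < M)%N by rewrite subn_gt0 ab' (leq_ltn_trans (leq_subr _ _)).
  apply: (negP (cexp_root_neq1 bM')); apply/eqP/(mulfI (expf_neq0 a z0)).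
  by rewrite -/z -exprD subnKC// h mulr1.
have : (z ^+ a / z ^+ b) ^+ M - 1 = 0.
  by rewrite expr_div_n -!exprM ![(_ * M)%N]mulnC !exprM zM !expr1n divr1 subrr.
by rewrite subrX1 => /eqP; rewrite mulf_eq0 subr_eq0 (negbTE u1) /= => /eqP ->.
Qed.

End exponential.

(** * Sampling of trigonometric polynomials *)

Section sampling.
Context {R : realType}.
Local Notation normc := (@Normc.normc R).

(** Interpolation at the [M]-th roots of unity rotated by [cexp y]. On the
    unit circle the interpolating basis polynomials are means of [M] numbers
    of modulus [1], hence bounded by [1]. *)
Lemma poly_sampling (P : {poly R[i]}) (M : nat) (x y : R) : (0 < M)%N -> (size P <= M)%N ->
  normc P.[cexp x] <= \sum_(l < M) normc P.[cexp (y + 2 * pi * l%:R / M%:R)].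
Proof.
move=> M0 sP; have M0' : M%:R != 0 :> R[i] by rewrite pnatr_eq0 -lt0n.
pose z := cexp (2 * pi / M%:R : R).
have zE l : cexp (y + 2 * pi * l%:R / M%:R) = cexp y * z ^+ l.
  rewrite cexpD -cexpMn; congr (_ * cexp _); rewrite mulrAC; exact: mulrC.
have -> : P.[cexp x] = \sum_(l < M) P.[cexp y * z ^+ l] *
    (M%:R^-1 * \sum_(k < M) (cexp x / (cexp y * z ^+ l)) ^+ k).
  have hE w : P.[w] = \sum_(a < M) P`_a * w ^+ a by exact: horner_coef_wide.
  have y0 := cexp_neq0 y; have z0 : z != 0 by exact: cexp_neq0.
  transitivity (\sum_(a < M) P`_a * (M%:R^-1 * \sum_(k < M)
      (cexp x ^+ k * cexp y ^+ a / cexp y ^+ k * \sum_(l < M) (z ^+ a / z ^+ k) ^+ l))).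
    rewrite hE; apply: eq_bigr => a _; congr (_ * _).
    have zsum (k : 'I_M) : \sum_(l < M) (z ^+ a / z ^+ k) ^+ l = if a == k then M%:R else 0.
      by rewrite cexp_root_sum.
    rewrite (eq_bigr (fun k : 'I_M => cexp x ^+ k * cexp y ^+ a / cexp y ^+ k *
      (if a == k then M%:R else 0))); last by move=> k _; rewrite zsum.
    rewrite (bigD1 a)//= eqxx big1 ?addr0; last first.
      by move=> k ka; rewrite eq_sym (negbTE ka) mulr0.
    by rewrite mulfK ?expf_neq0// mulrC mulfK.
  under [RHS]eq_bigr do rewrite hE mulr_suml.
  rewrite exchange_big/=; apply: eq_bigr => a _.
  transitivity (P`_a * (M%:R^-1 * \sum_(l < M) \sum_(k < M)
      (cexp x ^+ k * cexp y ^+ a / cexp y ^+ k * (z ^+ a / z ^+ k) ^+ l))).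
    congr (_ * (_ * _)); rewrite exchange_big/=.
    by apply: eq_bigr => k _; rewrite mulr_sumr.
  rewrite !mulr_sumr; apply: eq_bigr => l _.
  rewrite !mulr_sumr; apply: eq_bigr => k _.
  rewrite !exprMn !exprVn !exprMn -!exprM invfM [(l * a)%N]mulnC [(l * k)%N]mulnC !exprM.
  by ring.
apply: le_trans (normc_sum _ _ _) _; apply: ler_sum => l _.
rewrite zE Normc.normcM ler_piMr ?normc_ge0//.
rewrite Normc.normcM Normc.normcV.
have -> : normc M%:R = M%:R by rewrite -[M%:R]/(1 *+ M) normcMn Normc.normc1.
rewrite ler_pdivrMl ?ltr0n// mulr1.
apply: le_trans (normc_sum _ _ _) _.
have zl : normc (cexp x / (cexp y * z ^+ l)) = 1.
  by rewrite Normc.normcM Normc.normcV Normc.normcM normcX !normc_cexp expr1n mulr1 invr1 mulr1.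
under eq_bigr do rewrite normcX zl expr1n.
by rewrite sumr_const card_ord.
Qed.

(** The distance of [l] to [0] on the cycle of length [M]. Off this cycle it
    is [l] itself, which keeps the inverse squares summable over all [l]. *)
Definition cyc (M l : nat) : nat := if (l < M)%N then minn l (M - l) else l.

Lemma angle_window (p t s u v : R) : 0 < p -> `|t| < p / u ->
  s + u^-1 <= v -> v <= 1 - s - u^-1 -> s * p <= t + p * v <= p - s * p.
Proof.
move=> p0; rewrite ltr_norml => /andP[t1 t2] /(ler_wpM2l (ltW p0)) h1 /(ler_wpM2l (ltW p0)) h2.
move: t1 t2 h1 h2; move: (u^-1) => w.
by move=> *; apply/andP; split; lra.
Qed.

(** The mean of [N] consecutive powers of a unimodular number [w <> 1] is at
    most [2 / (N * |w - 1|)], and the angle of [w] keeps a distance of the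
    order of [cyc M l / M] from the multiples of [2 pi], where
    [M = (q + 2) * N]. *)
Lemma cesaro_decay (q : nat) : exists2 C : R, 1 <= C &
  forall (N l : nat) (t : R), (0 < N)%N -> (l < (q + 2) * N)%N ->
  `|t| < 2 * pi / ((q + 2) * N)%:R ->
  normc (N%:R^-1 * \sum_(k < N) cexp (t + 2 * pi * l%:R / ((q + 2) * N)%:R) ^+ k) <=
  C / (1 + (cyc ((q + 2) * N) l)%:R).
Proof.
have [c c0 sinc] := @sin_linear_lower_bound R.
have p0 := pi_gt0 R.
pose C := Num.max 2 (3 * (q + 2)%:R / (c * pi)).
exists C; first by rewrite le_max ler1n.
move=> N l t N0; set M := ((q + 2) * N)%N => lM tM.
have M0 : (0 < M)%N by rewrite muln_gt0 addn2.
have M0' : 0 < M%:R :> R by rewrite ltr0n.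
have N0' : 0 < N%:R :> R by rewrite ltr0n.
set w := cexp _; set d := cyc M l.
have w1 : normc w = 1 by exact: normc_cexp.
have NE : normc N%:R = N%:R by rewrite -[N%:R]/(1 *+ N) normcMn Normc.normc1.
have le1 : normc (N%:R^-1 * \sum_(k < N) w ^+ k) <= 1.
  rewrite Normc.normcM Normc.normcV NE ler_pdivrMl// mulr1.
  apply: le_trans (normc_sum _ _ _) _.
  under eq_bigr do rewrite normcX w1 expr1n.
  by rewrite sumr_const card_ord.
have d1 : 0 < 1 + d%:R :> R by rewrite ltr_wpDr.
have [d2|d2] := leqP d 1.
  apply: le_trans le1 _; rewrite ler_pdivlMr// mul1r.
  apply: (@le_trans _ _ 2); last by rewrite le_max lexx.
  have : d%:R <= 1 :> R by rewrite -[1]/(1%:R) ler_nat.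
  lra.
have dE : d = minn l (M - l) by rewrite /d /cyc lM.
(* [t] moves the angle by less than one step of the grid, so [d - 1] steps
   remain *)
pose s : R := (d.-1)%:R / M%:R.
have sE : s * M%:R = d%:R - 1 by rewrite /s divfK ?gt_eqF// -{2}(prednK (ltnW d2)) -addn1 natrD addrK.
have d1' : 1 <= d%:R - 1 :> R.
  have : 2%:R <= d%:R :> R by rewrite ler_nat.
  lra.
have s0 : 0 < s by rewrite -(pmulr_lgt0 _ M0') sE; lra.
have hl1 : s + M%:R^-1 <= l%:R / M%:R.
  rewrite -(ler_pM2r M0') mulrDl sE divfK ?gt_eqF// mulVf ?gt_eqF//.
  have : d%:R <= l%:R :> R by rewrite ler_nat dE geq_minl.
  lra.
have hl2 : l%:R / M%:R <= 1 - s - M%:R^-1.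
  rewrite -(ler_pM2r M0') !mulrBl sE divfK ?gt_eqF// mulVf ?gt_eqF// mul1r.
  have : d%:R <= M%:R - l%:R :> R by rewrite -natrB ?(ltnW lM)// ler_nat dE geq_minr.
  lra.
pose f := (t + 2 * pi * l%:R / M%:R) / 2.
have fl : s * pi <= f <= pi - s * pi.
  have tE : `|t / 2| < pi / M%:R.
    rewrite normrM [`|2^-1|]ger0_norm ?invr_ge0// ltr_pdivrMr//.
    by rewrite mulrAC [pi * 2]mulrC.
  have -> : f = t / 2 + pi * (l%:R / M%:R) by rewrite /f; field; rewrite gt_eqF.
  exact: (angle_window p0 tE hl1 hl2).
have sinf : c * (s * pi) <= sin f.
  move: fl => /andP[f1 f2]; have sp : 0 <= s * pi by rewrite mulr_ge0// ltW.
  have [fp|fp] := leP f (pi / 2).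
    apply: (@le_trans _ _ (c * f)); first by rewrite ler_pM2l.
    by apply: sinc; rewrite fp (le_trans sp f1).
  have -> : sin f = sin (pi - f).
    by rewrite sinB sinpi cospi mul0r sub0r mulN1r opprK.
  apply: (@le_trans _ _ (c * (pi - f))); first by rewrite ler_pM2l//; lra.
  by apply: sinc; apply/andP; split; lra.
have wf : 2 * (c * (s * pi)) <= normc (w - 1).
  rewrite /w normc_cexpB1 ler_pM2l//.
  by rewrite (le_trans sinf)// ler_norm.
have csp0 : 0 < 2 * (c * (s * pi)) by rewrite mulr_gt0// mulr_gt0// mulr_gt0.
have geo : (w - 1) * \sum_(k < N) w ^+ k = w ^+ N - 1 by rewrite subrX1.
have geo2 : normc (\sum_(k < N) w ^+ k) * normc (w - 1) <= 2.
  rewrite mulrC -Normc.normcM geo (le_trans (le_normcD _ _))// normcN normcX w1.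
  by rewrite Normc.normc1 expr1n; lra.
rewrite Normc.normcM Normc.normcV NE ler_pdivrMl//.
apply: (@le_trans _ _ (2 / (2 * (c * (s * pi))))).
  rewrite ler_pdivlMr// (le_trans _ geo2)// ler_wpM2l// normc_ge0//.
have ds : 1 + d%:R <= 3 * (s * M%:R) by rewrite sE; lra.
apply: (@le_trans _ _ (N%:R * (3 * (q + 2)%:R / (c * pi) / (1 + d%:R)))); last first.
  by rewrite ler_wpM2l// ler_wpM2r// ?invr_ge0 ?(ltW d1)// le_max lexx orbT.
rewrite ler_pdivrMr//.
have -> : N%:R * (3 * (q + 2)%:R / (c * pi) / (1 + d%:R)) * (2 * (c * (s * pi))) =
    2 * (3 * (s * M%:R)) / (1 + d%:R).
  rewrite /M natrM; move: (pi) p0 => p p0; field.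
  by rewrite !gt_eqF.
by rewrite ler_pdivlMr// ler_wpM2l.
Qed.

End sampling.

Section sampling_decay.
Context {R : realType}.
Local Notation normc := (@Normc.normc R).

Lemma sum_inverse_squares n : \sum_(l < n) (1 + l%:R : R) ^- 2 <= 2.
Proof.
suff h : \sum_(l < n) (1 + l%:R : R) ^- 2 <= 2 - 2 / (1 + n%:R).
  by rewrite (le_trans h)// gerBl divr_ge0// addr_ge0.
elim: n => [|n IH]; first by rewrite big_ord0 addr0 divr1 subrr.
rewrite big_ord_recr/= (le_trans (lerD IH (lexx _)))//.
have n0 : 0 <= n%:R :> R by [].
rewrite -[n.+1%:R]natr1; move: (n%:R) n0 => x x0.
rewrite -subr_ge0.
have -> : 2 - 2 / (1 + (x + 1)) - (2 - 2 / (1 + x) + (1 + x) ^- 2) =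
   x / ((1 + x) ^+ 2 * (2 + x)).
  by field; apply/andP; split; lra.
by rewrite divr_ge0// mulr_ge0// ?sqr_ge0//; lra.
Qed.

(** Uniformly in [M]: the weight is split between the two ends of the cycle. *)
Lemma sum_cyc_inverse_squares M n : \sum_(l < n) (1 + (cyc M l)%:R : R) ^- 2 <= 4.
Proof.
have pos k : 0 <= (1 + k%:R : R) ^- 2 by rewrite invr_ge0 exprn_ge0// addr_ge0.
have le l : (1 + (cyc M l)%:R : R) ^- 2 <=
    (1 + l%:R) ^- 2 + (if (l < M)%N then (1 + (M - l)%:R) ^- 2 else 0).
  rewrite /cyc; case: ifP => lM; last by rewrite addr0.
  by rewrite /minn; case: ifP => _; rewrite ?lerDl ?lerDr.
apply: le_trans (ler_sum _ (fun (l : 'I_n) _ => le l)) _.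
rewrite big_split/= (_ : 4 = 2 + 2 :> R); last by lra.
apply: lerD; first exact: sum_inverse_squares.
rewrite -big_mkcond/=.
apply: le_trans (_ : _ <= \sum_(l < M) (1 + (M - l)%:R : R) ^- 2) _.
  rewrite -(big_mkord (fun l => (l < M)%N) (fun l => (1 + (M - l)%:R : R) ^- 2)).
  rewrite -(big_mkord xpredT (fun l => (1 + (M - l)%:R : R) ^- 2)).
  have [nM|Mn] := leqP n M.
    rewrite [leRHS](big_cat_nat (n := n))//= [leLHS]big_mkcond/=.
    rewrite (@le_trans _ _ (\sum_(0 <= l < n) (1 + (M - l)%:R : R) ^- 2))//.
      by apply: ler_sum => l _; case: ifP => // _; exact: pos.
    by rewrite lerDl sumr_ge0.
  rewrite (big_cat_nat (n := M))//= ?(ltnW Mn)// [X in _ + X <= _]big_nat_cond [X in _ + X <= _]big1 ?addr0; last first.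
    by move=> l /andP[/andP[Ml _]]; rewrite ltnNge Ml.
  by rewrite [leLHS]big_mkcond/=; apply: ler_sum => l _; case: ifP => // _; exact: pos.
rewrite (reindex_inj rev_ord_inj)/=.
apply: le_trans (sum_inverse_squares M).
apply: ler_sum => l _; rewrite subnA ?(ltnW (ltn_ord _))//; last first.
rewrite lef_pV2 ?posrE ?exprn_gt0 ?ltr_wpDr//.
by rewrite ler_pXn2r ?nnegrE ?addr_ge0// lerD2l ler_nat subnn add0n.
Qed.

(** Sampling is applied to the product of [P] and the power [p + 2] of a
    Cesaro kernel that equals [1] at [cexp x]. Its degree is still below the
    number [(p + 4) * N] of nodes, and the kernel decays away from [cexp x].
    Inverse squares of the distance sum up to a constant, so one node must
    carry the bound with the remaining decay of order [p]. *)
Lemma poly_sampling_decay (p : nat) : exists2 C : R, 1 <= C &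
  forall (P : {poly R[i]}) (N : nat) (x y : R), (0 < N)%N -> (size P <= 2 * N)%N ->
  `|x - y| < 2 * pi / ((p + 4) * N)%:R ->
  exists2 l : nat, (l < (p + 4) * N)%N &
    normc P.[cexp x] <= C * (1 + (cyc ((p + 4) * N) l)%:R) ^- p *
       normc P.[cexp (y + 2 * pi * (l%:R / ((p + 4) * N)%:R))].
Proof.
have [C C1 hC] := @cesaro_decay R (p + 2).
exists (8 * C ^+ (p + 2)).
  have : 1 <= C ^+ (p + 2) by rewrite exprn_ege1.
  lra.
move=> P N x y N0 sP xy.
have {}hC l : (l < (p + 4) * N)%N -> normc (N%:R^-1 *
    \sum_(k < N) cexp (y - x + 2 * pi * l%:R / ((p + 4) * N)%:R) ^+ k) <=
    C / (1 + (cyc ((p + 4) * N) l)%:R).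
  have -> : (p + 4 = p + 2 + 2)%N by lia.
  move=> lM; apply: hC => //; rewrite distrC.
  by rewrite (_ : (p + 2 + 2 = p + 4)%N)//; lia.
move: xy hC; set M := ((p + 4) * N)%N => xy hC.
have M0 : (0 < M)%N by rewrite muln_gt0 N0 addn4.
pose K : {poly R[i]} := N%:R^-1 *: \sum_(k < N) (cexp (- x) ^+ k) *: 'X^k.
have KE z : K.[cexp z] = N%:R^-1 * \sum_(k < N) cexp (z - x) ^+ k.
  rewrite /K hornerZ horner_sum; congr (_ * _); apply: eq_bigr => k _.
  by rewrite hornerZ hornerXn -exprMn -cexpD addrC.
have sK : (size K <= N)%N.
  apply: leq_trans (size_scale_leq _ _) _.
  apply: (leq_trans (size_sum _ _ _)); apply/bigmax_leqP => k _.
  by apply: leq_trans (size_scale_leq _ _) _; rewrite size_polyXn.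
have Kx : K.[cexp x] = 1.
  rewrite KE subrr cexp0; under eq_bigr do rewrite expr1n.
  by rewrite sumr_const card_ord mulVf// pnatr_eq0 -lt0n.
have sPK : (size (P * K ^+ (p + 2)%N)%R <= M)%N.
  apply: (leq_trans (size_polyMleq _ _)).
  have sKq : (size (K ^+ (p + 2)%N)%R <= N.-1 * (p + 2) + 1)%N.
    have := size_poly_exp_leq K (p + 2); rewrite addn1 => h; apply: (leq_trans h).
    by rewrite ltnS leq_mul2r orbC -ltnS (leq_ltn_trans _ (leqnn _))//; lia.
  by rewrite /M; move: sP sKq N0; set a := size P; set b := size _; nia.
have := poly_sampling x y M0 sPK.
rewrite hornerM horner_exp Kx expr1n mulr1 => samp.
(* otherwise the samples would add up to at most [S / 8 * 4] *)
apply: contrapT => hl.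
set S := normc P.[cexp x] in samp hl.
pose a l := normc P.[cexp (y + 2 * pi * l%:R / M%:R)].
pose e l : R := 1 + (cyc M l)%:R.
have e0 l : 0 < e l by rewrite ltr_wpDr.
have {}hl l : (l < M)%N -> 8 * C ^+ (p + 2) * e l ^- p * a l < S.
  move=> lM; rewrite ltNge; apply/negP => h; apply: hl; exists l => //.
  by rewrite [2 * pi * (_ / _)]mulrA.
have S0 : 0 < S.
  apply: le_lt_trans (hl 0%N M0); apply: mulr_ge0; last exact: normc_ge0.
  by rewrite mulr_ge0 ?invr_ge0 ?exprn_ge0 ?mulr_ge0 ?exprn_ge0 ?(ltW (e0 _))//; lra.
have : S <= S / 2; last by lra.
apply: le_trans samp _.
apply: (@le_trans _ _ (\sum_(l < M) S / 8 * e l ^- 2)); last first.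
  rewrite -mulr_sumr (@le_trans _ _ (S / 8 * 4))//; last by lra.
  by rewrite ler_pM2l ?sum_cyc_inverse_squares// divr_gt0.
apply: ler_sum => l _; rewrite hornerM Normc.normcM horner_exp normcX KE.
rewrite (_ : y + 2 * pi * l%:R / M%:R - x = y - x + 2 * pi * l%:R / M%:R); last first.
  by rewrite addrAC.
have h := hC l (ltn_ord l).
apply: (@le_trans _ _ (a l * (C / e l) ^+ (p + 2))).
  rewrite ler_wpM2l ?normc_ge0//.
  apply: lerXn2r => //; rewrite nnegrE ?normc_ge0// divr_ge0//; first lra.
  exact: ltW (e0 l).
have h2 := ltW (hl l (ltn_ord l)).
have -> : a l * (C / e l) ^+ (p + 2) = (8 * C ^+ (p + 2) / e l ^+ p * a l) / 8 * e l ^- 2.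
  rewrite expr_div_n [e l ^+ (p + 2)]exprD; move: (C ^+ _) (e l ^+ p) (expf_neq0 p (lt0r_neq0 (e0 l))).
  by move: (e l) (e0 l) (a l) => u u0 v w z z0; field; rewrite z0 gt_eqF.
by rewrite ler_pM2r ?invr_gt0 ?exprn_gt0// ler_pM2r ?invr_gt0.
Qed.

End sampling_decay.

(** * A Nikol'skii inequality for rearrangements *)

Section nikolskii.
Context {R : realType}.
Local Notation normc := (@Normc.normc R).

(** Multiplication by the exponential of frequency [N j] turns a
    trigonometric polynomial of degree less than [N j] in the [j]-th
    variable into a polynomial in the complex exponential, and does not
    change the modulus. This is the form in which sampling applies to one
    coordinate. *)
Definition trig_degree m (N : 'I_m -> nat) (g : m.-tuple R -> R[i]) : Prop :=
  forall x j, exists2 P : {poly R[i]}, (size P <= 2 * N j)%N &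
    forall y, normc (g (set_tnth x j y)) = normc P.[cexp y].

Lemma set_tnth_id T m (x : m.-tuple T) j : set_tnth x j (tnth x j) = x.
Proof. by apply: eq_from_tnth => i; rewrite tnth_mktuple; case: eqP => [->|]. Qed.

(** One coordinate is sampled after the other, the remaining ones being
    frozen. *)
Lemma trig_sampling (p : nat) : exists2 C : R, 1 <= C &
  forall m (N : 'I_m -> nat) (g : m.-tuple R -> R[i]) (x y : m.-tuple R),
  (forall j, (0 < N j)%N) -> trig_degree N g ->
  (forall j, `|tnth x j - tnth y j| < 2 * pi / ((p + 4) * N j)%:R) ->
  exists2 l : 'I_m -> nat, forall j, (l j < (p + 4) * N j)%N &
    normc (g x) <=
    C ^+ m * \prod_j (1 + (cyc ((p + 4) * N j) (l j))%:R) ^- p *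
    normc (g [tuple tnth y j + 2 * pi * ((l j)%:R / ((p + 4) * N j)%:R) | j < m]).
Proof.
have [C C1 hC] := @poly_sampling_decay R p; exists C => // m N g x y N0 tg xy.
have C0 : 0 < C by rewrite (lt_le_trans _ C1).
pose M j := ((p + 4) * N j)%N.
pose z k (l : 'I_m -> nat) := [tuple if (j < k)%N then tnth y j + 2 * pi * ((l j)%:R / (M j)%:R)
  else tnth x j | j < m].
suff [l lM gl] : exists2 l : 'I_m -> nat, forall j, (l j < M j)%N &
    normc (g x) <= C ^+ m * \prod_(j < m | (j < m)%N) (1 + (cyc (M j) (l j))%:R) ^- p *
      normc (g (z m l)).
  exists l => //.
  rewrite (eq_bigl (fun j : 'I_m => (j < m)%N)) => [|j]; last by rewrite ltn_ord.
  rewrite (_ : [tuple _ | _ < _] = z m l)//.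
  by apply: eq_from_tnth => j; rewrite !tnth_mktuple ltn_ord.
suff H : forall k, (k <= m)%N -> exists2 l : 'I_m -> nat, forall j, (l j < M j)%N &
    normc (g x) <= C ^+ k * \prod_(j < m | (j < k)%N) (1 + (cyc (M j) (l j))%:R) ^- p *
      normc (g (z k l)) by exact: H.
elim=> [_|k IH km].
  exists (fun=> 0%N); first by move=> j; rewrite muln_gt0 N0 addn4.
  rewrite expr0 big1 ?mulr1 ?mul1r; last by move=> j; rewrite ltn0.
  rewrite le_eqVlt; apply/orP; left; apply/eqP; congr (normc (g _)).
  by apply: eq_from_tnth => j; rewrite tnth_mktuple ltn0.
have [l lM gl] := IH (ltnW km).
pose j0 := Ordinal km.
have [P sP gP] := tg (z k l) j0.
have [l0 l0M Pl0] := hC P (N j0) (tnth x j0) (tnth y j0) (N0 j0) sP (xy j0).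
pose l' j := if j == j0 then l0 else l j.
exists l' => [j|]; first by rewrite /l'; case: eqP => [->|_].
have zE : z k l = set_tnth (z k l) j0 (tnth x j0).
  apply: eq_from_tnth => j; rewrite [RHS]tnth_mktuple; case: eqP => // ->.
  by rewrite tnth_mktuple ltnn.
have zE' : z k.+1 l' = set_tnth (z k l) j0 (tnth y j0 + 2 * pi * (l0%:R / (M j0)%:R)).
  apply: eq_from_tnth => j; rewrite !tnth_mktuple /l' ltnS leq_eqVlt.
  rewrite -[(j == k :> nat)]/(j == j0); case: eqP => //= ->; by [].
rewrite zE gP in gl; rewrite zE' gP.
apply: (le_trans gl).
set D := \prod_(j < m | (j < k)%N) _.
have -> : \prod_(j < m | (j < k.+1)%N) (1 + (cyc (M j) (l' j))%:R) ^- p =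
    (1 + (cyc (M j0) l0)%:R) ^- p * D :> R.
  rewrite (bigD1 j0)//= {1}/l' eqxx; congr (_ * _).
  apply: eq_big => [j|j /andP[_ jj0]].
    by rewrite ltnS [in RHS]ltn_neqAle andbC.
  by rewrite /l' (negbTE jj0).
have D0 : 0 <= D by apply: prodr_ge0 => j _; rewrite invr_ge0 exprn_ge0// addr_ge0.
rewrite exprSr.
apply: le_trans (ler_wpM2l _ Pl0) _; first by rewrite mulr_ge0// exprn_ge0// ltW.
rewrite le_eqVlt; apply/orP; left; apply/eqP.
by rewrite /M; ring.
Qed.

Lemma floor_eq_dist (x y : R) : Num.floor x = Num.floor y -> `|x - y| < 1.
Proof.
move=> xy; have := floor_itv x; have := floor_itv y; rewrite xy intrD mulr1z.
by move=> /andP[y1 y2] /andP[x1 x2]; rewrite ltr_norml; apply/andP; split; lra.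
Qed.

(** A trigonometric polynomial is dominated by a function that is constant on
    cells of side [1 / N] and is a supremum of rapidly decreasing multiples of
    translates of the polynomial itself, so that its rearrangement is
    essentially constant below [1 / N]. *)
Lemma nikolskii m : exists2 C : R, 0 < C &
  forall (N : 'I_m -> nat) (g : m.-tuple R -> R[i]) (kappa : 'I_m -> R -> R) (A : R),
  (forall j, (0 < N j)%N) -> trig_degree N g -> Defs.periodic g ->
  (forall j v, 0 < v -> 0 < kappa j v) ->
  (forall j e v, 0 < e <= 1 -> 0 < v -> kappa j (e * v) <= e^-1 * kappa j v) ->
  0 <= A ->
  (forall v, (forall j, 0 < v j <= 1) ->
     (torus_rearr (fun x => (normc (g x))%:E) v <= (A * \prod_j kappa j (v j))%:E)%E) ->
  forall u, (forall j, 0 < u j <= 1) ->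
  (torus_rearr (fun x => (normc (g x))%:E) u <=
     (C * A * \prod_j kappa j (Num.max (u j) (N j)%:R^-1)%R)%:E)%E.
Proof.
(* With this decay the coefficient [c l] below is proportional to [eps l ^ m],
   the factor lost in dilating [m] variables by [eps l]. *)
pose p := (2 * m)%N.
have [C C1 hC] := trig_sampling p.
have C0 : 0 < C by rewrite (lt_le_trans _ C1).
pose e : R := (p + 4)%:R^-1.
have e0 : 0 < e by rewrite invr_gt0 ltr0n addn4.
have e1 : e <= 1 by rewrite invf_le1 ?ltr0n ?addn4// ler1n.
pose D : R := C ^+ m * (2 * 4 ^+ m * e^-1) ^+ m.
exists D; first by rewrite mulr_gt0 ?exprn_gt0// mulr_gt0 ?invr_gt0// mulr_gt0// exprn_gt0.
move=> N g kappa A N0 tg gp k0 kscale A0 gA u u01.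
pose M j := ((p + 4) * N j)%N.
have M0 j : (0 < M j)%N by rewrite muln_gt0 N0 addn4.
have M0' j : 0 < (M j)%:R :> R by rewrite ltr0n.
have tp0 := @twopi_gt0 R.
set G := fun x => (normc (g x))%:E.
pose cell (x : m.-tuple R) := [set y : m.-tuple R | forall j, Num.floor ((M j)%:R * (tnth y j / (2 * pi))) =
   Num.floor ((M j)%:R * (tnth x j / (2 * pi)))].
pose MJ x := ereal_sup (G @` cell x).
pose w l j : R := (1 + (cyc (M j) l)%:R) ^- 2.
have w0 l j : 0 < w l j by rewrite invr_gt0 exprn_gt0// ltr_wpDr.
have w1 l j : w l j <= 1.
  by rewrite invf_le1 ?exprn_gt0 ?ltr_wpDr// exprn_ege1// lerDl.
pose H (l : m.-tuple nat) x := if [forall j, tnth l j < M j]%N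
  then G [tuple tnth x j + 2 * pi * ((tnth l j)%:R / (M j)%:R) | j < m] else 0%E.
pose c (l : m.-tuple nat) := C ^+ m * \prod_j (w (tnth l j) j) ^+ m.
pose eps (l : m.-tuple nat) := 2^-1 * \prod_j (w (tnth l j) j / 4).
have c0 l : 0 < c l by rewrite mulr_gt0 ?exprn_gt0//; apply: prodr_gt0 => j _; rewrite exprn_gt0.
have eps0 l : 0 < eps l by rewrite mulr_gt0//; apply: prodr_gt0 => j _; rewrite divr_gt0.
have eps1 l : eps l <= 1.
  rewrite /eps mulr_ile1// ?prodr_ge0 ?invf_le1 ?ler1n//; first by move=> j _; rewrite ltW// divr_gt0.
  by apply: prodr_ile1 => j _; rewrite ltW ?divr_gt0//=; have := w1 (tnth l j) j; lra.
have sume : (\esum_(l in [set: m.-tuple nat]) (eps l)%:E < 1)%E.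
  apply: (@le_lt_trans _ _ ((2^-1)%:E * \esum_(l in [set: m.-tuple nat])
      (\prod_j (w (tnth l j) j / 4))%:E)%E).
    under eq_esum do rewrite /eps EFinM.
    apply: esumZl_le => // l; rewrite lee_fin prodr_ge0// => j _.
    by rewrite ltW// divr_gt0.
  apply: (@le_lt_trans _ _ ((2^-1)%:E * 1%:E)%E); last by rewrite -EFinM lte_fin; lra.
  rewrite lee_wpmul2l// ?lee_fin//.
  have := @esum_tuple_prod R nat m (fun j l => w l j / 4) (fun=> 1).
  rewrite big1//; apply => // [j l|j]; first by rewrite ltW// divr_gt0.
  rewrite -nneseries_esumT; last by move=> l; rewrite lee_fin ltW// divr_gt0.
  apply: lime_le; first by apply: is_cvg_nneseries => l _ _; rewrite lee_fin ltW// divr_gt0.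
  apply: nearW => n; rewrite sumEFin lee_fin big_mkord -mulr_suml ler_pdivrMr// mul1r.
  exact: sum_cyc_inverse_squares.
pose t j := Num.max (u j) (M j)%:R^-1.
have t0 j : 0 < t j by rewrite lt_max; case/andP: (u01 j) => ->.
apply: (@le_trans _ _ (torus_rearr MJ u)).
  apply: le_torus_rearr => x; apply: ereal_sup_ubound; exists x => //.
apply: (@le_trans _ _ (torus_rearr MJ t)).
  apply: torus_rearr_cell => // [j|x y xy]; first by case/andP: (u01 j).
  rewrite /MJ (_ : cell _ = cell [tuple 2 * pi * tnth y j | j < m])//.
  have E (z : m.-tuple R) j : tnth [tuple 2 * pi * tnth z j | j < m] j / (2 * pi) = tnth z j.
    by rewrite tnth_mktuple mulrAC divff ?gt_eqF// mul1r.
  by apply/seteqP; split => z hz j; rewrite hz !E xy.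
apply: (@le_trans _ _ (ereal_sup (range (fun l => (c l)%:E *
    torus_rearr (H l) (fun j => eps l * t j)%R))))%E.
  apply: (@torus_rearr_sup_le _ m _ [tuple of nseq m 0%N] set0) => //.
  move=> x _ _; apply: ge_ereal_sup => _ [y xy <-].
  have xy' j : `|tnth y j - tnth x j| < 2 * pi / ((p + 4) * N j)%:R.
    have := floor_eq_dist (xy j); rewrite -mulrBr -mulrBl normrM ger0_norm ?ltW//.
    rewrite normrM [`|(2 * pi)^-1|]ger0_norm ?invr_ge0 1?ltW// mulrA.
    by rewrite ltr_pdivrMr// mul1r mulrC -ltr_pdivlMr.
  have [l lM gl] := hC m N g y x N0 tg xy'.
  apply: (@le_trans _ _ ((c [tuple l j | j < m])%:E * H [tuple l j | j < m] x)%E); last first.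
    by apply: ereal_sup_ubound; exists [tuple l j | j < m].
  rewrite /H (_ : [forall j, _] = true); last first.
    by apply/forallP => j; rewrite tnth_mktuple lM.
  rewrite -EFinM lee_fin (le_trans gl)// le_eqVlt; apply/orP; left; apply/eqP; congr (_ * _).
    congr (_ * _); apply: eq_bigr => j _; by rewrite tnth_mktuple /w /p exprM exprVn.
  congr (Normc.normc (g _)); apply: eq_from_tnth => j; by rewrite !tnth_mktuple.
apply: ge_ereal_sup => _ [l _ <-].
pose t' j := Num.max (u j) (N j)%:R^-1.
have t'0 j : 0 < t' j <= 1.
  case/andP: (u01 j) => u0 u1; rewrite lt_max u0 ge_max u1 invf_le1 ?ltr0n// ler1n.
  exact: N0.
have tt' j : e * t' j <= t j.
  rewrite /t' maxr_pMr ?(ltW e0)// ge_max; apply/andP; split.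
    by rewrite le_max ler_piMl// ltW//; case/andP: (u01 j).
  by rewrite le_max /M natrM invfM lexx orbT.
have HG : (torus_rearr (H l) (fun j => eps l * t j)%R <=
   torus_rearr G (fun j => eps l * e * t' j)%R)%E.
  apply: (@le_trans _ _ (torus_rearr G (fun j => eps l * t j)%R)); last first.
    by apply: torus_rearr_antitone => j; rewrite -mulrA ler_pM2l.
  have [lM|lM] := boolP [forall j, (tnth l j < M j)%N]; rewrite /H ?lM ?(negbTE lM); last first.
    by apply: le_torus_rearr => x; rewrite lee_fin normc_ge0.
  apply: (@torus_rearr_translate _ m G (fun j => (tnth l j)%:R / (M j)%:R)) => [x j|j].
    by rewrite /G gp.
  by rewrite divr_ge0//= ler_pdivrMr// mul1r ler_nat ltnW// (forallP lM).
have eel : 0 < eps l * e <= 1.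
  by rewrite mulr_gt0//= mulr_ile1// ltW.
apply: le_trans (lee_wpmul2l _ HG) _; first by rewrite lee_fin ltW.
apply: le_trans (lee_wpmul2l _ (gA _ _)) _; first by rewrite lee_fin ltW.
  move=> j; case/andP: (t'0 j) => t'j0 t'j1; case/andP: eel => ee0 ee1.
  by rewrite mulr_gt0//= mulr_ile1// ltW.
rewrite -EFinM lee_fin.
apply: (@le_trans _ _ (c l * (A * \prod_j ((eps l * e)^-1 * kappa j (t' j))))).
  rewrite ler_pM2l// ler_wpM2l//; apply: ler_prod => j _.
  rewrite ltW ?k0 ?kscale//=; first by case/andP: (t'0 j).
  by rewrite mulr_gt0//; [case/andP: eel|case/andP: (t'0 j)].
rewrite big_split/= prodr_const card_ord.
suff E : c l * (eps l * e)^-1 ^+ m = D.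
  by rewrite -E le_eqVlt; apply/orP; left; apply/eqP; ring.
rewrite /c /eps prodrXl big_split/= prodr_const card_ord.
set W := \prod_j _; have W0 : W != 0.
  by apply: lt0r_neq0; apply: prodr_gt0 => j _.
rewrite /D -mulrA -exprMn; congr (_ * _ ^+ _).
by rewrite !invfM invrK exprVn invrK; field; rewrite W0 lt0r_neq0.
Qed.

End nikolskii.

(** * Modification on null sets *)

Section null_modification.
Import HBNNSimple.
Context d (T : measurableType d) (R : realType) (mu : {measure set T -> \bar R}).

(** The sets that are Borel off a Borel null set form a sigma-algebra, which
    contains the generators of the completion. *)
Lemma completed_measurable_off_null (E : set T) :
  (completed_algebra_gen mu).-sigma.-measurable E ->
  exists M, [/\ measurable M, mu M = 0 & measurable (E `&` ~` M)].
Proof.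
pose C := [set E | exists M, [/\ measurable M, mu M = 0 & measurable (E `&` ~` M)]].
move: E; suff : <<s completed_algebra_gen mu >> `<=` C by [].
apply: smallest_sub; last first.
  move=> _ [A mA [N [F [mF F0 NF]] <-]]; exists F; split => //.
  rewrite (_ : _ `&` _ = A `&` ~` F); first exact: measurableI (measurableC _).
  apply/seteqP; split=> x; first by case=> -[Ax|/NF].
  by case=> Ax Fx; split => //; left.
split.
- by exists set0; split=> //; rewrite ?measure0// set0I.
- move=> E [M [mM M0 mE]]; exists M; split => //.
  rewrite setTD (_ : _ `&` _ = ~` (E `&` ~` M) `&` ~` M).
    by apply: measurableI; exact: measurableC.
  apply/seteqP; split=> x [nE nM]; split=> //; first by case.
  by move=> Ex; exact: nE.
- move=> E hE; pose M n := projT1 (cid (hE n)).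
  have hM n : [/\ measurable (M n), mu (M n) = 0 & measurable (E n `&` ~` M n)].
    by rewrite /M; case: cid.
  exists (\bigcup_n M n); split.
  + by apply: bigcupT_measurable => n; case: (hM n).
  + have : mu.-negligible (\bigcup_n M n).
      by apply: negligible_bigcup => n; case: (hM n) => mM M0 _; apply/negligibleP.
    by move/negligibleP; apply; apply: bigcupT_measurable => n; case: (hM n).
  + rewrite (_ : _ `&` _ = \bigcup_n (E n `&` ~` M n) `&` ~` \bigcup_n M n).
      apply: measurableI; first by apply: bigcupT_measurable => n; case: (hM n).
      by apply: measurableC; apply: bigcupT_measurable => n; case: (hM n).
    apply/seteqP; split=> x [[n _ En] nM]; split => //.
      by exists n => //; split => // Mn; apply: nM; exists n.
    by exists n => //; case: En.
Qed.

(** Off one null set the superlevel sets at all the rational heights, which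
    are countably many, are Borel. *)
Lemma borel_modification (f : T -> R) : lebesgue_measurable_fun mu setT f ->
  exists M, [/\ measurable M, mu M = 0 &
    exists2 g : T -> R, measurable_fun setT g & forall x, ~ M x -> g x = f x].
Proof.
move=> mf.
have hq (q : rat) : exists M, [/\ measurable M, mu M = 0 &
    measurable ([set x | ratr q < f x] `&` ~` M)].
  apply: completed_measurable_off_null.
  have := mf measurableT `]ratr q, +oo[%classic (measurable_itv _).
  rewrite setTI; congr (_.-sigma.-measurable _).
  by apply/seteqP; split => x /=; rewrite in_itv/= andbT.
pose M q := projT1 (cid (hq q)).
have hM q : [/\ measurable (M q), mu (M q) = 0 &
    measurable ([set x | ratr q < f x] `&` ~` M q)] by rewrite /M; case: cid.
pose N := \bigcup_q M q.
have mN : measurable N by apply: bigcupT_measurable_rat => q; case: (hM q).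
exists N; split => //.
  have : mu.-negligible N.
    rewrite /N (reindex_bigcup (fun n : nat => odflt 0 (unpickle n)) setT)//.
      by apply: negligible_bigcup => n; case: (hM (odflt 0 (unpickle n))) => mM M0 _; apply/negligibleP.
    by move=> q _; exists (pickle q) => //=; rewrite pickleK.
  by move/negligibleP; apply.
exists (patch (fun=> 0) (~` N) f); last by move=> x Nx; rewrite patchT// inE.
have mr (q : rat) : measurable [set x | ratr q < patch (fun=> 0) (~` N) f x].
  have mq : measurable ([set x | ratr q < f x] `&` ~` N).
    rewrite (_ : _ `&` _ = ([set x | ratr q < f x] `&` ~` M q) `&` ~` N).
      by apply: measurableI; [case: (hM q)|exact: measurableC].
    apply/seteqP; split=> x; last by case=> -[].
    by case=> fx Nx; split => //; split => // Mx; apply: Nx; exists q.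
  rewrite (_ : [set _ | _] = ([set x | ratr q < f x] `&` ~` N) `|`
      (if ratr q < 0 :> R then N else set0)).
    by apply: measurableU => //; case: ifP.
  apply/seteqP; split => x /=; rewrite patchE.
    case: (pselect (N x)) => Nx.
      by rewrite memNset// => q0; rewrite q0; right.
    by rewrite mem_set// => qf; left.
  case=> [[fx Nx]|]; first by rewrite mem_set.
  by case: ifP => // q0 Nx; rewrite memNset.
apply: (measurability _ (RGenOInfty.measurableE R)).
move=> _ [_ [a ->] <-]; rewrite setTI.
rewrite (_ : _ @^-1` _ = \bigcup_(q : rat) (if a < ratr q then
    [set x | ratr q < patch (fun=> 0) (~` N) f x] else set0)).
  by apply: bigcupT_measurable_rat => q; case: ifP.
apply/seteqP; split => x /=; rewrite in_itv/= andbT.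
  move=> /rat_in_itvoo[q]; rewrite in_itv/= => /andP[aq qx].
  by exists q => //; rewrite aq.
by move=> [q _]; case: ifP => // aq /=; exact: lt_trans.
Qed.

(** The supremum of the integrals of simple minorants does not see null sets,
    even when the integrands are not measurable. *)
Lemma integral_off_null_le (D M : set T) (f g : T -> \bar R) :
  measurable D -> measurable M -> mu M = 0 ->
  (forall x, (0 <= f x)%E) -> (forall x, (0 <= g x)%E) ->
  (forall x, D x -> ~ M x -> (f x <= g x)%E) ->
  (\int[mu]_(x in D) f x <= \int[mu]_(x in D) g x)%E.
Proof.
move=> mD mM M0 f0 g0 fg.
rewrite [leLHS]ge0_integralE//; apply: ge_ereal_sup => _ [h hf <-].
rewrite -integralT_nnsfun.
have -> : (\int[mu]_x (h x)%:E = \int[mu]_(x in ~` M) (h x)%:E)%E.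
  rewrite -(setUv M) ge0_integral_setU//=; last 4 first.
  - exact: measurableC.
  - by rewrite setUv; apply/measurable_EFinP.
  - by move=> x _; rewrite lee_fin.
  - by rewrite disj_set2E setICr.
  rewrite [X in (X + _)%E](_ : _ = 0) ?add0e//.
  rewrite -[RHS](@integral_abs_eq0 _ _ _ mu M (EFin \o h))//; last first.
    by apply/measurable_EFinP; exact: measurable_funTS.
  by apply: eq_integral => x _ /=; rewrite ger0_norm.
rewrite [leLHS]integral_mkcond [leRHS]integral_mkcond.
apply: ge0_le_integral_nonmeasurable => x _; rewrite !patchE.
  by case: ifP => // _; rewrite lee_fin.
case: ifPn => [|_]; last by case: ifP.
rewrite inE => nM; have := hf x; rewrite patchE; case: ifPn => // /set_mem Dx h1.
by rewrite (le_trans h1)// fg.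
Qed.

Lemma integral_off_null (D M : set T) (f g : T -> \bar R) :
  measurable D -> measurable M -> mu M = 0 ->
  (forall x, D x -> ~ M x -> f x = g x) ->
  (\int[mu]_(x in D) f x = \int[mu]_(x in D) g x)%E.
Proof.
move=> mD mM M0 fg; rewrite [LHS]integralE [RHS]integralE.
by congr (_ - _)%E; apply/eqP; rewrite eq_le; apply/andP; split;
  apply: (integral_off_null_le mD mM M0) => // x Dx Mx; rewrite ?funeposE ?funenegE fg//.
Qed.

End null_modification.

(** * Integration over slices *)

Section slices.
Context {R : realType}.
Local Notation leb := (@lebesgue_measure R).
Local Notation per := (@period_itv R).

Lemma measurable_per : measurable per.
Proof. exact: measurable_itv. Qed.

Lemma measurable_set_tnth m (j : 'I_m) :
  measurable_fun [set: m.-tuple R * R] (fun p => set_tnth p.1 j p.2).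
Proof.
apply/measurable_fun_tnthP => i; rewrite /comp.
have [->|ij] := eqVneq i j.
  by apply: (eq_measurable_fun snd) => // p _; rewrite tnth_mktuple eqxx.
apply: (eq_measurable_fun (fun p : m.-tuple R * R => tnth p.1 i)).
  by move=> p _; rewrite tnth_mktuple (negbTE ij).
exact: measurableT_comp (measurable_tnth i) measurable_fst.
Qed.

Lemma measurable_slice m (j : 'I_m) (x : m.-tuple R) :
  measurable_fun [set: R] (set_tnth x j).
Proof. exact: (measurable_fun_pair2 x (measurable_set_tnth j)). Qed.

Definition slice_integral m (j : 'I_m) (F : m.-tuple R -> \bar R) (x : m.-tuple R) : \bar R :=
  (\int[leb]_(y in per) F (set_tnth x j y))%E.

Lemma measurable_slice_integral m (j : 'I_m) (F : m.-tuple R -> \bar R) :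
  measurable_fun setT F -> (forall x, (0 <= F x)%E) ->
  measurable_fun setT (slice_integral j F).
Proof.
move=> mF F0.
pose G (p : m.-tuple R * measurableTypeR R) : \bar R :=
  (F (set_tnth p.1 j p.2) * (\1_per p.2)%:E)%E.
have mG : measurable_fun setT G.
  apply: emeasurable_funM; first exact: measurableT_comp mF (measurable_set_tnth j).
  apply/measurable_EFinP; apply: measurableT_comp measurable_snd.
  exact: measurable_indic measurable_per.
have G0 p : (0 <= G p)%E by rewrite mule_ge0// lee_fin.
have := @measurable_fun_fubini_tonelli_F _ _ _ (measurableTypeR R) R leb G mG G0.
apply: eq_measurable_fun => x _; rewrite /slice_integral integral_mkcond.
apply: eq_integral => y _; rewrite /G patchE indicE.
by case: ifP => yp; rewrite ?mule1 ?mule0.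
Qed.

Lemma tonelli_torus1 m (F : m.+1.-tuple R -> \bar R) :
  measurable_fun setT F -> (forall x, (0 <= F x)%E) ->
  (\int[lebesgue_tuple R m.+1]_(x in @torus R m.+1) F x =
   \int[leb]_(x in per) \int[lebesgue_tuple R m]_(x' in @torus R m) F (cons_pair (x, x')))%E.
Proof.
move=> mF F0; rewrite [LHS]integral_mkcond tonelli_tuple1; last 2 first.
- by apply/(measurable_restrictT _ _).1 => //; [exact: measurable_torus|exact: measurable_funTS].
- by move=> x; exact: erestrict_ge0.
rewrite [RHS]integral_mkcond; apply: eq_integral => x _.
rewrite [RHS]patchE; have [px|px] := pselect (per x); last first.
  rewrite memNset//; apply: integral0_eq => x' _.
  by rewrite patchE memNset// torus_cons => -[].
rewrite mem_set// [RHS]integral_mkcond; apply: eq_integral => x' _.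
rewrite !patchE; have [tx|tx] := pselect (torus x').
  by rewrite !mem_set//; apply/torus_cons.
by rewrite !memNset// torus_cons => -[].
Qed.

(** A slice integral does not depend on [x_j], whose own integration then
    contributes the length of the period. *)
Lemma integral_torus_slice m (j : 'I_m) (F : m.-tuple R -> \bar R) :
  measurable_fun setT F -> (forall x, (0 <= F x)%E) ->
  (\int[lebesgue_tuple R m]_(x in @torus R m) slice_integral j F x =
   (2 * pi)%:E * \int[lebesgue_tuple R m]_(x in @torus R m) F x)%E.
Proof.
elim: m j F => [[]//|m IH] j F mF F0.
have mS := measurable_slice_integral j mF F0.
have S0 x : (0 <= slice_integral j F x)%E by apply: integral_ge0.
have p0 : 0 <= 2 * pi :> R by rewrite ltW// twopi_gt0.
case: (unliftP ord0 j) mS S0 => [i|] -> mS S0.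
  rewrite tonelli_torus1// tonelli_torus1// -ge0_integralZl//; last 3 first.
  - exact: measurable_per.
  - apply: measurable_funTS.
    pose G x := (F x * (\1_(torus (m := m)) [tuple of behead x])%:E)%E.
    have mG : measurable_fun [set: m.+1.-tuple R] G.
      apply: emeasurable_funM => //; apply/measurable_EFinP.
      apply: measurableT_comp (@measurable_behead _ _ _).
      exact: measurable_indic (@measurable_torus _ _).
    have G0 x : (0 <= G x)%E by rewrite mule_ge0// lee_fin.
    apply: eq_measurable_fun (measurable_fun_tonelli1 mG G0) => x _.
    rewrite [RHS]integral_mkcond; apply: eq_integral => x' _.
    rewrite /G patchE (_ : [tuple of behead (cons_pair (x, x'))] = x' :> m.-tuple R); last exact: val_inj.
    by rewrite indicE; case: ifP; rewrite ?mule1 ?mule0.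
  - by move=> x _; apply: integral_ge0.
  apply: eq_integral => x _; rewrite -(IH i); last 2 first.
  - exact: measurable_fun_section1.
  - by move=> x'; exact: F0.
  apply: eq_integral => x' _; apply: eq_integral => y _; congr F.
  apply: eq_from_tnth => k; rewrite tnth_mktuple.
  case: (unliftP ord0 k) => [l|] ->; last by rewrite !tnth_cons0.
  by rewrite !tnth_consS tnth_mktuple (inj_eq lift_inj).
rewrite tonelli_torus// tonelli_torus// -ge0_integralZl//; last 3 first.
- exact: measurable_torus.
- apply: measurable_funTS.
  pose G x := (F x * (\1_per (tnth x ord0))%:E)%E.
  have mG : measurable_fun [set: m.+1.-tuple R] G.
    apply: emeasurable_funM => //; apply/measurable_EFinP.
    exact: measurableT_comp (measurable_indic measurable_per) (measurable_tnth ord0).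
  have G0 x : (0 <= G x)%E by rewrite mule_ge0// lee_fin.
  apply: eq_measurable_fun (measurable_fun_tonelli2 mG G0) => x' _.
  rewrite [RHS]integral_mkcond; apply: eq_integral => x _.
  by rewrite /G patchE tnth_cons0 indicE; case: ifP; rewrite ?mule1 ?mule0.
- by move=> x' _; apply: integral_ge0.
apply: eq_integral => x' _.
pose c := (\int[leb]_(y in per) F (cons_pair (y, x')))%E.
rewrite (eq_integral (cst c)); last first.
  move=> x _; apply: eq_integral => y _; congr F.
  apply: eq_from_tnth => k; rewrite tnth_mktuple.
  by case: (unliftP ord0 k) => [l|] ->; rewrite ?tnth_consS ?tnth_cons0.
rewrite (integral_cst leb measurable_per c) muleC; congr (_ * _)%E; exact: lebesgue_period.
Qed.

(** The slice formula, applied to the indicator of [N]. *)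
Lemma null_slices m (j : 'I_m) (N : set (m.-tuple R)) :
  measurable N -> lebesgue_tuple R m N = 0 ->
  exists N', [/\ measurable N', lebesgue_tuple R m N' = 0 &
    forall x, torus x -> ~ N' x -> leb (per `&` [set y | N (set_tnth x j y)]) = 0].
Proof.
move=> mN N0.
pose F := (fun x => (\1_N x)%:E) : m.-tuple R -> \bar R.
have mF : measurable_fun setT F by apply/measurable_EFinP; exact: measurable_indic.
have F0 x : (0 <= F x)%E by rewrite lee_fin.
have mS := measurable_slice_integral j mF F0.
have mT := @measurable_torus R m.
have : ae_eq (lebesgue_tuple R m) (@torus R m) (slice_integral j F) (cst 0%E).
  apply/ae_eq_integral_abs => //; first exact: measurable_funTS.
  under eq_integral do rewrite gee0_abs ?integral_ge0//.
  have I0 : lebesgue_tuple R m (N `&` @torus R m) = 0.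
    apply/eqP; rewrite eq_le measure_ge0 andbT -[leRHS]N0.
    by apply: le_measure; rewrite ?inE//; exact: measurableI.
  rewrite integral_torus_slice// (integral_indic (lebesgue_tuple R m) mT mN).
  by rewrite [X in (_ * X)%E]I0 mule0.
case=> A [mA A0 sub]; exists A; split => // x tx nA.
have : slice_integral j F x = 0.
  by apply: contrapT => h; apply: nA; apply: sub => /= /(_ tx).
have mSx : measurable [set y : measurableTypeR R | N (set_tnth x j y)].
  by rewrite -[X in measurable X]setTI; exact: (measurable_slice j x).
by rewrite /slice_integral /F (integral_indic leb measurable_per mSx) setIC.
Qed.

(** The slice integrals of the positive part and of the negative part agree
    almost everywhere, hence so do the integrals of the two parts. *)
Lemma integral_torus0_slices m (j : 'I_m) (N : set (m.-tuple R)) (h : m.-tuple R -> R) :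
  measurable N -> lebesgue_tuple R m N = 0 ->
  (lebesgue_tuple R m).-integrable (@torus R m) (EFin \o h) -> measurable_fun setT h ->
  (forall x, torus x -> ~ N x -> (\int[leb]_(y in per) h (set_tnth x j y))%R = 0) ->
  (\int[lebesgue_tuple R m]_(x in @torus R m) (h x)%:E = 0)%E.
Proof.
move=> mN N0 ih mh h0.
have mT := @measurable_torus R m.
pose H := EFin \o h; have mH : measurable_fun setT H by exact/measurable_EFinP.
have mP : measurable_fun setT H^\+%E by exact: measurable_funepos.
have mQ : measurable_fun setT H^\-%E by exact: measurable_funeneg.
have [ip iq] : (\int[lebesgue_tuple R m]_(x in @torus R m) H^\+%E x < +oo)%E /\
    (\int[lebesgue_tuple R m]_(x in @torus R m) H^\-%E x < +oo)%E.
  by split; [exact: integral_funepos_lt_pinfty|exact: integral_funeneg_lt_pinfty].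
have p0 : 0 < 2 * pi :> R by exact: twopi_gt0.
have fin (F : m.-tuple R -> \bar R) : measurable_fun setT F -> (forall x, 0 <= F x)%E ->
    (\int[lebesgue_tuple R m]_(x in @torus R m) F x < +oo)%E ->
    {ae lebesgue_tuple R m, forall x, torus x -> slice_integral j F x \is a fin_num}.
  move=> mF F0 iF; apply: integrable_ae => //; apply/integrableP; split.
    by apply: measurable_funTS; exact: measurable_slice_integral.
  under eq_integral do rewrite gee0_abs ?integral_ge0//.
  rewrite integral_torus_slice// muleC.
  have := integral_ge0 (lebesgue_tuple R m) (fun x (_ : torus x) => F0 x).
  move: iF; case: (\int[_]_(x in _) _)%E => // r _ _.
  by rewrite -EFinM ltry.
suff E : (\int[lebesgue_tuple R m]_(x in @torus R m) H^\+%E x =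
          \int[lebesgue_tuple R m]_(x in @torus R m) H^\-%E x)%E.
  rewrite integralE -/H E subee// ge0_fin_numE//.
  by apply: integral_ge0 => x _; exact: funeneg_ge0.
have cancel (a b : \bar R) : (0 <= a)%E -> (a < +oo)%E -> (0 <= b)%E -> (b < +oo)%E ->
    ((2 * pi)%:E * a = (2 * pi)%:E * b)%E -> a = b.
  case: a b => [a| |] [b| |]// _ _ _ _; rewrite -!EFinM => -[] /mulfI ->//.
  by rewrite gt_eqF.
apply: cancel => //; try by apply: integral_ge0.
rewrite -!(integral_torus_slice j)//.
apply: ae_eq_integral => //.
- by apply: measurable_funTS; exact: measurable_slice_integral.
- by apply: measurable_funTS; exact: measurable_slice_integral.
have nN : {ae lebesgue_tuple R m, forall x, ~ N x}.
  by exists N; split => // x /=; exact: contrapT.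
have := fin _ mP (fun x => funepos_ge0 H x) ip.
have := fin _ mQ (fun x => funeneg_ge0 H x) iq.
apply: filterS3 nN => x Nx qfin pfin tx.
have := h0 x tx Nx; rewrite /Rintegral integralE.
rewrite [X in fine (X - _)](_ : _ = slice_integral j H^\+%E x); last first.
  by apply: eq_integral => y _; rewrite !funeposE.
rewrite [X in fine (_ - X)](_ : _ = slice_integral j H^\-%E x); last first.
  by apply: eq_integral => y _; rewrite !funenegE.
move: (pfin tx) (qfin tx); case: (slice_integral j H^\+%E x) => // a.
case: (slice_integral j H^\-%E x) => // b _ _ /= /eqP; rewrite subr_eq0 => /eqP ->.
by [].
Qed.

Lemma integrable_slices m (j : 'I_m) (h : m.-tuple R -> R) : measurable_fun setT h ->
  (lebesgue_tuple R m).-integrable (@torus R m) (EFin \o h) ->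
  exists N, [/\ measurable N, lebesgue_tuple R m N = 0 &
    forall x, torus x -> ~ N x -> leb.-integrable per (EFin \o (h \o set_tnth x j))].
Proof.
move=> mh ih; pose F x := `|(h x)%:E|%E.
have mF : measurable_fun setT F.
  by apply: measurableT_comp => //; exact/measurable_EFinP.
have F0 x : (0 <= F x)%E by exact: abse_ge0.
have mT := @measurable_torus R m.
have iS : (lebesgue_tuple R m).-integrable (@torus R m) (slice_integral j F).
  apply/integrableP; split; first by apply: measurable_funTS; exact: measurable_slice_integral.
  under eq_integral do rewrite gee0_abs ?integral_ge0//.
  rewrite integral_torus_slice//; move/integrableP : ih => [_].
  rewrite -/F; have := integral_ge0 (lebesgue_tuple R m) (fun x (_ : torus x) => F0 x).
  rewrite (_ : (fun x => _) = F)//; case: (\int[_]_(x in _) _)%E => // a _ _.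
  by rewrite -EFinM ltry.
have [A [mA A0 hA]] := integrable_ae mT iS.
exists A; split => // x tx nA; apply/integrableP; split.
  apply/measurable_EFinP; apply: measurable_funTS; apply: measurableT_comp => //.
  exact: measurable_slice.
have : slice_integral j F x \is a fin_num by apply: contrapT => h'; apply: nA; apply: hA => /= /(_ tx).
by rewrite ge0_fin_numE// integral_ge0.
Qed.

(** A factor that does not depend on [x_j] comes out of the integrals over the
    slices. *)
Lemma Rintegral_torus_mean0 m (j : 'I_m) (N : set (m.-tuple R)) (h w : m.-tuple R -> R) :
  measurable N -> lebesgue_tuple R m N = 0 -> measurable_fun setT h ->
  (lebesgue_tuple R m).-integrable (@torus R m) (EFin \o h) ->
  measurable_fun setT w ->
  (lebesgue_tuple R m).-integrable (@torus R m) (EFin \o (fun x => h x * w x)) ->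
  (forall x y, w (set_tnth x j y) = w x) ->
  (forall x, torus x -> ~ N x -> (\int[leb]_(y in per) h (set_tnth x j y))%R = 0) ->
  (\int[lebesgue_tuple R m]_(x in @torus R m) (h x * w x))%R = 0.
Proof.
move=> mN N0 mh ih mw ihw wj h0; have [N' [mN' N'0 iN']] := integrable_slices j mh ih.
rewrite /Rintegral (@integral_torus0_slices _ j (N `|` N'))//.
- exact: measurableU.
- by apply/eqP; rewrite eq_le measure_ge0 andbT (le_trans (measureU2 _ mN mN'))// [X in (X + _)%E]N0 [X in (_ + X)%E]N'0 adde0.
- exact: measurable_funM.
move=> x tx /not_orP[Nx N'x].
rewrite (@eq_Rintegral _ _ _ leb per (fun y => w x * (h \o set_tnth x j) y)); last first.
  by move=> y _; rewrite wj mulrC.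
by rewrite RintegralZl ?h0 ?mulr0//; [exact: measurable_per|exact: iN'].
Qed.

End slices.

(** * Multipliers of the annihilator *)

Section multipliers.
Context d (T : measurableType d) (R : realType) (mu : {measure set T -> \bar R}).
Variables (D : set T) (mD : measurable D) (h : T -> R).
Hypotheses (mh : measurable_fun setT h) (ih : mu.-integrable D (EFin \o h)).

Definition bounded_measurable (v : T -> R) : Prop :=
  measurable_fun setT v /\ exists B : R, forall x, `|v x| <= B.

Lemma bounded_measurable_cst c : bounded_measurable (fun=> c).
Proof. by split => //; exists `|c|. Qed.

Lemma bounded_measurableD v w : bounded_measurable v -> bounded_measurable w ->
  bounded_measurable (fun x => v x + w x).
Proof.
move=> [mv [B vB]] [mw [C wC]]; split; first exact: measurable_funD.
by exists (B + C) => x; rewrite (le_trans (ler_normD _ _))// lerD.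
Qed.

Lemma bounded_measurableM v w : bounded_measurable v -> bounded_measurable w ->
  bounded_measurable (fun x => v x * w x).
Proof.
move=> [mv [B vB]] [mw [C wC]]; split; first exact: measurable_funM.
by exists (B * C) => x; rewrite normrM ler_pM.
Qed.

Lemma integrable_mul_bounded v : bounded_measurable v ->
  mu.-integrable D (EFin \o (fun x => h x * v x)).
Proof.
move=> [mv [B vB]].
have B0 (x : T) : 0 <= B by rewrite (le_trans _ (vB x)).
apply: (le_integrable mD _ _ (integrableZl mD B ih)).
  by apply/measurable_EFinP; apply: measurable_funTS; exact: measurable_funM.
by move=> x Dx /=; rewrite lee_fin !normrM mulrC ler_wpM2r// (le_trans (vB x))// ler_norm.
Qed.

Definition pairing (v : T -> R) : R := \int[mu]_(x in D) (h x * v x).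

Lemma pairing_linear a b v w : bounded_measurable v -> bounded_measurable w ->
  pairing (fun x => a * v x + b * w x) = a * pairing v + b * pairing w.
Proof.
move=> bv bw; have iv := integrable_mul_bounded bv; have iw := integrable_mul_bounded bw.
rewrite /pairing -!RintegralZl// -RintegralD//; last 2 first.
- by apply: (eq_integrable mD _ _ _ (integrableZl mD a iv)) => x _ /=; rewrite EFinM.
- by apply: (eq_integrable mD _ _ _ (integrableZl mD b iw)) => x _ /=; rewrite EFinM.
by apply: eq_Rintegral => x _; ring.
Qed.

(** Dominated convergence, with the majorant [B * |h|]. *)
Lemma pairing_cvg (v_ : nat -> T -> R) v B : (forall n, measurable_fun setT (v_ n)) ->
  (forall n x, `|v_ n x| <= B) -> (forall x, v_ n x @[n --> \oo] --> v x) ->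
  bounded_measurable v /\ ((forall n, pairing (v_ n) = 0) -> pairing v = 0).
Proof.
move=> mv vB cv.
have mv' : measurable_fun setT v.
  by apply: (measurable_fun_cvg (h := v_)) => // x _.
have vB' x : `|v x| <= B.
  have cn : `|v_ n x| @[n --> \oo] --> `|v x| by apply: cvg_norm; exact: cv.
  rewrite -(cvg_lim _ cn)//; apply: limr_le; first by apply/cvg_ex; exists `|v x|.
  by near=> n; exact: vB.
split; first by split => //; exists B.
move=> v0.
have mf n : measurable_fun D (fun x => (h x * v_ n x)%:E).
  by apply/measurable_EFinP; apply: measurable_funTS; exact: measurable_funM.
have mg : measurable_fun D (fun x => (h x * v x)%:E).
  by apply/measurable_EFinP; apply: measurable_funTS; exact: measurable_funM.
have B0 (x : T) : 0 <= B by rewrite (le_trans _ (vB 0%N x)).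
have iB : mu.-integrable D (fun x => (B * `|h x|)%:E).
  have := integrableZl mD B (integrable_abse ih).
  by apply: eq_integrable => // x _ /=; rewrite EFinM.
have [] := dominated_convergence mD mf mg _ iB _.
- by apply: aeW => x _; apply: cvg_EFin; [near=> n|apply: cvgMr; exact: cv].
- apply: aeW => x n Dx /=; rewrite lee_fin normrM mulrC ler_wpM2r//.
- move=> ig _ lim; have : (\int[mu]_(x in D) (h x * v_ n x)%:E)%E @[n --> \oo] --> 0%E.
    apply: cvg_near_cst; near=> n; have := v0 n; rewrite /pairing /Rintegral.
    have := integrable_fin_num mD (integrable_mul_bounded (conj (mv n) (ex_intro _ B (vB n)))).
    by move=> fi f0; rewrite -[LHS]fineK// f0.
  by move=> /(cvg_unique _ lim); rewrite /pairing /Rintegral => ->.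
Unshelve. all: by end_near. Qed.

Variables (I : Type) (e : I -> T -> R).
Hypothesis be : forall i, bounded_measurable (e i).

Definition annihilated u : Prop := bounded_measurable u /\
  forall i, pairing (fun x => u x * e i x) = 0.

(** The multipliers of the annihilated functions form an algebra closed under
    bounded pointwise limits, which the annihilated functions do not. *)
Definition multiplier w : Prop := bounded_measurable w /\
  forall u, annihilated u -> annihilated (fun x => w x * u x).

Lemma annihilatedD a b u v : annihilated u -> annihilated v ->
  annihilated (fun x => a * u x + b * v x).
Proof.
move=> [bu u0] [bv v0]; split.
  by apply: bounded_measurableD; apply: bounded_measurableM => //; exact: bounded_measurable_cst.
move=> i; rewrite (_ : (fun _ => _) = (fun x => a * (u x * e i x) + b * (v x * e i x))).
  by rewrite pairing_linear ?u0 ?v0 ?mulr0 ?addr0//; apply: bounded_measurableM.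
by apply/funext => x; ring.
Qed.

Lemma multiplierD a b v w : multiplier v -> multiplier w ->
  multiplier (fun x => a * v x + b * w x).
Proof.
move=> [bv hv] [bw hw]; split.
  by apply: bounded_measurableD; apply: bounded_measurableM => //; exact: bounded_measurable_cst.
move=> u au; rewrite (_ : (fun _ => _) = (fun x => a * (v x * u x) + b * (w x * u x))).
  by apply: annihilatedD; [exact: hv|exact: hw].
by apply/funext => x; ring.
Qed.

Lemma multiplierM v w : multiplier v -> multiplier w -> multiplier (fun x => v x * w x).
Proof.
move=> [bv hv] [bw hw]; split; first exact: bounded_measurableM.
move=> u au; rewrite (_ : (fun _ => _) = (fun x => v x * (w x * u x))).
  by apply: hv; exact: hw.
by apply/funext => x; rewrite mulrA.
Qed.

Lemma multiplier_cst c : multiplier (fun=> c).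
Proof.
split=> [|u au]; first exact: bounded_measurable_cst.
rewrite (_ : (fun _ => _) = (fun x => c * u x + 0 * u x)); first exact: annihilatedD.
by apply/funext => x; rewrite mul0r addr0.
Qed.

Lemma multiplier_cvg (w_ : nat -> T -> R) w B : (forall n, multiplier (w_ n)) ->
  (forall n x, `|w_ n x| <= B) -> (forall x, w_ n x @[n --> \oo] --> w x) -> multiplier w.
Proof.
move=> hw wB cw.
have bw : bounded_measurable w.
  by have [] := pairing_cvg (fun n => (hw n).1.1) wB cw.
split=> // u au; split; first exact: bounded_measurableM bw au.1.
move=> i; have [bv [C vC]] := bounded_measurableM au.1 (be i).
have [] := @pairing_cvg (fun n x => w_ n x * u x * e i x) (fun x => w x * u x * e i x) (B * C).
- move=> n; apply: measurable_funM; last by case: (be i).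
  by apply: measurable_funM; [case: (hw n) => -[]|case: au => -[]].
- by move=> n x; rewrite -mulrA normrM ler_pM.
- by move=> x; apply: cvgMl; apply: cvgMl; exact: cw.
- by move=> _; apply => n; have [_] := (hw n).2 u au; apply.
Qed.

Lemma multiplier_ae v w (N : set T) : measurable N -> mu N = 0 ->
  bounded_measurable w -> (forall x, D x -> ~ N x -> v x = w x) ->
  multiplier v -> multiplier w.
Proof.
move=> mN N0 bw vw [bv hv]; split => // u au; split; first exact: bounded_measurableM bw au.1.
move=> i; have [_ /(_ i) <-] := hv u au.
congr fine; apply: ae_eq_integral => //.
- apply/measurable_EFinP; apply: measurable_funTS; apply: measurable_funM => //.
  by case: (bounded_measurableM (bounded_measurableM bw au.1) (be i)).
- apply/measurable_EFinP; apply: measurable_funTS; apply: measurable_funM => //.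
  by case: (bounded_measurableM (bounded_measurableM bv au.1) (be i)).
- exists N; split => // x /= /not_implyP[Dx ne]; apply: contrapT => Nx; apply: ne.
  by rewrite vw.
Qed.

Let q (y : R) := (3 * y - y ^+ 3) / 2.

Let iter_q_opp n y : iter n q (- y) = - iter n q y.
Proof. by elim: n => //= n ->; rewrite /q; field. Qed.

Let iter_q_pos n y : 0 < y <= 1 -> y <= iter n q y <= 1 /\ 1 - iter n q y <= (1 - y / 2) ^+ n.
Proof.
move=> /andP[y0 y1]; elim: n => [|n [/andP[h1 h2] h3]] /=.
  by rewrite lexx y1 expr0; split => //; lra.
set z := iter n q y in h1 h2 h3 *.
have E : 1 - q z = (1 - z / 2 - z ^+ 2 / 2) * (1 - z) by rewrite /q; field.
have E2 : q z - z = z * (1 - z) * (1 + z) / 2 by rewrite /q; field.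
have z0 : 0 < z by exact: lt_le_trans h1.
have hz : 0 <= z * (1 - z) * (1 + z) by rewrite !mulr_ge0//; lra.
have hz2 : 0 <= 1 - z / 2 - z ^+ 2 / 2.
  have : z ^+ 2 <= 1 by rewrite expr_le1// ltW.
  lra.
have h4 : 0 <= 1 - q z by rewrite E mulr_ge0//; lra.
split; first by apply/andP; split; lra.
rewrite E [leRHS]exprS ler_pM//; first lra.
have : 0 <= z ^+ 2 by exact: sqr_ge0.
lra.
Qed.

Let iter_q_cvg y : `|y| <= 1 -> iter n q y @[n --> \oo] --> Num.sg y.
Proof.
have pos (z : R) : 0 < z <= 1 -> (fun n => iter n q z : R) @ \oo --> (1 : R).
  move=> z01; have zlt : `|1 - z / 2| < 1 by rewrite ltr_norml; apply/andP; split; lra.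
  have c0 := @cvg_geometric R 1 _ zlt.
  have c1 : (1 - geometric 1 (1 - z / 2) n) @[n --> \oo] --> (1 : R).
    by rewrite -[X in _ --> X]subr0; apply: cvgB => //; exact: cvg_cst.
  apply: (squeeze_cvgr _ c1 (cvg_cst (1 : R))).
  near=> n.
  have [/andP[_ ->] h1] := iter_q_pos n z01; rewrite andbT /=; lra.
move=> y1; have [y0|y0|->] := ltgtP y 0.
- rewrite ltr0_sg// (_ : (fun n => _) = (fun n => - iter n q (- y))); last first.
    by apply/funext => n; rewrite iter_q_opp opprK.
  by apply: cvgN; apply: pos; rewrite oppr_gt0 y0/= -ltr0_norm.
- by rewrite gtr0_sg//; apply: pos; rewrite y0 -(gtr0_norm y0).
- have q0 n : iter n q 0 = 0 by elim: n => //= n ->; rewrite /q; field.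
  by rewrite sgr0; apply: cvg_near_cst; near=> n; exact: q0.
Unshelve. all: by end_near. Qed.

(** The odd map [y |-> (3 y - y ^ 3) / 2] of the interval from [-1] to [1] to
    itself pushes every [y] to its sign. *)
Lemma multiplier_sg w : multiplier w -> (forall x, `|w x| <= 1) ->
  multiplier (fun x => Num.sg (w x)).
Proof.
move=> hw w1; apply: (@multiplier_cvg (fun n x => iter n q (w x)) _ 1).
- elim=> [|n IH]; first exact: hw.
  rewrite (_ : (fun _ => _) = (fun x => (3 / 2) * iter n q (w x) + (- 2^-1) *
    (iter n q (w x) * (iter n q (w x) * iter n q (w x))))).
    by apply: multiplierD => //; apply: multiplierM => //; exact: multiplierM.
  by apply/funext => x; rewrite iterS /q; field.
- move=> n x; have [w0|w0|->] := ltgtP (w x) 0.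
  + have /(iter_q_pos n)[] : 0 < - w x <= 1 by rewrite oppr_gt0 w0 -(ltr0_norm w0) w1.
    by rewrite iter_q_opp ler_norml => /andP[h1 h2] _; apply/andP; split; lra.
  + have /(iter_q_pos n)[] : 0 < w x <= 1 by rewrite w0 -(gtr0_norm w0) w1.
    by rewrite ler_norml => /andP[h1 h2] _; apply/andP; split; lra.
  + have -> : iter n q 0 = 0 by elim: n => //= n ->; rewrite /q; field.
    by rewrite normr0.
- by move=> x; exact: iter_q_cvg.
Qed.

(** The indicator is the polynomial [(s + s ^ 2) / 2] in the sign [s] of
    [w]. *)
Lemma multiplier_indic_pos w : multiplier w -> (forall x, `|w x| <= 1) ->
  multiplier (\1_[set x | 0 < w x] : T -> R).
Proof.
move=> hw w1; have hs := multiplier_sg hw w1.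
rewrite (_ : \1__ = (fun x => 2^-1 * Num.sg (w x) + 2^-1 * (Num.sg (w x) * Num.sg (w x)))).
  by apply: multiplierD => //; exact: multiplierM.
apply/funext => x; rewrite indicE; have [w0|w0|w0] := ltgtP (w x) 0.
- rewrite memNset/= ?ltr0_sg//; first by field.
  by move=> /(lt_trans w0); rewrite ltxx.
- by rewrite mem_set//= gtr0_sg//; field.
- by rewrite w0 sgr0 memNset//= ?w0 ?ltxx// !mulr0 addr0.
Qed.

Definition multiplier_sets : set (set T) :=
  [set E | measurable E /\ multiplier (\1_E : T -> R)].

(** The indicator of a complement and that of a finite union are polynomials
    in the given indicators; a countable union is a bounded pointwise limit. *)
Lemma sigma_algebra_multiplier_sets : sigma_algebra setT multiplier_sets.
Proof.
have hC E : multiplier_sets E -> multiplier_sets (~` E).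
  move=> [mE hE]; split; first exact: measurableC.
  rewrite (_ : \1__ = (fun x => 1 * 1 + (- 1) * (\1_E : T -> R) x)).
    apply: multiplierD => //; exact: multiplier_cst.
  apply/funext => x; rewrite !indicE in_setC; case: (x \in E); rewrite /=; ring.
split.
- split => //; rewrite (_ : \1__ = (fun=> 0)); first exact: multiplier_cst.
  by apply/funext => x; rewrite indicE in_set0.
- by move=> E hE; rewrite setTD; exact: hC.
move=> F hF; split; first by apply: bigcupT_measurable => n; case: (hF n).
pose P n x := \prod_(i < n) (\1_(~` F i) x : R).
have mP n : multiplier (P n).
  elim: n => [|n IH].
    rewrite (_ : P 0%N = (fun=> 1)); first exact: multiplier_cst.
    by apply/funext => x; rewrite /P big_ord0.
  rewrite (_ : P n.+1 = (fun x => P n x * \1_(~` F n) x)).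
    by apply: multiplierM => //; case: (hC _ (hF n)).
  by apply/funext => x; rewrite /P big_ord_recr.
have P01 n x : 0 <= P n x <= 1.
  by rewrite prodr_ge0//=; apply: prodr_ile1 => i _; rewrite indicE; case: (_ \in _); rewrite lexx ler01.
apply: (@multiplier_cvg (fun n x => 1 * 1 + (- 1) * P n x) _ 1).
- by move=> n; apply: multiplierD => //; exact: multiplier_cst.
- by move=> n x; have /andP[p0 p1] := P01 n x; rewrite ler_norml; apply/andP; split; lra.
- move=> x; apply: cvg_near_cst.
  have [[k _ Fk]|nF] := pselect ((\bigcup_n F n) x).
    exists k.+1 => // n /= kn; rewrite indicE mem_set; last by exists k.
    rewrite /P (bigD1 (Ordinal kn))//= indicE memNset ?mul0r; last exact.
    by ring.
  near=> n; rewrite indicE memNset//.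
  rewrite /P big1 ?mulr1 ?subrr//.
  move=> i _; rewrite indicE mem_set// => Fi; apply: nF.
  by exists i.
Unshelve. all: by end_near. Qed.

(** The sign of [h] is then a multiplier. Applied to [1] and paired with
    [e i = 1] it gives the integral of [|h|]. *)
Lemma multiplier_sets_ae0 i : (forall x, e i x = 1) -> annihilated (fun=> 1) ->
  (forall E, measurable E -> multiplier_sets E) -> ae_eq mu D (EFin \o h) (cst 0%E).
Proof.
move=> ei a1 hE; apply/ae_eq_integral_abs => //.
  by apply/measurable_EFinP; exact: measurable_funTS.
have mp : measurable [set x | 0 < h x].
  rewrite -[X in measurable X]setTI.
  rewrite (_ : [set x | 0 < h x] = h @^-1` `]0, +oo[%classic).
    exact: mh.
  by apply/seteqP; split => x /=; rewrite in_itv/= andbT.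
have mn : measurable [set x | h x < 0].
  rewrite -[X in measurable X]setTI.
  rewrite (_ : [set x | h x < 0] = h @^-1` `]-oo, 0[%classic).
    exact: mh.
  by apply/seteqP; split => x /=; rewrite in_itv.
have /(_ _ a1)[_ /(_ i)] := (multiplierD 1 (- 1) (hE _ mp).2 (hE _ mn).2).2.
set F := (\int[mu]_(x in D) _)%E => F0.
have FE : F = (\int[mu]_(x in D) (h x * ((1 * \1_[set x | 0 < h x] x +
      -1 * \1_[set x | h x < 0] x) * 1 * e i x))%:E)%E.
  apply: eq_integral => x _; rewrite ei !mulr1 mul1r mulN1r !indicE /=.
  have [h0|h0|h0] := ltgtP (h x) 0.
  - by rewrite memNset/= ?mem_set// ?sub0r ?mulrN1 ?ltr0_norm// => /(lt_trans h0); rewrite ltxx.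
  - by rewrite mem_set//= memNset/= ?subr0 ?mulr1 ?gtr0_norm// => /(lt_trans h0); rewrite ltxx.
  - by rewrite h0 normr0 mul0r.
have Ff : F \is a fin_num by move/integrableP: ih => [_ i1]; rewrite ge0_fin_numE// integral_ge0.
by rewrite -[LHS](fineK Ff) FE; rewrite /pairing /Rintegral in F0; rewrite F0.
Qed.

End multipliers.

(** * Uniqueness of Fourier coefficients *)

Section torus_uniqueness.
Context {R : realType} {m : nat}.
Local Notation leb := (@lebesgue_measure R).
Local Notation mu := (lebesgue_tuple R m).
Local Notation D := (@torus R m).

Definition angle (k : m.-tuple int) (x : m.-tuple R) : R :=
  \sum_(j < m) (tnth k j)%:~R * tnth x j.

Definition trig (i : m.-tuple int * bool) (x : m.-tuple R) : R :=
  if i.2 then cos (angle i.1 x) else sin (angle i.1 x).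

Lemma measurable_angle k : measurable_fun setT (angle k).
Proof.
apply: measurable_sum => j; apply: measurable_funM => //.
exact: measurable_tnth.
Qed.

Lemma bounded_measurable_cos (f : m.-tuple R -> R) :
  measurable_fun setT f -> bounded_measurable (fun x => cos (f x)).
Proof.
move=> mf; split; last by exists 1 => x; exact: cos_max.
apply: measurableT_comp mf; apply: continuous_measurable_fun.
exact: continuous_cos.
Qed.

Lemma bounded_measurable_sin (f : m.-tuple R -> R) :
  measurable_fun setT f -> bounded_measurable (fun x => sin (f x)).
Proof.
move=> mf; split; last by exists 1 => x; exact: sin_max.
apply: measurableT_comp mf; apply: continuous_measurable_fun.
exact: continuous_sin.
Qed.

Lemma bounded_measurable_trig i : bounded_measurable (trig i).
Proof.
case: i => k [].
- exact: bounded_measurable_cos (measurable_angle k).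
- exact: bounded_measurable_sin (measurable_angle k).
Qed.

Definition shift_freq (k : m.-tuple int) (j : 'I_m) (s : int) : m.-tuple int :=
  [tuple tnth k i + s *+ (i == j) | i < m].

Lemma angle_shift k j s x : angle (shift_freq k j s) x = angle k x + s%:~R * tnth x j.
Proof.
rewrite /angle; under eq_bigr do rewrite tnth_mktuple intrD mulrDl.
rewrite big_split/=; congr (_ + _); rewrite (bigD1 j)//= eqxx mulr1n big1 ?addr0//.
by move=> i /negbTE ->; rewrite mulr0n mul0r.
Qed.

Lemma measurable_coord (j : 'I_m) (P : set R) :
  measurable P -> measurable [set x : m.-tuple R | P (tnth x j)].
Proof.
move=> mP; rewrite -[X in measurable X]setTI.
have := @measurable_tnth _ R m j; apply => //.
Qed.

Lemma torus_face_null (j : 'I_m) (c : R) : mu (D `&` [set x | tnth x j = c]) = 0.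
Proof.
pose N := [set x : m.-tuple R | tnth x j = c].
have mN : measurable N.
  exact: (@measurable_coord j [set c] (measurable_set1 c)).
pose F := (fun x => (\1_N x)%:E) : m.-tuple R -> \bar R.
have mF : measurable_fun setT F by apply/measurable_EFinP; exact: measurable_indic.
have F0 x : (0 <= F x)%E by rewrite lee_fin.
have mT := @measurable_torus R m.
have := integral_torus_slice j mF F0; rewrite (integral_indic mu mT mN) setIC => E.
have S0 x : slice_integral j F x = 0%E.
  have ms : measurable [set y : measurableTypeR R | N (set_tnth x j y)].
    by rewrite -[X in measurable X]setTI; exact: (measurable_slice j x).
  rewrite /slice_integral /F (integral_indic leb (@measurable_per R) ms).
  apply/eqP; rewrite eq_le measure_ge0 andbT -(lebesgue_measure_set1 c).
  apply: le_lebesgue => y [+ _].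
  by rewrite /N /= tnth_mktuple eqxx.
move: E; rewrite integral0_eq => [/esym/eqP|x _]; last exact: S0.
by rewrite mule_eq0 eqe gt_eqF ?twopi_gt0//= => /eqP.
Qed.

Variables (h : m.-tuple R -> R).
Hypotheses (mh : measurable_fun setT h) (ih : mu.-integrable D (EFin \o h)).
Local Notation mult := (multiplier mu D h trig).
Let mD := @measurable_torus R m.

(** By the addition formulas, multiplication by [cos x_j] turns a
    trigonometric function into the mean of two with the frequency shifted
    by one in either direction. *)
Lemma multiplier_cos_coord j : mult (fun x => cos (tnth x j)).
Proof.
have bj := bounded_measurable_cos (measurable_tnth j); split => // u [bu u0].
split; first exact: bounded_measurableM.
move=> [k b]; rewrite (_ : (fun _ => _) = (fun x =>
    2^-1 * (u x * trig (shift_freq k j 1, b) x) + 2^-1 * (u x * trig (shift_freq k j (- 1), b) x))).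
  rewrite pairing_linear// ?u0 ?mulr0 ?addr0//;
    by apply: bounded_measurableM => //; exact: bounded_measurable_trig.
apply/funext => x; rewrite /trig/= !angle_shift mul1r mulrN1z mulN1r.
by case: b; rewrite ?cosD ?sinD cosN sinN; field.
Qed.

Lemma multiplier_sin_coord j : mult (fun x => sin (tnth x j)).
Proof.
have bj := bounded_measurable_sin (measurable_tnth j); split => // u [bu u0].
split; first exact: bounded_measurableM.
move=> [k b]; rewrite (_ : (fun _ => _) = (fun x =>
    ((-1) ^+ (~~ b) / 2) * (u x * trig (shift_freq k j 1, ~~ b) x) +
    (- (-1) ^+ (~~ b) / 2) * (u x * trig (shift_freq k j (- 1), ~~ b) x))).
  rewrite pairing_linear// ?u0 ?mulr0 ?addr0//;
    by apply: bounded_measurableM => //; exact: bounded_measurable_trig.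
apply/funext => x; rewrite /trig/= !angle_shift mul1r mulrN1z mulN1r.
by case: b; rewrite ?cosD ?sinD cosN sinN /= ?expr0 ?expr1; field.
Qed.

Lemma cos_sub_sg (y c : R) : 0 < y < 2 * pi -> 0 < c < 2 * pi ->
  Num.sg (cos (y - c / 2) - cos (c / 2)) = Num.sg (c - y).
Proof.
move=> /andP[y0 y1] /andP[c0 c1].
have -> : cos (y - c / 2) - cos (c / 2) = 2 * (sin (y / 2) * sin ((c - y) / 2)).
  have -> : y - c / 2 = y / 2 - (c - y) / 2 by field.
  have -> : c / 2 = y / 2 + (c - y) / 2 by field.
  by rewrite cosB cosD; ring.
rewrite !sgrM gtr0_sg// mul1r gtr0_sg ?mul1r; last by apply: sin_gt0_pi; apply/andP; split; lra.
have [h1|h1|h1] := ltgtP c y.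
- have : 0 < sin (- ((c - y) / 2)) by apply: sin_gt0_pi; apply/andP; split; lra.
  by rewrite sinN oppr_gt0 => h2; rewrite !ltr0_sg// subr_lt0.
- by rewrite !gtr0_sg ?subr_gt0//; apply: sin_gt0_pi; apply/andP; split; lra.
- by rewrite h1 subrr mul0r sin0.
Qed.

(** On the torus a half-space [x_j < c] agrees up to two faces with the
    superlevel set of a translated cosine. *)
Lemma multiplier_halfspace j (c : R) :
  multiplier_sets mu D h trig [set x : m.-tuple R | tnth x j < c].
Proof.
have mE (P : R -> Prop) : measurable [set y : R | P y] -> measurable [set x : m.-tuple R | P (tnth x j)].
  exact: measurable_coord.
have mH (b : R) : measurable [set x : m.-tuple R | tnth x j < b].
  apply: (mE (fun y => y < b)); rewrite (_ : [set y | _] = `]-oo, b[%classic) ?measurable_itv//.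
split; first exact: mH.
have bH (E : set (m.-tuple R)) : measurable E -> bounded_measurable (\1_E : _ -> R).
  move=> mE'; split; first exact: measurable_indic.
  by exists 1 => x; rewrite indicE; case: (_ \in _); rewrite ?normr1 ?normr0.
pose N := (D `&` [set x : m.-tuple R | tnth x j = 0]) `|` (D `&` [set x | tnth x j = 2 * pi]).
have mN : measurable N.
  apply: measurableU; apply: measurableI => //; apply: (mE (fun y => y = _)); exact: measurable_set1.
have N0 : mu N = 0.
  apply/eqP; rewrite eq_le measure_ge0 andbT (le_trans (measureU2 _ _ _))//.
  - by apply: measurableI => //; apply: (mE (fun y => y = _)); exact: measurable_set1.
  - by apply: measurableI => //; apply: (mE (fun y => y = _)); exact: measurable_set1.
  by rewrite [X in (X + _)%E](torus_face_null j 0) [X in (_ + X)%E](torus_face_null j (2 * pi)) adde0.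
have in01 x : D x -> ~ N x -> 0 < tnth x j < 2 * pi.
  move=> Dx Nx; have := Dx j; rewrite /period_itv /= in_itv/= => /andP[x0 x1].
  rewrite !lt_neqAle x0 x1 !andbT; apply/andP; split; apply/eqP => E; apply: Nx.
    by left.
  by right.
have [c0|c0] := leP c 0.
  apply: (multiplier_ae mD mh bounded_measurable_trig mN N0 _ _ (multiplier_cst mD mh ih bounded_measurable_trig 0)) => //.
    exact: bH.
  move=> x Dx /(in01 _ Dx)/andP[x0 _]; rewrite indicE memNset//=.
  by move=> /lt_le_trans/(_ c0)/(lt_trans x0); rewrite ltxx.
have [c1|c1] := leP (2 * pi) c.
  apply: (multiplier_ae mD mh bounded_measurable_trig mN N0 _ _ (multiplier_cst mD mh ih bounded_measurable_trig 1)) => //.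
    exact: bH.
  by move=> x Dx /(in01 _ Dx)/andP[_ x1]; rewrite indicE mem_set//=; exact: lt_le_trans c1.
pose w x := 2^-1 * (cos (c / 2) * cos (tnth x j) + sin (c / 2) * sin (tnth x j)) +
   (- 2^-1) * cos (c / 2).
have wE x : w x = (cos (tnth x j - c / 2) - cos (c / 2)) / 2 by rewrite /w cosB; field.
have mw : mult w.
  apply: multiplierD => //; [exact: bounded_measurable_trig| |apply: multiplier_cst => //].
    apply: multiplierD => //; [exact: bounded_measurable_trig|exact: multiplier_cos_coord|].
    exact: multiplier_sin_coord.
  exact: bounded_measurable_trig.
have w1 x : `|w x| <= 1.
  rewrite wE normrM [`|2^-1|]ger0_norm// ler_pdivrMr// mul1r.
  by rewrite (le_trans (ler_normB _ _))// (_ : 2 = 1 + 1)// lerD ?cos_max.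
apply: (multiplier_ae mD mh bounded_measurable_trig mN N0 _ _ (multiplier_indic_pos mD mh ih bounded_measurable_trig mw w1)).
  exact: bH.
move=> x Dx /(in01 _ Dx) x01; rewrite !indicE; congr (nat_of_bool _)%:R.
apply/idP/idP; rewrite !inE /= wE pmulr_lgt0 ?invr_gt0// -sgr_gt0 cos_sub_sg ?c0//.
  by rewrite sgr_gt0 subr_gt0.
by move=> xc; rewrite sgr_gt0 subr_gt0.
Qed.

(** The half-spaces [x_j < c] generate the Borel sets, and they are
    multiplier sets of the trigonometric system. *)
Lemma torus_uniqueness : (forall i, \int[mu]_(x in D) (h x * trig i x) = 0) ->
  ae_eq mu D (EFin \o h) (cst 0%E).
Proof.
move=> h0; apply: (@multiplier_sets_ae0 _ _ _ mu D mD h mh ih _ trig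
  bounded_measurable_trig ([tuple of nseq m 0], true)).
- move=> x; rewrite /trig /angle /= big1 ?cos0// => j _.
  by rewrite (_ : tnth _ j = 0) ?mul0r// (tnth_nth 0)/= nth_nseq ltn_ord.
- split; first exact: bounded_measurable_cst.
  by move=> i; rewrite -[RHS](h0 i); apply: eq_Rintegral => x _; rewrite mul1r.
move=> E mE.
have sS := sigma_algebra_multiplier_sets mD mh ih bounded_measurable_trig.
pose S := multiplier_sets mu D h trig.
have mid : measurable_fun setT (id : g_sigma_algebraType S -> m.-tuple R).
  apply/measurable_fun_tnthP => j.
  apply: (measurability _ (RGenInftyO.measurableE R)) => _ [_ [c ->] <-].
  rewrite setTI; apply: sub_sigma_algebra.
  rewrite (_ : _ @^-1` _ = [set x | tnth x j < c]); first exact: multiplier_halfspace.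
  by apply/seteqP; split => x /=; rewrite in_itv.
have := mid measurableT E mE; rewrite setTI preimage_id.
by rewrite /measurable/= sigma_algebra_id.
Qed.

End torus_uniqueness.

(** * Dyadic blocks *)

Section frequencies.
Context {R : realType} {m : nat}.

Definition block_freq (s : m.-tuple nat) (k : m.-tuple int) : Prop :=
  forall j, (0 < tnth s j)%N /\ (2 ^ (tnth s j).-1 <= absz (tnth k j) < 2 ^ tnth s j)%N.

Lemma dyadic_blockP s k : dyadic_block R s k <-> block_freq s k.
Proof.
have lt a b : (`|a|%:~R < 2 ^ b%:Z :> R) = (absz a < 2 ^ b)%N.
  by rewrite -abszE -[2 ^ b%:Z]/(2 ^+ b) -natrX ltr_nat.
have le (a : int) b : (2 ^ (b.+1%:Z - 1) <= `|a|%:~R :> R) = (2 ^ b <= absz a)%N.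
  have -> : (b.+1%:Z - 1 = b%:Z) by lia.
  by rewrite -abszE -[2 ^ b%:Z]/(2 ^+ b) -natrX ler_nat.
split=> h j; have := h j; rewrite lt.
  move=> [h1 h2]; case: (tnth s j) h1 h2 => [|a] h1 h2.
    move: h2; rewrite expn0 ltnS leqn0 absz_eq0 => /eqP k0.
    by move: h1; rewrite k0 normr0 sub0r leNgt invr_gt0 ltr0n.
  split => //; rewrite h2 andbT.
  by rewrite -le.
by case: (tnth s j) => [[]//|a] [_ /andP[h1 h2]]; rewrite le.
Qed.

Lemma block_freq_inj s t k : block_freq s k -> block_freq t k -> s = t.
Proof.
move=> hs ht; apply: eq_from_tnth => j.
have aux a b n : (2 ^ a.-1 <= n < 2 ^ a)%N -> (2 ^ b.-1 <= n < 2 ^ b)%N -> (a <= b)%N.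
  move=> /andP[h1 h2] /andP[h3 h4]; rewrite leqNgt; apply/negP => ba.
  have : (2 ^ b <= 2 ^ a.-1)%N by rewrite leq_exp2l// -ltnS (leq_trans ba)// leqSpred.
  by move=> /leq_trans/(_ h1); rewrite leqNgt h4.
have [_ h1] := hs j; have [_ h2] := ht j.
by apply/eqP; rewrite eqn_leq (aux _ _ _ h1 h2) (aux _ _ _ h2 h1).
Qed.

Lemma block_freq_ex (k : m.-tuple int) : (forall j, tnth k j != 0) -> exists s, block_freq s k.
Proof.
move=> k0; exists [tuple (trunc_log 2 (absz (tnth k j))).+1 | j < m] => j.
rewrite tnth_mktuple; split => //=; rewrite trunc_logP//= ?absz_gt0//.
exact: trunc_log_ltn.
Qed.

Lemma finite_bounded_freq (K : nat) :
  finite_set [set k : m.-tuple int | forall j, (absz (tnth k j) < K)%N].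
Proof.
pose f (t : m.-tuple 'I_(2 * K)) : m.-tuple int := [tuple (tnth t j)%:Z - K%:Z | j < m].
apply: (@sub_finite_set _ _ (f @` setT)); last first.
  by apply: finite_image; exact: finite_finset.
move=> k hk; have lt j : (absz (tnth k j + K%:Z)%R < 2 * K)%N by have := hk j; lia.
exists [tuple Ordinal (lt j) | j < m] => //; apply: eq_from_tnth => j.
by rewrite !tnth_mktuple /=; have := hk j; lia.
Qed.

Lemma finite_dyadic_block s : finite_set (dyadic_block R (m := m) s).
Proof.
pose K := (2 ^ \sum_j tnth s j)%N.
apply: sub_finite_set (finite_bounded_freq K) => k /dyadic_blockP h j.
have [_ /andP[_ h2]] := h j; rewrite (leq_trans h2)// /K leq_exp2l//.
by rewrite (bigD1 j)//= leq_addr.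
Qed.

Lemma finite_weight_lt (gamma : 'I_m -> R) (n : nat) : (forall j, 0 < gamma j) ->
  finite_set [set s : m.-tuple nat | weight gamma s < n%:R].
Proof.
move=> g0.
pose K := \max_(j < m) (Num.truncn (n%:R / gamma j)).+1.
have hK j (a : nat) : a%:R * gamma j < n%:R -> (a < K)%N.
  move=> h; apply: (@leq_trans (Num.truncn (n%:R / gamma j)).+1); last exact: leq_bigmax.
  rewrite ltnS truncn_ge_nat; first by rewrite ltW// ltr_pdivlMr.
  by rewrite divr_ge0// ltW.
pose f (t : m.-tuple 'I_K) : m.-tuple nat := [tuple nat_of_ord (tnth t j) | j < m].
apply: (@sub_finite_set _ _ (f @` setT)); last first.
  by apply: finite_image; exact: finite_finset.
move=> s hs; have lt j : (tnth s j < K)%N.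
  apply: (hK j); apply: le_lt_trans hs; rewrite /weight (bigD1 j)//= lerDl.
  by apply: sumr_ge0 => i _; rewrite mulr_ge0// ltW.
by exists [tuple Ordinal (lt j) | j < m] => //; apply: eq_from_tnth => j; rewrite !tnth_mktuple.
Qed.

End frequencies.

Section trigonometric_sums.
Context {R : realType} {m : nat}.
Local Notation normc := (@Normc.normc R).
Local Notation harmonic := Defs.harmonic.
Implicit Types (k : m.-tuple int) (x : m.-tuple R).

Lemma harmonicE k x : harmonic k x = cexp (angle k x).
Proof. by []. Qed.

Lemma angle_set_tnth k x j (y : R) :
  angle k (set_tnth x j y) = angle k (set_tnth x j 0) + (tnth k j)%:~R * y.
Proof.
rewrite /angle (bigD1 j)//= [in RHS](bigD1 j)//= !tnth_mktuple eqxx mulr0 add0r addrC.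
by congr (_ + _); apply: eq_bigr => i /negbTE ij; rewrite !tnth_mktuple ij.
Qed.

Lemma cexp_int2pi (n : int) : cexp (n%:~R * (2 * pi) : R) = 1.
Proof.
case: n => n; first by rewrite cexpMn cexp2pi expr1n.
by rewrite NegzE mulrNz mulNr cexpN cexpMn cexp2pi expr1n invr1.
Qed.

Lemma harmonic_periodic k x j :
  harmonic k (set_tnth x j (tnth x j + 2 * pi)) = harmonic k x.
Proof.
rewrite !harmonicE angle_set_tnth mulrDr addrA -angle_set_tnth set_tnth_id.
by rewrite cexpD cexp_int2pi mulr1.
Qed.

Definition trig_sum (L : seq (m.-tuple int)) (b : m.-tuple int -> R[i]) x : R[i] :=
  \sum_(k <- L) b k * harmonic k x.

Lemma trig_sum_periodic L b : Defs.periodic (trig_sum L b).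
Proof. by move=> x j; apply: eq_bigr => k _; rewrite harmonic_periodic. Qed.

(** Multiplication by the exponential of frequency [N j] shifts all the
    frequencies in the [j]-th variable into the range from [0] to [2 * N j]. *)
Lemma trig_sum_degree L b (N : 'I_m -> nat) :
  (forall k j, k \in L -> (absz (tnth k j) < N j)%N) -> trig_degree N (trig_sum L b).
Proof.
move=> hL x j.
pose n k := absz (tnth k j + (N j)%:Z)%R.
exists (\sum_(k <- L) (b k * cexp (angle k (set_tnth x j 0))) *: 'X^(n k)).
  apply: (leq_trans (size_sum _ _ _)); apply/bigmax_leqP_seq => k kL _.
  apply: (leq_trans (size_scale_leq _ _)); rewrite size_polyXn.
  by have := hL k j kL; rewrite /n; lia.
move=> y; suff -> : (\sum_(k <- L) (b k * cexp (angle k (set_tnth x j 0))) *: 'X^(n k)).[cexp y] =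
    cexp ((N j)%:R * y) * trig_sum L b (set_tnth x j y).
  by rewrite Normc.normcM normc_cexp mul1r.
rewrite horner_sum /trig_sum mulr_sumr big_seq_cond [RHS]big_seq_cond.
apply: eq_bigr => k; rewrite andbT => kL.
rewrite hornerZ hornerXn harmonicE [in RHS]angle_set_tnth.
have -> : cexp y ^+ n k = cexp ((N j)%:R * y) * cexp ((tnth k j)%:~R * y).
  rewrite -cexpMn -cexpD -mulrDl; congr (cexp (_ * _)).
  have -> : (n k)%:R = ((tnth k j) + (N j)%:Z)%:~R :> R.
    by rewrite /n -[LHS]/((Posz (absz _))%:~R) gez0_abs//; have := hL k j kL; lia.
  by rewrite intrD addrC.
by rewrite [cexp (_ + _)]cexpD; ring.
Qed.

Definition block_seq (s : m.-tuple nat) : seq (m.-tuple int) :=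
  finmap.enum_fset (fset_set (dyadic_block R s)).

Lemma mem_block_seq s k : k \in block_seq s <-> block_freq s k.
Proof.
have E : (k \in block_seq s) = (k \in dyadic_block R s) := in_fset_set (finite_dyadic_block s) k.
by rewrite E inE; exact: dyadic_blockP.
Qed.

Lemma block_seq_uniq s : uniq (block_seq s).
Proof. exact: finmap.fset_uniq. Qed.

Lemma delta_block_trig_sum s (f : m.-tuple R -> R[i]) :
  delta_block s f = trig_sum (block_seq s) (fourier_coef f).
Proof. by apply/funext => x; rewrite /delta_block fsbig_finite//; exact: finite_dyadic_block. Qed.

Lemma delta_block_periodic s (f : m.-tuple R -> R[i]) : Defs.periodic (delta_block s f).
Proof. by rewrite delta_block_trig_sum; exact: trig_sum_periodic. Qed.

Lemma delta_block_degree s (f : m.-tuple R -> R[i]) :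
  trig_degree (fun j => 2 ^ tnth s j)%N (delta_block s f).
Proof.
rewrite delta_block_trig_sum; apply: trig_sum_degree => k j.
by move=> /mem_block_seq/(_ j)[_ /andP[]].
Qed.

End trigonometric_sums.

(** * Orthogonality of the harmonics *)

Section complex_integrals.
Context d (T : measurableType d) (R : realType) (mu : {measure set T -> \bar R}).
Variables (D : set T) (mD : measurable D).
Implicit Types F G : T -> R[i].

Definition complex_integrable F : Prop :=
  mu.-integrable D (EFin \o (fun x => complex.Re (F x))) /\
  mu.-integrable D (EFin \o (fun x => complex.Im (F x))).

Local Notation cint := (complex_integral mu D).

Lemma integrable_real_comb (a b : R) (f g : T -> R) :
  mu.-integrable D (EFin \o f) -> mu.-integrable D (EFin \o g) ->
  mu.-integrable D (EFin \o (fun x => a * f x + b * g x)).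
Proof.
move=> fi gi; have := integrableD mD (integrableZl mD a fi) (integrableZl mD b gi).
by apply: eq_integrable => // x _ /=; rewrite EFinD !EFinM.
Qed.

Lemma Rintegral_comb (a b : R) (f g : T -> R) :
  mu.-integrable D (EFin \o f) -> mu.-integrable D (EFin \o g) ->
  \int[mu]_(x in D) (a * f x + b * g x) =
  a * \int[mu]_(x in D) f x + b * \int[mu]_(x in D) g x.
Proof.
move=> fi gi; rewrite -!RintegralZl// -RintegralD//.
- by apply: (eq_integrable mD _ _ _ (integrableZl mD a fi)) => x _ /=; rewrite EFinM.
- by apply: (eq_integrable mD _ _ _ (integrableZl mD b gi)) => x _ /=; rewrite EFinM.
Qed.

Lemma ReM (z w : R[i]) :
  complex.Re (z * w) = complex.Re z * complex.Re w + (- complex.Im z) * complex.Im w.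
Proof. by case: z w => a b [c e] /=; rewrite mulNr. Qed.

Lemma ImM (z w : R[i]) :
  complex.Im (z * w) = complex.Re z * complex.Im w + complex.Im z * complex.Re w.
Proof. by case: z w => a b [c e] /=. Qed.

Lemma ReD (z w : R[i]) : complex.Re (z + w) = complex.Re z + complex.Re w.
Proof. by case: z w => a b [c e]. Qed.

Lemma ImD (z w : R[i]) : complex.Im (z + w) = complex.Im z + complex.Im w.
Proof. by case: z w => a b [c e]. Qed.

Lemma complex_integrableZ c F : complex_integrable F -> complex_integrable (fun x => c * F x).
Proof.
move=> [rF iF]; split.
  rewrite (_ : (fun x => _) = (fun x => complex.Re c * complex.Re (F x) + (- complex.Im c) * complex.Im (F x))).
    exact: integrable_real_comb.
  by apply/funext => x; rewrite ReM.
rewrite (_ : (fun x => _) = (fun x => complex.Re c * complex.Im (F x) + complex.Im c * complex.Re (F x))).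
  exact: integrable_real_comb.
by apply/funext => x; rewrite ImM.
Qed.

Lemma complex_integrableD F G : complex_integrable F -> complex_integrable G ->
  complex_integrable (fun x => F x + G x).
Proof.
move=> [rF iF] [rG iG]; split.
  rewrite (_ : (fun x => _) = (fun x => 1 * complex.Re (F x) + 1 * complex.Re (G x))).
    exact: integrable_real_comb.
  by apply/funext => x; rewrite ReD !mul1r.
rewrite (_ : (fun x => _) = (fun x => 1 * complex.Im (F x) + 1 * complex.Im (G x))).
  exact: integrable_real_comb.
by apply/funext => x; rewrite ImD !mul1r.
Qed.

Lemma complex_integralZ c F : complex_integrable F -> cint (fun x => c * F x) = c * cint F.
Proof.
move=> [rF iF]; rewrite /complex_integral.
rewrite (@eq_Rintegral _ _ _ _ _ (fun x => complex.Re c * complex.Re (F x) + (- complex.Im c) * complex.Im (F x))); last first.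
  by move=> x _; rewrite ReM.
rewrite [X in (_ +i* X)%C](@eq_Rintegral _ _ _ _ _ (fun x => complex.Re c * complex.Im (F x) + complex.Im c * complex.Re (F x))); last first.
  by move=> x _; rewrite ImM.
rewrite !Rintegral_comb//; case: c => a b; rewrite mulNr; congr (_ +i* _)%C.
Qed.

Lemma complex_integralD F G : complex_integrable F -> complex_integrable G ->
  cint (fun x => F x + G x) = cint F + cint G.
Proof.
move=> [rF iF] [rG iG]; rewrite /complex_integral.
rewrite (@eq_Rintegral _ _ _ _ _ (fun x => 1 * complex.Re (F x) + 1 * complex.Re (G x))); last first.
  by move=> x _; rewrite ReD !mul1r.
rewrite [X in (_ +i* X)%C](@eq_Rintegral _ _ _ _ _ (fun x => 1 * complex.Im (F x) + 1 * complex.Im (G x))); last first.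
  by move=> x _; rewrite ImD !mul1r.
by rewrite !Rintegral_comb// !mul1r.
Qed.

Lemma complex_integral_sum (I : Type) (s : seq I) (F : I -> T -> R[i]) :
  (forall i, complex_integrable (F i)) ->
  complex_integrable (fun x => \sum_(i <- s) F i x) /\
  cint (fun x => \sum_(i <- s) F i x) = \sum_(i <- s) cint (F i).
Proof.
move=> iF; elim: s => [|i s [IH1 IH2]].
  rewrite big_nil (_ : (fun x => _) = (fun=> 0)); last by apply/funext => x; rewrite big_nil.
  split; last by rewrite /complex_integral !Rintegral_cst// !mul0r.
  by split; apply: (eq_integrable mD _ _ _ (integrable0 _ _)).
rewrite (_ : (fun x => _) = (fun x => F i x + \sum_(j <- s) F j x)); last first.
  by apply/funext => x; rewrite big_cons.
by split; [exact: complex_integrableD|rewrite complex_integralD// IH2 big_cons].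
Qed.

End complex_integrals.

Section orthogonality.
Context {R : realType} {m : nat}.
Local Notation harmonic := Defs.harmonic.
Local Notation leb := (@lebesgue_measure R).
Local Notation per := (@period_itv R).
Local Notation mu := (lebesgue_tuple R m).
Local Notation D := (@torus R m).
Let mD := @measurable_torus R m.

Lemma is_derive_sin_affine (a : R) (c : R) (y:R): c != 0 -> is_derive y 1 (fun y : R => c^-1 * sin (a + c * y)) (cos (a + c * y)).
Proof.
move=> c0.
have h : is_derive y 1 (fun y : R => a + c * y) c.
  apply: is_derive_eq; rewrite add0r. rewrite /GRing.scale/=. by rewrite mul1r mulr1.
have h2 := @is_derive1_comp R (@sin R) (fun y => a + c * y) y _ _ (is_derive_sin _) h.
have h3 := is_deriveZ (c^-1) h2.
apply: (is_derive_eq h3).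
by rewrite /GRing.scale/= mulrCA mulVf ?mulr1.
Qed.
Lemma continuous_cos_affine (a : R) (c : R) : {within `[0, 2*pi], continuous (fun y : R => cos (a + c * y))}.
Proof.
apply: continuous_subspaceT => y.
apply: (@continuous_comp _ _ _ (fun y => a + c * y) (@cos R)); last exact: continuous_cos.
by apply: cvgD; [exact: cvg_cst|apply: cvgMr; exact: cvg_id].
Qed.

Lemma integral_cos_period (a : R) (n : int) : n != 0 ->
  \int[leb]_(y in per) cos (a + n%:~R * y) = 0.
Proof.
move=> n0; have n0' : n%:~R != 0 :> R by rewrite intr_eq0.
pose F (y : R) : R := n%:~R^-1 * sin (a + n%:~R * y).
have dF (y : R) : is_derive y 1 F (cos (a + n%:~R * y)) by exact: is_derive_sin_affine.
have cF (y : R) : {for y, continuous F}.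
  by apply/differentiable_continuous/derivable1_diffP; exact: ex_derive.
have p0 : 0 < 2 * pi :> R by exact: twopi_gt0.
rewrite /Rintegral /per (@continuous_FTC2 _ _ F)//.
- rewrite /F /= mulr0 addr0.
  suff -> : sin (a + n%:~R * (2 * pi)) = sin a by rewrite subrr.
  have := cexp_int2pi (R := R) n; rewrite /cexp => -[c1 s1].
  by rewrite sinD c1 s1 mulr0 addr0 mulr1.
- exact: continuous_cos_affine.
- split; [by move=> y _; exact: ex_derive| |].
    by apply: cvg_at_right_filter; exact: cF.
  by apply: cvg_at_left_filter; exact: cF.
- by move=> y _; rewrite derive1E; exact: derive_val.
Qed.

Lemma torus_measure n : lebesgue_tuple R n (@torus R n) = ((2 * pi) ^+ n)%:E.
Proof.
elim: n => [|n IH].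
  by rewrite expr0 /lebesgue_tuple /= diracE mem_set// => -[].
have <- := mul1e (lebesgue_tuple R n.+1 (@torus R n.+1)).
rewrite -(integral_cst (lebesgue_tuple R n.+1) (@measurable_torus R n.+1) 1%E).
rewrite (tonelli_torus (F := cst 1%E))//.
rewrite (eq_integral (cst (2 * pi)%:E)); last first.
  by move=> x _; rewrite (integral_cst leb (@measurable_per R) 1%E) mul1e; exact: lebesgue_period.
rewrite (integral_cst (lebesgue_tuple R n) (@measurable_torus R n) (2 * pi)%:E).
by rewrite [X in (_ * X)%E]IH exprS EFinM.
Qed.

Lemma integrable_bounded (f : m.-tuple R -> R) : bounded_measurable f ->
  mu.-integrable D (EFin \o f).
Proof.
move=> [mf [B fB]]; apply: measurable_bounded_integrable => //.
- by rewrite [X in (X < _)%E]torus_measure ltry.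
- exact: measurable_funTS.
- by exists B; split => [|M BM x _]; [exact: num_real|exact: le_trans (fB x) (ltW BM)].
Qed.

Lemma integral_cos_angle (k : m.-tuple int) (j : 'I_m) (b : R) : tnth k j != 0 ->
  \int[mu]_(x in D) cos (angle k x + b) = 0.
Proof.
move=> kj; have bm : bounded_measurable (fun x => cos (angle k x + b)).
  by apply: bounded_measurable_cos; apply: measurable_funD => //; exact: measurable_angle.
rewrite /Rintegral (@integral_torus0_slices _ _ j set0)//.
- exact: integrable_bounded.
- by case: bm.
- move=> x _ _; rewrite -[RHS](integral_cos_period (angle k (set_tnth x j 0) + b) kj).
  by apply: eq_Rintegral => y _; rewrite angle_set_tnth addrAC.
Qed.

Lemma complex_integrable_harmonic k : complex_integrable mu D (harmonic k).
Proof.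
by split; apply: integrable_bounded;
  [exact: (bounded_measurable_trig (k, true))|exact: (bounded_measurable_trig (k, false))].
Qed.

Lemma complex_integral_harmonic k :
  complex_integral mu D (harmonic k) = if [forall j, tnth k j == 0] then ((2 * pi) ^+ m)%:C%C else 0.
Proof.
rewrite /complex_integral; case: ifPn => [/forallP k0|].
  have a0 (x : m.-tuple R) : angle k x = 0.
    by rewrite /angle big1// => j _; rewrite (eqP (k0 j)) mul0r.
  rewrite (@eq_Rintegral _ _ _ mu D (fun=> 1)); last by move=> x _; rewrite /= -/(angle k x) a0 cos0.
  rewrite [X in (_ +i* X)%C](@eq_Rintegral _ _ _ mu D (fun=> 0)); last by move=> x _; rewrite /= -/(angle k x) a0 sin0.
  by rewrite !Rintegral_cst// mul0r mul1r [X in fine X](torus_measure m).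
rewrite negb_forall => /existsP[j kj].
rewrite (@eq_Rintegral _ _ _ mu D (fun x => cos (angle k x + 0))); last by move=> x _; rewrite addr0.
rewrite (integral_cos_angle _ kj).
rewrite (@eq_Rintegral _ _ _ mu D (fun x => cos (angle k x + (- (pi / 2))))).
  by rewrite (integral_cos_angle _ kj).
by move=> x _; rewrite /= -/(angle k x) cosB cos_pihalf sin_pihalf mulr0 add0r mulr1.
Qed.

Lemma harmonic_mul_conj (l k : m.-tuple int) (x : m.-tuple R) : harmonic l x * (harmonic k x)^*%C =
  harmonic [tuple tnth l j - tnth k j | j < m] x.
Proof.
rewrite !harmonicE (_ : (cexp (angle k x))^*%C = cexp (- angle k x)); last first.
  by rewrite /cexp cosN sinN.
rewrite -cexpD; congr cexp; rewrite /angle -sumrN -big_split/=.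
by apply: eq_bigr => j _; rewrite tnth_mktuple intrB mulrBl.
Qed.

Lemma complex_integral_harmonic_conj (l k : m.-tuple int) :
  complex_integral mu D (fun x : m.-tuple R => harmonic l x * (harmonic k x)^*%C) =
  if l == k then ((2 * pi) ^+ m)%:C%C else 0.
Proof.
rewrite (_ : (fun x => _) = harmonic [tuple tnth l j - tnth k j | j < m]); last first.
  by apply/funext => x; exact: harmonic_mul_conj.
rewrite complex_integral_harmonic; congr (if _ then _ else _).
apply/forallP/eqP => [h|-> j]; last by rewrite tnth_mktuple subrr.
by apply: eq_from_tnth => j; have := h j; rewrite tnth_mktuple subr_eq0 => /eqP.
Qed.

End orthogonality.

(** * Dominated limits *)

Section trigonometric_limit.
Context {R : realType} {m : nat}.
Local Notation mu := (lebesgue_tuple R m).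
Local Notation D := (@torus R m).
Let mD := @measurable_torus R m.

(** Dominated convergence carries the vanishing of the trigonometric
    integrals over to the limit. For each frequency they vanish from some
    rank on only, as for the remainders of a Fourier series. *)
Lemma trig_limit_ae0 (g : nat -> m.-tuple R -> R) (W : m.-tuple R -> \bar R) :
  (forall n, measurable_fun setT (g n)) -> mu.-integrable D W ->
  (forall n x, D x -> (`|g n x|%:E <= W x)%E) ->
  {ae mu, forall x, D x -> cvgn (fun n => g n x)} ->
  (forall i, exists n0, forall n, (n0 <= n)%N ->
     \int[mu]_(x in D) (g n x * trig i x) = 0) ->
  {ae mu, forall x, D x -> g n x @[n --> \oo] --> (0 : R)}.
Proof.
move=> mg iW gW cg g0.
pose h x : R := fine (limn_esup (fun n => (g n x)%:E)).
have mh : measurable_fun setT h.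
  apply: measurableT_comp; first exact: fine_measurable.
  by apply: measurable_fun_limn_esup => n; exact/measurable_EFinP.
have ch x : cvgn (fun n => g n x) -> g n x @[n --> \oo] --> h x.
  move=> /cvg_ex[l gl]; have -> : h x = l; last exact: gl.
  have ce : (g n x)%:E @[n --> \oo] --> l%:E.
    by apply: cvg_EFin => //; near=> n.
  by rewrite /h (cvg_limn_einf_sup ce).2.
have cgh : {ae mu, forall x, D x -> g n x @[n --> \oo] --> h x}.
  by apply: filterS cg => x cx Dx; apply: ch; exact: cx.
have ih : mu.-integrable D (EFin \o h).
  have [] // := @dominated_convergence _ _ _ mu D mD (fun n x => (g n x)%:E) (EFin \o h) W.
  - by move=> n; apply/measurable_EFinP; exact: measurable_funTS.
  - by apply/measurable_EFinP; exact: measurable_funTS.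
  - apply: filterS cgh => x cx Dx; apply: cvg_EFin; first by near=> n.
    exact: cx.
  - by apply: aeW => x n Dx; exact: gW.
have h0 i : \int[mu]_(x in D) (h x * trig i x) = 0.
  have [mt t1] : measurable_fun setT (trig i : m.-tuple R -> R) /\
      forall x : m.-tuple R, `|trig i x| <= 1.
    split; first by case: (@bounded_measurable_trig R m i).
    by case: i => k [] x; rewrite /trig /= ?cos_max ?sin_max.
  have [_ _ lim] : [/\ mu.-integrable D (fun x => (h x * trig i x)%:E),
     [sequence \int[mu]_(x in D) `|(g n x * trig i x)%:E - (h x * trig i x)%:E|]_n%E @ \oo --> 0%E
     & [sequence \int[mu]_(x in D) (g n x * trig i x)%:E]_n%E @ \oo --> (\int[mu]_(x in D) (h x * trig i x)%:E)%E].
    apply: (@dominated_convergence _ _ _ mu D mD (fun n x => (g n x * trig i x)%:E) _ W) => //.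
    - by move=> n; apply/measurable_EFinP; apply: measurable_funTS; exact: measurable_funM.
    - by apply/measurable_EFinP; apply: measurable_funTS; exact: measurable_funM.
    - apply: filterS cgh => x cx Dx; apply: cvg_EFin; first by near=> n.
      apply: cvgMl; exact: cx.
    - apply: aeW => x n Dx; rewrite abse_EFin normrM; apply: le_trans (gW n x Dx).
      by rewrite lee_fin ler_piMr.
  have [n0 hn0] := g0 i.
  have lim0 : [sequence \int[mu]_(x in D) (g n x * trig i x)%:E]_n%E @ \oo --> 0%E.
    apply: cvg_near_cst; exists n0 => // n /= hn.
    rewrite -[RHS]/(0%:E) -(hn0 n hn) /Rintegral fineK//.
    apply: integrable_fin_num => //; apply: (le_integrable mD _ _ iW).
      by apply/measurable_EFinP; apply: measurable_funTS; exact: measurable_funM.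
    move=> x Dx; rewrite abse_EFin normrM (@le_trans _ _ `|g n x|%:E)//.
      by rewrite lee_fin ler_piMr.
    by rewrite (le_trans (gW n x Dx))// lee_abs.
  by rewrite /Rintegral (cvg_unique _ lim lim0).
have [// A [mA A0 hA]] := torus_uniqueness mh ih h0.
have := cgh; apply: filterS2; last by exists A; split => //; exact: hA.
move=> x /= hx cx Dx; have -> : (0 : R) = h x; last exact: cx.
by have [] := hx Dx.
Unshelve. all: by end_near. Qed.

End trigonometric_limit.

(** * Integrability from the anisotropic norm *)

Section integrability.
Context {R : realType}.
Local Notation normc := (@Normc.normc R).

(** The reciprocal of a fundamental function, continued by a constant beyond
    [1] so that it is positive and well behaved under dilations on the whole
    half-line. *)
Definition recip_Phi (phi : R -> R) (v : R) : R := (phi (Num.min v 1))^-1.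

Lemma min1_itv (v : R) : 0 < v -> 0 < Num.min v 1 <= 1.
Proof. by move=> v0; rewrite lt_min v0 ltr01 ge_min lexx orbT. Qed.

Lemma recip_Phi_gt0 phi v : Phi_function phi -> 0 < v -> 0 < recip_Phi phi v.
Proof. by move=> hphi v0; rewrite invr_gt0 Phi_gt0// min1_itv. Qed.

Lemma recip_PhiE phi v : v <= 1 -> recip_Phi phi v = (phi v)^-1.
Proof. by move=> v1; rewrite /recip_Phi min_l. Qed.

Lemma recip_Phi_scale phi e v : Phi_function phi -> 0 < e <= 1 -> 0 < v ->
  recip_Phi phi (e * v) <= e^-1 * recip_Phi phi v.
Proof.
move=> hphi /andP[e0 e1] v0; rewrite /recip_Phi -invfM.
have /andP[m0 m1] := min1_itv v0.
have ev0 : 0 < e * v by rewrite mulr_gt0.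
have /andP[n0 n1] := min1_itv ev0.
have pv0 : 0 < phi (Num.min v 1) by apply: Phi_gt0; rewrite ?m0.
have pev0 : 0 < phi (Num.min (e * v) 1) by apply: Phi_gt0; rewrite ?n0.
rewrite lef_pV2 ?posrE ?mulr_gt0//.
apply: (@le_trans _ _ (phi (e * Num.min v 1))).
  by apply: Phi_scale => //; [rewrite ltW|rewrite ltW].
apply: Phi_nondecreasing => //; first by rewrite mulr_ge0// ltW.
by rewrite minr_pMr ?(ltW e0)// le_min !ge_min lexx/= mulr1 e1 orbT.
Qed.

Lemma phi_geometric_uniform m (phi : 'I_m -> R -> R) :
  (forall j, Phi_function (phi j)) -> (forall j, (upper_dilation (phi j) < 2%:E)%E) ->
  exists K b, [/\ 0 < K, 0 < b < 2 & forall j i, recip_Phi (phi j) (2^-1 ^+ i) <= K * b ^+ i].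
Proof.
move=> hphi uphi.
have /choice[u hu] : forall j, exists u : R * R, [/\ 0 < u.1, 0 < u.2 < 2 &
    forall i, (phi j (2 ^- i))^-1 <= u.1 * u.2 ^+ i].
  by move=> j; have [K [b hKb]] := phi_geometric (hphi j) (uphi j); exists (K, b).
pose b := \big[Num.max/1]_j (u j).2; pose K := 1 + \sum_j (u j).1.
have K0 : 0 < K by rewrite ltr_pwDl// sumr_ge0// => j _; case: (hu j) => /ltW.
have b1 : 1 <= b by exact: bigmax_ge_id.
exists K, b; split => //.
  rewrite (lt_le_trans ltr01 b1)/=; apply: bigmax_lt; first by rewrite ltr1n.
  by move=> j _; case: (hu j) => _ /andP[].
move=> j i; have [uj0 /andP[uj1 _] uj] := hu j.
rewrite recip_PhiE; last by rewrite exprn_ile1// invf_le1// ler1n.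
rewrite exprVn (le_trans (uj i))// ler_pM ?exprn_ge0 ?(ltW uj0) ?(ltW uj1)//.
  rewrite /K (bigD1 j)//= addrCA lerDl addr_ge0// sumr_ge0// => k _.
  by case: (hu k) => /ltW.
by apply: lerXn2r; rewrite ?nnegrE ?(ltW uj1)// ?(le_trans ler01 b1)//; exact: le_bigmax.
Qed.

(** The norm bounds the iterated rearrangement by a product of reciprocals
    of fundamental functions, which are integrable because their upper
    dilation indices are less than [2]. *)
Lemma integral_torus_le_aniso_norm m (X : 'I_m -> symmetric_space R) (phi : 'I_m -> R -> R) :
  (forall j, fundamental_function (X j) (phi j)) -> (forall j, Phi_function (phi j)) ->
  (forall j, (upper_dilation (phi j) < 2%:E)%E) ->
  exists2 C : R, 0 < C & forall (f : m.-tuple R -> R[i]) (g : m.-tuple R -> \bar R) M (A : R),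
  measurable M -> lebesgue_tuple R m M = 0 ->
  measurable_fun setT g -> (forall x, (0 <= g x)%E) ->
  (forall x, ~ M x -> (g x <= (normc (f x))%:E)%E) ->
  0 <= A -> (aniso_norm X f <= A%:E)%E ->
  (\int[lebesgue_tuple R m]_(x in @torus R m) g x <= (C * A)%:E)%E.
Proof.
move=> hX hphi uphi.
have [K [b [K0 b2 hK]]] := phi_geometric_uniform hphi uphi.
have [C C0 hC] := @integral_torus_le_rearr R m b K b2 K0.
exists C => // f g M A mM M0 mg g0 gf A0 fA.
apply: (hC (fun j => recip_Phi (phi j))) => //.
- by move=> j v; exact: recip_Phi_gt0.
- by move=> j e v; exact: recip_Phi_scale.
move=> v v01; apply: le_trans (le_torus_rearr_ae _ mM M0 _) _.
  by move=> x _; exact: gf.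
apply: le_trans (torus_rearr_le_aniso_norm hX hphi fA v01) _.
rewrite lee_fin ler_wpM2l// ler_prod// => j _; case/andP: (v01 j) => v0 v1.
by rewrite recip_PhiE// lexx andbT invr_ge0 Phi_ge0// ltW.
Qed.

Lemma nneseries_pickle_le (T : countType) (F : T -> \bar R) : (forall t, (0 <= F t)%E) ->
  (\sum_(i <oo) oapp F 0 (pickle_inv i) <= \esum_(t in [set: T]) F t)%E.
Proof.
move=> F0; pose G i := oapp F 0%E (@pickle_inv T i).
have G0 i : (0 <= G i)%E by rewrite /G; case: pickle_inv => /=.
rewrite nneseries_esumT//.
rewrite (@esumID _ _ (range (@pickle T)) setT G) ?setTI//.
rewrite [X in (_ + X)%E]esum1 ?adde0; last first.
  move=> i nPi; rewrite /G; case E : pickle_inv => [t|]//=.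
  by case: nPi; exists t => //; have := pickle_invK (T := T) i; rewrite E.
rewrite (@reindex_esum _ _ _ setT (range (@pickle T)) (@pickle T) G).
  by apply: le_esum => t _; rewrite /G pickleK_inv.
split; first by move=> t _; exists t.
  by move=> s t _ _; exact: (pcan_inj (@pickleK_inv T)).
by move=> i [t _ <-]; exists t.
Qed.

End integrability.

(** * Fourier coefficients *)

Section coefficients.
Context {R : realType} {m : nat}.
Local Notation normc := (@Normc.normc R).
Local Notation harmonic := Defs.harmonic.
Local Notation mu := (lebesgue_tuple R m).
Local Notation D := (@torus R m).
Let mD := @measurable_torus R m.
Implicit Types F G : m.-tuple R -> R[i].

Definition borel F : Prop :=
  measurable_fun setT (fun x => complex.Re (F x)) /\
  measurable_fun setT (fun x => complex.Im (F x)).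

Definition complex_bounded F : Prop :=
  bounded_measurable (fun x => complex.Re (F x)) /\
  bounded_measurable (fun x => complex.Im (F x)).

Lemma normcE (z : R[i]) : normc z = Num.sqrt (complex.Re z ^+ 2 + complex.Im z ^+ 2).
Proof. by case: z. Qed.

Lemma Re_le_normc (z : R[i]) : `|complex.Re z| <= normc z.
Proof. by rewrite normcE -sqrtr_sqr ler_sqrt ?lerDl ?sqr_ge0// addr_ge0 ?sqr_ge0. Qed.

Lemma Im_le_normc (z : R[i]) : `|complex.Im z| <= normc z.
Proof. by rewrite normcE -sqrtr_sqr ler_sqrt ?lerDr ?sqr_ge0// addr_ge0 ?sqr_ge0. Qed.

Lemma normc_le_ReIm (z : R[i]) : normc z <= `|complex.Re z| + `|complex.Im z|.
Proof.
rewrite normcE -[leRHS]ger0_norm ?addr_ge0// -sqrtr_sqr ler_sqrt ?sqr_ge0//.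
rewrite sqrrD !real_normK ?num_real//.
by have := mulr_ge0 (normr_ge0 (complex.Re z)) (normr_ge0 (complex.Im z)); lra.
Qed.

Lemma measurable_normc F : borel F -> measurable_fun setT (fun x => normc (F x)).
Proof.
move=> [mr mi]; rewrite (_ : (fun x => _) = (fun x =>
   Num.sqrt (complex.Re (F x) ^+ 2 + complex.Im (F x) ^+ 2))).
  apply: measurableT_comp.
    by apply: continuous_measurable_fun; exact: sqrt_continuous.
  by apply: measurable_funD; apply: measurable_funX.
by apply/funext => x; rewrite normcE.
Qed.

Lemma borelB F G : borel F -> borel G -> borel (fun x => F x - G x).
Proof.
move=> [rF iF] [rG iG]; split.
  rewrite (_ : (fun x => _) = (fun x => complex.Re (F x) - complex.Re (G x))).
    exact: measurable_funB.
  by apply/funext => x; case: (F x); case: (G x).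
rewrite (_ : (fun x => _) = (fun x => complex.Im (F x) - complex.Im (G x))).
  exact: measurable_funB.
by apply/funext => x; case: (F x); case: (G x).
Qed.

Lemma bounded_measurable_comb (a b : R) (u v : m.-tuple R -> R) :
  bounded_measurable u -> bounded_measurable v ->
  bounded_measurable (fun x => a * u x + b * v x).
Proof.
by move=> bu bv; apply: bounded_measurableD; apply: bounded_measurableM => //;
  exact: bounded_measurable_cst.
Qed.

Lemma complex_bounded_harmonic k : complex_bounded (harmonic k).
Proof.
by split; [exact: (bounded_measurable_trig (k, true))|exact: (bounded_measurable_trig (k, false))].
Qed.

Lemma complex_bounded_conj_harmonic k : complex_bounded (fun x => (harmonic k x)^*%C).
Proof.
split; first exact: (bounded_measurable_trig (k, true)).
rewrite (_ : (fun x => _) = (fun x => - 1 * sin (angle k x) + 0 * sin (angle k x))).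
  by apply: bounded_measurable_comb; exact: (bounded_measurable_trig (k, false)).
by apply/funext => x; rewrite mul0r addr0 mulN1r.
Qed.

Lemma complex_bounded_trig_sum L b : complex_bounded (trig_sum L b).
Proof.
elim: L => [|k L [IH1 IH2]].
  rewrite (_ : trig_sum [::] b = (fun=> 0)); first by split; exact: bounded_measurable_cst.
  by apply/funext => x; rewrite /trig_sum big_nil.
have [bk1 bk2] := complex_bounded_harmonic k.
rewrite (_ : trig_sum (k :: L) b = (fun x => b k * harmonic k x + trig_sum L b x)); last first.
  by apply/funext => x; rewrite /trig_sum big_cons.
split.
  rewrite (_ : (fun x => _) = (fun x => (complex.Re (b k) * complex.Re (harmonic k x) +
      (- complex.Im (b k)) * complex.Im (harmonic k x)) + complex.Re (trig_sum L b x))).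
    by apply: bounded_measurableD => //; exact: bounded_measurable_comb.
  by apply/funext => x; rewrite ReD ReM.
rewrite (_ : (fun x => _) = (fun x => (complex.Re (b k) * complex.Im (harmonic k x) +
    complex.Im (b k) * complex.Re (harmonic k x)) + complex.Im (trig_sum L b x))).
  by apply: bounded_measurableD => //; exact: bounded_measurable_comb.
by apply/funext => x; rewrite ImD ImM.
Qed.

Lemma borel_bounded F : complex_bounded F -> borel F.
Proof. by move=> [[? _] [? _]]; split. Qed.

Lemma complex_integrable_bounded F : complex_bounded F -> complex_integrable mu D F.
Proof. by move=> [? ?]; split; exact: integrable_bounded. Qed.

Lemma complex_integrableM F G : borel F -> complex_integrable mu D F -> complex_bounded G ->
  complex_integrable mu D (fun x => F x * G x).
Proof.
move=> [mr mi] [ir ii] [br bi]; split.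
  rewrite (_ : (fun x => _) = (fun x => 1 * (complex.Re (F x) * complex.Re (G x)) +
      (- 1) * (complex.Im (F x) * complex.Im (G x)))).
    by apply: integrable_real_comb => //; exact: integrable_mul_bounded.
  by apply/funext => x; rewrite ReM mul1r mulN1r mulNr.
rewrite (_ : (fun x => _) = (fun x => 1 * (complex.Re (F x) * complex.Im (G x)) +
    1 * (complex.Im (F x) * complex.Re (G x)))).
  by apply: integrable_real_comb => //; exact: integrable_mul_bounded.
by apply/funext => x; rewrite ImM !mul1r.
Qed.

Lemma complex_integral_trig_sum L b k : uniq L ->
  complex_integral mu D (fun x => trig_sum L b x * (harmonic k x)^*%C) =
  ((2 * pi) ^+ m)%:C%C * (if k \in L then b k else 0).
Proof.
move=> uL; rewrite (_ : (fun x => _) = (fun x => \sum_(l <- L) b l * (harmonic l x * (harmonic k x)^*%C))); last first.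
  by apply/funext => x; rewrite /trig_sum mulr_suml; apply: eq_bigr => l _; rewrite mulrA.
have iF l : complex_integrable mu D (fun x => harmonic l x * (harmonic k x)^*%C).
  by rewrite (funext (harmonic_mul_conj l k)); exact: complex_integrable_harmonic.
have iF' l : complex_integrable mu D (fun x => b l * (harmonic l x * (harmonic k x)^*%C)).
  exact: complex_integrableZ.
rewrite (complex_integral_sum mD L iF').2.
under eq_bigr do rewrite complex_integralZ// complex_integral_harmonic_conj.
case: ifPn => kL.
  rewrite (bigD1_seq k)//= eqxx big1 ?addr0 1?mulrC// => l /negbTE ->.
  by rewrite mulr0.
rewrite mulr0 big_seq_cond big1// => l /andP[lL _].
by case: eqVneq lL => [->|]; rewrite ?(negbTE kL)// mulr0.
Qed.

(** The real function [trig (k, b)] is a combination of the conjugate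
    harmonics of frequencies [k] and [- k]. *)
Lemma complex_integral_trig0 F (k : m.-tuple int) b : borel F -> complex_integrable mu D F ->
  (forall l, l = k \/ l = [tuple - tnth k j | j < m] ->
     complex_integral mu D (fun x => F x * (harmonic l x)^*%C) = 0) ->
  \int[mu]_(x in D) (complex.Re (F x) * trig (k, b) x) = 0 /\
  \int[mu]_(x in D) (complex.Im (F x) * trig (k, b) x) = 0.
Proof.
move=> mF iF h.
pose k' := [tuple - tnth k j | j < m].
have ak' x : angle k' x = - angle k x.
  by rewrite /angle -sumrN; apply: eq_bigr => j _; rewrite tnth_mktuple mulrNz mulNr.
have iH l : complex_integrable mu D (fun x => F x * (harmonic l x)^*%C).
  exact: complex_integrableM (complex_bounded_conj_harmonic l).
pose c : R[i] := if b then (2^-1)%:C%C else (- 2^-1 *i)%C.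
pose c' : R[i] := if b then (2^-1)%:C%C else (2^-1 *i)%C.
have E : complex_integral mu D (fun x => F x * (trig (k, b) x)%:C%C) = 0.
  rewrite (_ : (fun x => _) = (fun x => c' * (F x * (harmonic k x)^*%C) + c * (F x * (harmonic k' x)^*%C))).
    rewrite complex_integralD//; last 2 first.
      exact: complex_integrableZ.
      exact: complex_integrableZ.
    by rewrite !complex_integralZ// !h ?mulr0 ?addr0//; [right|left].
  apply/funext => x; rewrite !harmonicE ak' /c /c' /trig /=.
  clear c c'; case: (F x) => u v; case: b => /=; rewrite cosN sinN opprK;
    by apply/eqP; rewrite eq_complex /=; apply/andP; split; apply/eqP; field.
have RE x : complex.Re (F x * (trig (k, b) x)%:C%C) = complex.Re (F x) * trig (k, b) x.
  by rewrite ReM /= mulr0 addr0.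
have IE x : complex.Im (F x * (trig (k, b) x)%:C%C) = complex.Im (F x) * trig (k, b) x.
  by rewrite ImM /= mulr0 add0r.
move: E; rewrite /complex_integral (funext RE) (funext IE) => -[].
by [].
Qed.

End coefficients.

Section fourier.
Context {R : realType} {m : nat}.
Local Notation normc := (@Normc.normc R).
Local Notation harmonic := Defs.harmonic.
Local Notation leb := (@lebesgue_measure R).
Local Notation per := (@period_itv R).
Local Notation mu := (lebesgue_tuple R m).
Local Notation D := (@torus R m).
Let mD := @measurable_torus R m.

Lemma null_setU (A B : set (m.-tuple R)) : measurable A -> measurable B ->
  mu A = 0 -> mu B = 0 -> measurable (A `|` B) /\ mu (A `|` B) = 0.
Proof.
move=> mA mB A0 B0; split; first exact: measurableU.
apply/eqP; rewrite eq_le measure_ge0 andbT (le_trans (measureU2 _ mA mB))//.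
by rewrite [X in (X + _)%E]A0 [X in (_ + X)%E]B0 adde0.
Qed.

Lemma complex_borel_modification (f : m.-tuple R -> R[i]) : complex_measurable f ->
  exists M, [/\ measurable M, mu M = 0 &
    exists2 g : m.-tuple R -> R[i], borel g & forall x, ~ M x -> g x = f x].
Proof.
move=> [/borel_modification[M1 [mM1 M10 [g1 mg1 g1E]]] /borel_modification[M2 [mM2 M20 [g2 mg2 g2E]]]].
have [mM M0] := null_setU mM1 mM2 M10 M20.
exists (M1 `|` M2); split => //; exists (fun x => (g1 x +i* g2 x)%C) => //.
by move=> x /not_orP[/g1E e1 /g2E e2]; rewrite e1 e2; case: (f x).
Qed.

Lemma complex_integrable_of_normc (F : m.-tuple R -> R[i]) : borel F ->
  (\int[mu]_(x in D) (normc (F x))%:E < +oo)%E -> complex_integrable mu D F.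
Proof.
move=> bF iF; have [mr mi] := bF.
have iN : mu.-integrable D (fun x => (normc (F x))%:E).
  apply/integrableP; split.
    by apply/measurable_EFinP; apply: measurable_funTS; exact: measurable_normc.
  by under eq_integral do rewrite gee0_abs ?lee_fin ?normc_ge0//.
split; apply: (le_integrable mD _ _ iN).
- by apply/measurable_EFinP; exact: measurable_funTS.
- by move=> x _; rewrite /= lee_fin [leRHS]ger0_norm ?normc_ge0// Re_le_normc.
- by apply/measurable_EFinP; exact: measurable_funTS.
- by move=> x _; rewrite /= lee_fin [leRHS]ger0_norm ?normc_ge0// Im_le_normc.
Qed.

Lemma complex_integral_off_null (M : set (m.-tuple R)) (F G : m.-tuple R -> R[i]) :
  measurable M -> mu M = 0 -> (forall x, ~ M x -> F x = G x) ->
  complex_integral mu D F = complex_integral mu D G.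
Proof.
move=> mM M0 FG; rewrite /complex_integral /Rintegral.
by congr (_ +i* _)%C; congr fine; apply: (integral_off_null mD mM M0) => x _ Mx; rewrite FG.
Qed.

Lemma fourier_coefE (f : m.-tuple R -> R[i]) k :
  complex_integral mu D (fun x => f x * (harmonic k x)^*%C) =
  ((2 * pi) ^+ m)%:C%C * fourier_coef f k.
Proof.
rewrite /fourier_coef mulrA -rmorphM/= divff ?mul1r//.
by rewrite expf_neq0// gt_eqF// twopi_gt0.
Qed.

(** Integrals over the slices in the direction of [x_j] vanish, and a harmonic
    with [k_j = 0] is constant on these slices. *)
Lemma fourier_coef_mean0 (f g : m.-tuple R -> R[i]) (M : set (m.-tuple R)) k j :
  measurable M -> mu M = 0 -> borel g -> complex_integrable mu D g ->
  (forall x, ~ M x -> g x = f x) ->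
  {ae mu, forall x, complex_integral leb per (fun y => f (set_tnth x j y)) = 0} ->
  tnth k j = 0 -> fourier_coef f k = 0.
Proof.
move=> mM M0 [mr mi] [ir ii] gf [A [mA A0 hA]] kj.
suff E : complex_integral mu D (fun x => f x * (harmonic k x)^*%C) = 0.
  move: E; rewrite fourier_coefE => /eqP; rewrite mulf_eq0 => /orP[|/eqP//].
  by rewrite fmorph_eq0 expf_eq0 gt_eqF ?twopi_gt0// andbF.
have [N1 [mN1 N10 hN1]] := null_slices j mM M0.
have [mN N0] := null_setU mN1 mA N10 A0.
have slices x : torus x -> ~ (N1 `|` A) x ->
    \int[leb]_(y in per) complex.Re (g (set_tnth x j y)) = 0 /\
    \int[leb]_(y in per) complex.Im (g (set_tnth x j y)) = 0.
  move=> tx /not_orP[nN1 nA].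
  have [] : complex_integral leb per (fun y => f (set_tnth x j y)) = 0.
    by apply: contrapT => h; apply: nA; exact: hA.
  have mS : measurable (per `&` [set y | M (set_tnth x j y)]).
    apply: measurableI; first exact: measurable_per.
    by rewrite -[X in measurable X]setTI; exact: (measurable_slice j x).
  have eqf (p : R[i] -> R) : \int[leb]_(y in per) p (g (set_tnth x j y)) =
      \int[leb]_(y in per) p (f (set_tnth x j y)).
    have := @integral_off_null _ _ R leb per _ (fun y => (p (g (set_tnth x j y)))%:E)
      (fun y => (p (f (set_tnth x j y)))%:E) (@measurable_per R) mS (hN1 x tx nN1).
    by rewrite /Rintegral => -> // y py nM; rewrite gf// => My; apply: nM.
  by rewrite -!eqf => h1 h2.
have ha x y : angle k (set_tnth x j y) = angle k x :> R.
  have e z : angle k (set_tnth x j z) = angle k (set_tnth x j 0) :> R.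
    by rewrite angle_set_tnth kj mul0r addr0.
  by rewrite -[in RHS](set_tnth_id x j) !e.
have hk b x y : trig (k, b) (set_tnth x j y) = trig (k, b) x :> R.
  by rewrite /trig /= ha.
have mt b : measurable_fun setT (trig (k, b) : m.-tuple R -> R).
  by case: (@bounded_measurable_trig R m (k, b)).
have bt b := @bounded_measurable_trig R m (k, b).
have z1 b : \int[mu]_(x in D) (complex.Re (g x) * trig (k, b) x) = 0.
  apply: (@Rintegral_torus_mean0 _ _ j (N1 `|` A)) => //.
  - exact: integrable_mul_bounded.
  - by move=> x tx /(slices x tx)[].
have z2 b : \int[mu]_(x in D) (complex.Im (g x) * trig (k, b) x) = 0.
  apply: (@Rintegral_torus_mean0 _ _ j (N1 `|` A)) => //.
  - exact: integrable_mul_bounded.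
  - by move=> x tx /(slices x tx)[].
rewrite -(@complex_integral_off_null M (fun x => g x * (harmonic k x)^*%C))//; last first.
  by move=> x Mx; rewrite gf.
rewrite /complex_integral.
rewrite (@eq_Rintegral _ _ _ mu D (fun x => 1 * (complex.Re (g x) * trig (k, true) x) +
    1 * (complex.Im (g x) * trig (k, false) x))); last first.
  by move=> x _; rewrite ReM /trig /= !mul1r mulNr mulrN opprK.
rewrite [X in (_ +i* X)%C](@eq_Rintegral _ _ _ mu D (fun x =>
    (- 1) * (complex.Re (g x) * trig (k, false) x) +
    1 * (complex.Im (g x) * trig (k, true) x))); last first.
  by move=> x _; rewrite ImM /trig /= !mul1r mulN1r mulrN.
rewrite !Rintegral_comb// ?z1 ?z2 ?mulr0 ?addr0//; exact: integrable_mul_bounded.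
Qed.

End fourier.

(** * The tail of the Fourier series *)

Section fourier_tail.
Context {R : realType} {m : nat}.
Local Notation normc := (@Normc.normc R).
Local Notation harmonic := Defs.harmonic.
Local Notation leb := (@lebesgue_measure R).
Local Notation per := (@period_itv R).
Local Notation mu := (lebesgue_tuple R m).
Local Notation D := (@torus R m).
Let mD := @measurable_torus R m.

(** An enumeration of the multi-indices turns the sum over all blocks into
    an ordinary series; a number that encodes no multi-index stands for an
    empty block. *)
Definition blocks (i : nat) : seq (m.-tuple int) :=
  oapp (@block_seq R m) [::] (pickle_inv i).

Lemma blocks_uniq i : uniq (blocks i).
Proof. by rewrite /blocks; case: pickle_inv => //= s; exact: block_seq_uniq. Qed.

Lemma mem_blocks i k : k \in blocks i <-> exists2 s, pickle_inv i = Some s & block_freq s k.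
Proof.
rewrite /blocks; case: pickle_inv => /= [s|]; last by split => // -[].
by rewrite mem_block_seq; split => [h|[_ [<-]]//]; exists s.
Qed.

(** A frequency without zero coordinates lies in exactly one block, and a
    frequency with a zero coordinate has [b k = 0]. *)
Lemma blocks_eventually (k : m.-tuple int) (b : m.-tuple int -> R[i]) :
  (forall j, tnth k j = 0 -> b k = 0) ->
  exists n0, forall n, (n0 <= n)%N -> \sum_(i < n) (if k \in blocks i then b k else 0) = b k.
Proof.
move=> b0; have [k0|] := pselect (forall j, tnth k j != 0); last first.
  move=> /existsNP[j /negP]; rewrite negbK => /eqP/b0 ->.
  by exists 0%N => n _; rewrite big1// => i _; case: ifP.
have [s hs] := block_freq_ex k0.
exists (pickle s).+1 => n hn; rewrite (bigD1 (Ordinal hn))//= big1 ?addr0.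
  case: ifPn => // /negP[]; apply/mem_blocks; exists s => //.
  by rewrite pickleK_inv.
move=> i; case: ifP => // /mem_blocks[t it kt] /eqP[]; apply: val_inj => /=.
have := pickle_invK (T := m.-tuple nat) i; rewrite it /= => <-.
by rewrite (block_freq_inj hs kt).
Qed.

Lemma partial_sums_cvg (u : nat -> R[i]) :
  (\sum_(i <oo) (normc (u i))%:E < +oo)%E ->
  cvgn (fun n => \sum_(i < n) complex.Re (u i)) /\ cvgn (fun n => \sum_(i < n) complex.Im (u i)).
Proof.
move=> uoo; have cN : cvgn (series (fun i => normc (u i))).
  apply: nondecreasing_is_cvgn.
    exact: (nondecreasing_series (P := xpredT) (fun i _ _ => normc_ge0 (u i))).
  exists (fine (\sum_(i <oo) (normc (u i))%:E)) => _ [k _ <-].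
  rewrite -lee_fin fineK; last by rewrite ge0_fin_numE// nneseries_ge0// => i _ _; rewrite lee_fin normc_ge0.
  rewrite -sumEFin; apply: nneseries_lim_ge => i _ _; by rewrite lee_fin normc_ge0.
have cv (p : R[i] -> R) : (forall z, `|p z| <= normc z) -> cvgn (fun n => \sum_(i < n) p (u i)).
  move=> hp; rewrite (_ : (fun n => _) = series (fun i => p (u i))); last first.
    by apply/funext => n; rewrite /series /= big_mkord.
  apply: normed_cvg; apply: (series_le_cvg _ _ _ cN) => i //=; first exact: normc_ge0.
by split; apply: cv => z; [exact: Re_le_normc|exact: Im_le_normc].
Qed.

Lemma complex_bounded_partial_sum (d : nat -> m.-tuple R -> R[i]) p :
  (forall i, complex_bounded (d i)) -> complex_bounded (fun x => \sum_(i < p) d i x).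
Proof.
move=> bd; elim: p => [|p [IH1 IH2]].
  rewrite (_ : (fun x => _) = (fun=> 0)); first by split; exact: bounded_measurable_cst.
  by apply/funext => x; rewrite big_ord0.
have [b1 b2] := bd p; split.
  rewrite (_ : (fun x => _) = (fun x => complex.Re (\sum_(i < p) d i x) + complex.Re (d p x))).
    exact: bounded_measurableD.
  by apply/funext => x; rewrite big_ord_recr ReD.
rewrite (_ : (fun x => _) = (fun x => complex.Im (\sum_(i < p) d i x) + complex.Im (d p x))).
  exact: bounded_measurableD.
by apply/funext => x; rewrite big_ord_recr ImD.
Qed.

Lemma esum_powR_lty (r : 'I_m -> R) : (forall j, 0 < r j) ->
  (\esum_(s in [set: m.-tuple nat]) (\prod_j 2 `^ (- ((tnth s j)%:R * r j)))%:E < +oo)%E.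
Proof.
move=> r0; pose q j : R := 2 `^ (- r j).
have q01 j : 0 < q j < 1.
  rewrite powR_gt0//= /q powRN invf_lt1 ?powR_gt0//.
  have := gt0_ltr_powR (r0 j) (_ : 1 \in Num.nneg) (_ : 2 \in Num.nneg) (ltr1n R 2).
  by rewrite !nnegrE powR1; apply.
apply: (@le_lt_trans _ _ (\prod_j (1 - q j)^-1)%:E); last exact: ltry.
rewrite (_ : (fun s => _) = (fun s : m.-tuple nat => (\prod_j q j ^+ tnth s j)%:E)); last first.
  apply/funext => s; congr (_%:E); apply: eq_bigr => j _.
  by rewrite -mulrN mulrC powRrM powR_mulrn// powR_ge0.
apply: (esum_tuple_prod (u := fun j k => q j ^+ k)).
- by move=> j k; rewrite exprn_ge0// ltW//; case/andP: (q01 j).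
- by move=> j; rewrite invr_gt0 subr_gt0; case/andP: (q01 j).
- by move=> j; rewrite esum_geometric//; case/andP: (q01 j) => /ltW -> ->.
Qed.

Lemma big_uniq_subset (I : eqType) (K L : seq I) (F : I -> R[i]) :
  uniq K -> uniq L -> {subset L <= K} -> \sum_(k <- L) F k = \sum_(k <- K | k \in L) F k.
Proof.
move=> uK uL LK; rewrite -[RHS]big_filter; apply: perm_big; apply: uniq_perm => //.
  exact: filter_uniq.
by move=> k; rewrite mem_filter; case: (boolP (k \in L)) => //= /LK ->.
Qed.

(** Eventually the partial sums contain all blocks of the hyperbolic cross,
    and those are pairwise disjoint. *)
Lemma hyperbolic_cross_sum (gamma : 'I_m -> R) (n : nat) (b : m.-tuple int -> R[i]) x :
  (forall j, 0 < gamma j) ->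
  exists p0, forall p, (p0 <= p)%N ->
  \sum_(k \in @hyperbolic_cross R m gamma n) b k * harmonic k x =
  \sum_(i < p) (if oapp (fun s => (weight gamma s < n%:R)%R) false (pickle_inv i)
                then trig_sum (blocks i) b x else 0).
Proof.
move=> gamma0; have fW := @finite_weight_lt R m gamma n gamma0.
pose Ws := finmap.enum_fset (fset_set [set s : m.-tuple nat | weight gamma s < n%:R]).
have memW s : (s \in Ws) = (weight gamma s < n%:R).
  have E : (s \in Ws) = (s \in [set s : m.-tuple nat | weight gamma s < n%:R]) := in_fset_set fW s.
  by rewrite E; apply/idP/idP; rewrite inE.
have fQ : finite_set (@hyperbolic_cross R m gamma n).
  by apply: bigcup_finite => // s _; exact: finite_dyadic_block.
pose K := finmap.enum_fset (fset_set (@hyperbolic_cross R m gamma n)).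
have memK k : k \in K <-> exists2 s, weight gamma s < n%:R & block_freq s k.
  have E : (k \in K) = (k \in @hyperbolic_cross R m gamma n) := in_fset_set fQ k.
  rewrite E inE; split => [[s ws /dyadic_blockP ks]|[s ws ks]]; first by exists s.
  by exists s => //; apply/dyadic_blockP.
exists (\max_(s <- Ws) (pickle s).+1)%N => p hp.
rewrite fsbig_finite// -/K -big_mkcond/=.
pose cond (i : 'I_p) := oapp (fun s => (weight gamma s < n%:R)%R) false (@pickle_inv (m.-tuple nat) i).
rewrite (eq_bigr (fun i : 'I_p => \sum_(k <- K | k \in blocks i) b k * harmonic k x)); last first.
  move=> i ci; apply: big_uniq_subset; [exact: finmap.fset_uniq|exact: blocks_uniq|].
  move=> k /mem_blocks[s si ks]; apply/memK; exists s => //.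
  by move: ci; rewrite si.
rewrite (exchange_big_dep xpredT)//= big_seq_cond [RHS]big_seq_cond; apply: eq_bigr => k.
rewrite andbT => /memK[s ws ks].
have sp : (pickle s < p)%N.
  apply: leq_trans hp; apply: (@leq_bigmax_seq _ _ xpredT (fun s => (pickle s).+1)) => //.
  by rewrite memW.
rewrite (bigD1 (Ordinal sp))/=; last first.
  rewrite pickleK_inv /= ws; apply/mem_blocks; exists s => //; exact: pickleK_inv.
rewrite big1 ?addr0// => i /andP[/andP[_ /mem_blocks[t it kt]] /eqP[]]; apply: val_inj => /=.
have := pickle_invK (T := m.-tuple nat) i; rewrite it /= => <-.
by rewrite (block_freq_inj ks kt).
Qed.

(** The integrals of the blocks are summable, so the series of the blocks
    converges absolutely almost everywhere and is dominated by an integrable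
    function. The difference of [f] and its sum is integrable and all of its
    trigonometric integrals vanish, so it is zero almost everywhere. Without
    the blocks of the hyperbolic cross the tail of the series remains. *)
Lemma fourier_tail_bound (gamma r : 'I_m -> R) (X : 'I_m -> symmetric_space R)
    (phi : 'I_m -> R -> R) (f : m.-tuple R -> R[i]) (n : nat) :
  (forall j, 0 < gamma j) -> (forall j, 0 < r j) ->
  (forall j, fundamental_function (X j) (phi j)) -> (forall j, Phi_function (phi j)) ->
  (forall j, (upper_dilation (phi j) < 2%:E)%E) ->
  aniso_space0 X f -> (aniso_norm X f <= 1)%E ->
  (forall s, aniso_norm X (delta_block s f) <= (\prod_j 2 `^ (- ((tnth s j)%:R * r j)))%:E)%E ->
  exists M, [/\ measurable M, mu M = 0 & forall x, torus x -> ~ M x ->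
    ((normc (f x - \sum_(k \in @hyperbolic_cross R m gamma n) fourier_coef f k * harmonic k x))%:E <=
     \esum_(s in [set s | (n%:R <= weight gamma s)%R]) (normc (delta_block s f x))%:E)%E].
Proof.
move=> gamma0 r0 hX hphi uphi [[_ mf _] mean0] f1 fs.
have [M [mM M0 [g bg gf]]] := complex_borel_modification mf.
have [C C0 hC] := integral_torus_le_aniso_norm hX hphi uphi.
have gN : (\int[mu]_(x in D) (normc (g x))%:E <= (C * 1)%:E)%E.
  apply: (hC f _ M) => //.
  - by apply/measurable_EFinP; exact: measurable_normc.
  - by move=> x; rewrite lee_fin normc_ge0.
  - by move=> x /gf ->.
have ig : complex_integrable mu D g by apply: complex_integrable_of_normc => //; exact: le_lt_trans gN (ltry _).
pose a := fourier_coef f.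
have a0 k j : tnth k j = 0 -> a k = 0 by exact: (fourier_coef_mean0 mM M0 bg ig gf (mean0 j)).
pose d i : m.-tuple R -> R[i] := trig_sum (blocks i) a.
have bd i : complex_bounded (d i) by exact: complex_bounded_trig_sum.
have dE i x : d i x = oapp (fun s => delta_block s f x) 0 (pickle_inv i).
  rewrite /d /blocks; case: pickle_inv => /= [s|]; first by rewrite delta_block_trig_sum.
  by rewrite /trig_sum big_nil.
pose G p x := g x - \sum_(i < p) d i x.
have bS p : complex_bounded (fun x => \sum_(i < p) d i x).
  exact: complex_bounded_partial_sum.
have bG p : borel (G p) by apply: borelB => //; exact: borel_bounded.
have iG p : complex_integrable mu D (G p).
  rewrite (_ : G p = (fun x => g x + (-1) * \sum_(i < p) d i x)).
    apply: complex_integrableD => //; apply: complex_integrableZ => //.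
    exact: complex_integrable_bounded.
  by apply/funext => x; rewrite mulN1r.
have coefG k : exists n0, forall p, (n0 <= p)%N ->
    complex_integral mu D (fun x => G p x * (harmonic k x)^*%C) = 0.
  have [n0 hn0] := blocks_eventually (a0 k); exists n0 => p /hn0 hp.
  have bh := complex_bounded_conj_harmonic (R := R) k.
  rewrite (_ : (fun x => _) = (fun x => g x * (harmonic k x)^*%C +
      (-1) * \sum_(i < p) d i x * (harmonic k x)^*%C)); last first.
    by apply/funext => x; rewrite /G mulrBl mulN1r mulr_suml.
  have id i : complex_integrable mu D (fun x => d i x * (harmonic k x)^*%C).
    by apply: complex_integrableM => //; [exact: borel_bounded|exact: complex_integrable_bounded].
  have [iSd cSd] := complex_integral_sum mD (index_enum 'I_p) (fun i : 'I_p => id i).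
  rewrite complex_integralD//; last 2 first.
  - exact: complex_integrableM.
  - exact: complex_integrableZ.
  rewrite complex_integralZ// cSd mulN1r.
  have -> : complex_integral mu D (fun x => g x * (harmonic k x)^*%C) = ((2 * pi) ^+ m)%:C%C * a k.
    rewrite -fourier_coefE; apply: (@complex_integral_off_null _ _ M) => // x Mx.
    by rewrite gf.
  under eq_bigr do rewrite complex_integral_trig_sum ?blocks_uniq//.
  by rewrite -mulr_sumr hp subrr.
have trigG i : exists n0, forall p, (n0 <= p)%N ->
    \int[mu]_(x in D) (complex.Re (G p x) * trig i x) = 0 /\
    \int[mu]_(x in D) (complex.Im (G p x) * trig i x) = 0.
  case: i => k b; have [n1 h1] := coefG k.
  have [n2 h2] := coefG [tuple - tnth k j | j < m].
  exists (maxn n1 n2) => p; rewrite geq_max => /andP[p1 p2].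
  apply: complex_integral_trig0 => // l [->|->]; [exact: h1|exact: h2].
pose W x := ((normc (g x))%:E + \sum_(i <oo) (normc (d i x))%:E)%E.
have Nd i x : (0 <= (normc (d i x))%:E)%E by rewrite lee_fin normc_ge0.
have mNd i : measurable_fun setT (fun x => (normc (d i x))%:E).
  by apply/measurable_EFinP; apply: measurable_normc; exact: borel_bounded.
have mNg : measurable_fun setT (fun x => (normc (g x))%:E).
  by apply/measurable_EFinP; exact: measurable_normc.
have W0 x : (0 <= W x)%E by rewrite adde_ge0 ?nneseries_ge0// lee_fin normc_ge0.
have mW : measurable_fun setT W.
  apply: emeasurable_funD => //; apply: ge0_emeasurable_sum => //.
pose B (s : m.-tuple nat) : R := \prod_j 2 `^ (- ((tnth s j)%:R * r j)).
have B0 s : 0 <= B s by apply: prodr_ge0 => j _; exact: powR_ge0.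
have sumB : (\esum_(s in [set: m.-tuple nat]) (B s)%:E < +oo)%E by exact: esum_powR_lty.
have iW : mu.-integrable D W.
  apply/integrableP; split; first exact: measurable_funTS.
  under eq_integral do rewrite gee0_abs//.
  rewrite ge0_integralD//; last 4 first.
  - by move=> x _; rewrite lee_fin normc_ge0.
  - exact: measurable_funTS.
  - by move=> x _; exact: nneseries_ge0.
  - by apply: measurable_funTS; apply: ge0_emeasurable_sum.
  rewrite integral_nneseries//; last by move=> i; exact: measurable_funTS.
  apply: lte_add_pinfty; first exact: le_lt_trans gN (ltry _).
  apply: (@le_lt_trans _ _ (\sum_(i <oo) (C%:E * oapp (fun s => (B s)%:E) 0 (pickle_inv i)))%E).
    apply: lee_nneseries => i _; first by move=> _; apply: integral_ge0.
    case E : (pickle_inv i) => [s|] /=; last first.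
      rewrite mule0 integral0_eq// => x _; rewrite dE E /=.
      by rewrite expr0n addr0 sqrtr0.
    rewrite -EFinM; apply: (hC (delta_block s f) _ set0) => //.
    by move=> x _; rewrite dE E.
  rewrite nneseriesZl; last by move=> i _; case: pickle_inv => //= s; rewrite lee_fin.
  have := nneseries_pickle_le (F := fun s => (B s)%:E) (fun s => B0 s).
  move=> /le_lt_trans/(_ sumB); apply: lte_mul_pinfty => //.
  by rewrite lee_fin ltW.
have GW p x : ((normc (G p x))%:E <= W x)%E.
  apply: (@le_trans _ _ (normc (g x) + \sum_(i < p) normc (d i x))%:E).
    by rewrite lee_fin (le_trans (le_normcD _ _))// lerD2l normcN normc_sum.
  rewrite EFinD leeD2l// -sumEFin -(big_mkord xpredT (fun i => (normc (d i x))%:E)).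
  by apply: nneseries_lim_ge.
have Woo : {ae mu, forall x, D x -> W x \is a fin_num} by exact: integrable_ae.
have cG : {ae mu, forall x, D x -> cvgn (fun p => complex.Re (G p x)) /\ cvgn (fun p => complex.Im (G p x))}.
  apply: filterS Woo => x Wx Dx.
  have /partial_sums_cvg[cr ci] : (\sum_(i <oo) (normc (d i x))%:E < +oo)%E.
    apply: (@le_lt_trans _ _ (W x)); first by rewrite leeDr// lee_fin normc_ge0.
    by rewrite -ge0_fin_numE//; exact: Wx.
  have eG (p : R[i] -> R) q : (forall z w, p (z + w) = p z + p w) -> (forall z, p (- z) = - p z) ->
      p (G q x) = p (g x) - \sum_(i < q) p (d i x).
    move=> pD pN; have p0 : p 0 = 0 by rewrite -(subrr (0 : R[i])) pD pN subrr.
    by rewrite /G pD pN (big_morph p pD p0).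
  split.
    rewrite (_ : (fun p => _) = (fun p => complex.Re (g x) - \sum_(i < p) complex.Re (d i x))).
      by apply: is_cvgB => //; exact: is_cvg_cst.
    by apply/funext => p; apply: eG; [exact: ReD|case].
  rewrite (_ : (fun p => _) = (fun p => complex.Im (g x) - \sum_(i < p) complex.Im (d i x))).
    by apply: is_cvgB => //; exact: is_cvg_cst.
  by apply/funext => p; apply: eG; [exact: ImD|case].
have limR : {ae mu, forall x, D x -> complex.Re (G p x) @[p --> \oo] --> (0 : R)}.
  apply: (@trig_limit_ae0 _ _ (fun p x => complex.Re (G p x)) W) => //.
  - by move=> p; case: (bG p).
  - by move=> p x Dx; apply: le_trans (GW p x); rewrite lee_fin Re_le_normc.
  - by apply: filterS cG => x h Dx; case: (h Dx).
  - by move=> i; have [n0 h] := trigG i; exists n0 => p /h[].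
have limI : {ae mu, forall x, D x -> complex.Im (G p x) @[p --> \oo] --> (0 : R)}.
  apply: (@trig_limit_ae0 _ _ (fun p x => complex.Im (G p x)) W) => //.
  - by move=> p; case: (bG p).
  - by move=> p x Dx; apply: le_trans (GW p x); rewrite lee_fin Im_le_normc.
  - by apply: filterS cG => x h Dx; case: (h Dx).
  - by move=> i; have [n0 h] := trigG i; exists n0 => p /h[].
have nM : {ae mu, forall x, ~ M x} by exists M; split => // x /=; exact: contrapT.
have : {ae mu, forall x, D x -> ((normc (f x - \sum_(k \in @hyperbolic_cross R m gamma n) a k * harmonic k x))%:E <=
     \esum_(s in [set s | (n%:R <= weight gamma s)%R]) (normc (delta_block s f x))%:E)%E}.
  apply: filterS3 limR limI nM => x lr li Mx Dx.
  apply/lee_addgt0Pr => e e0.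
  have [p0 hp0] := @hyperbolic_cross_sum gamma n a x gamma0.
  have e2 : 0 < e / 2 by rewrite divr_gt0.
  have /cvgr0Pnorm_lt/(_ _ e2) nr := lr Dx; have /cvgr0Pnorm_lt/(_ _ e2) ni := li Dx.
  near \oo => p.
  have pp0 : (p0 <= p)%N by near: p; exact: nbhs_infty_ge.
  rewrite (hp0 p pp0).
  rewrite (_ : f x - _ = G p x + \sum_(i < p) (if oapp (fun s => (weight gamma s < n%:R)%R) false (pickle_inv i)
                then 0 else d i x)); last first.
    have -> : G p x = f x - (\sum_(i < p) (if oapp (fun s => (weight gamma s < n%:R)%R) false (pickle_inv i)
                then d i x else 0) + \sum_(i < p) (if oapp (fun s => (weight gamma s < n%:R)%R) false (pickle_inv i)
                then 0 else d i x)).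
      rewrite /G gf// -big_split/=; congr (_ - _); apply: eq_bigr => i _.
      by case: ifP; rewrite ?addr0 ?add0r.
    by rewrite opprD addrA subrK.
  apply: (@le_trans _ _ ((normc (G p x))%:E + \sum_(i <oo) oapp (fun s => if s \in [set s | (n%:R <= weight gamma s)%R] then (normc (delta_block s f x))%:E else 0) 0 (pickle_inv i))%E).
    apply: (@le_trans _ _ (normc (G p x) + \sum_(i < p) normc (if oapp (fun s => (weight gamma s < n%:R)%R) false (pickle_inv i)
                then 0 else d i x))%:E).
      by rewrite lee_fin (le_trans (le_normcD _ _))// lerD2l normc_sum.
    rewrite EFinD leeD2l// -sumEFin -(big_mkord xpredT (fun i => (normc (if oapp (fun s => (weight gamma s < n%:R)%R) false (pickle_inv i)
                then 0 else d i x))%:E)).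
    apply: le_trans (nneseries_lim_ge (P := xpredT) p _); last first.
      by move=> i _ _; case: pickle_inv => //= s; case: ifP; rewrite // lee_fin normc_ge0.
    apply: lee_sum => i _; rewrite dE; case: pickle_inv => [s|] /=; last by rewrite expr0n addr0 sqrtr0.
    case: (boolP (weight gamma s < n%:R)) => hs; first by rewrite /= expr0n addr0 sqrtr0; case: ifP; rewrite // lee_fin normc_ge0.
    by case: ifPn => // /negP[]; rewrite inE /= leNgt.
  rewrite addeC; apply: leeD.
    rewrite [leRHS]esum_mkcond; apply: nneseries_pickle_le => s.
    by case: ifP => // _; rewrite lee_fin normc_ge0.
  rewrite lee_fin (le_trans (normc_le_ReIm _))// [leRHS](splitr e) lerD// ltW//.
    by near: p.
  by near: p.
case=> A [mA A0 hA]; exists A; split => // x Dx nA; apply: contrapT => h; apply: nA; apply: hA => /= /(_ Dx).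
exact: h.
Unshelve. all: by end_near. Qed.

End fourier_tail.

(** * Superposition of the blocks *)

Section superposition.
Context {R : realType} {m : nat}.
Local Notation normc := (@Normc.normc R).
Variables (X : 'I_m -> symmetric_space R) (phi psi : 'I_m -> R -> R).
Hypotheses (hX : forall j, fundamental_function (X j) (phi j))
  (hphi : forall j, Phi_function (phi j)) (hpsi : forall j, Phi_function (psi j))
  (lpsi : forall j, (1 < lower_dilation (psi j))%E)
  (dil : forall j, (upper_dilation (psi j) < lower_dilation (phi j))%E).

Lemma psi_phi_decay_uniform : exists C q, [/\ 0 < C, 0 < q < 1 & forall j s k,
  psi j (2 ^- k) / phi j (2 ^- minn s k) <= C * q ^+ dst s k * phi_ratio (psi j) (phi j) s].
Proof.
have /choice[u hu] : forall j, exists u : R * R, [/\ 0 < u.1, 0 < u.2 < 1 & forall s k,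
    psi j (2 ^- k) / phi j (2 ^- minn s k) <= u.1 * u.2 ^+ dst s k * phi_ratio (psi j) (phi j) s].
  by move=> j; have [C [q h]] := psi_phi_decay (hphi j) (hpsi j) (lpsi j) (dil j); exists (C, q).
pose q := \big[Num.max/2^-1]_j (u j).2; pose C := 1 + \sum_j (u j).1.
have C0 : 0 < C by rewrite ltr_pwDl// sumr_ge0// => j _; case: (hu j) => /ltW.
have q0 : 0 < q by apply: (@lt_le_trans _ _ 2^-1); [rewrite invr_gt0|exact: bigmax_ge_id].
exists C, q; split => //.
  rewrite q0/=; apply: bigmax_lt; first by rewrite invf_lt1// ltr1n.
  by move=> j _; case: (hu j) => _ /andP[].
move=> j s k; have [uj0 /andP[uj1 _] uj] := hu j.
apply: (le_trans (uj s k)); rewrite ler_wpM2r//.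
  by rewrite /phi_ratio divr_ge0// ltW// Phi_pow2_gt0.
rewrite ler_pM ?exprn_ge0 ?(ltW uj0) ?(ltW uj1)//.
  rewrite /C (bigD1 j)//= addrCA lerDl addr_ge0// sumr_ge0// => i _.
  by case: (hu i) => /ltW.
by apply: lerXn2r; rewrite ?nnegrE ?(ltW uj1) ?(ltW q0)//; exact: le_bigmax.
Qed.

Lemma recip_Phi_antitone (f : R -> R) v w : Phi_function f -> 0 < v -> v <= w ->
  recip_Phi f w <= recip_Phi f v.
Proof.
move=> hf v0 vw; have w0 : 0 < w by exact: lt_le_trans vw.
have /andP[m0 m1] := min1_itv v0; have /andP[n0 n1] := min1_itv w0.
have p1 : 0 < f (Num.min v 1) by apply: Phi_gt0; rewrite ?m0.
have p2 : 0 < f (Num.min w 1) by apply: Phi_gt0; rewrite ?n0.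
rewrite /recip_Phi lef_pV2 ?posrE//; apply: Phi_nondecreasing => //; first exact: ltW.
by rewrite le_min !ge_min vw lexx orbT.
Qed.

Lemma torus_rearr0 n (t : 'I_n -> R) : (forall j, 0 < t j) ->
  torus_rearr (fun=> 0%E) t = 0%E.
Proof.
elim: n t => [//|n IH] t t0 /=; rewrite -[RHS](IH (fun j => t (lift ord0 j))) => [|j]; last exact: t0.
congr (torus_rearr _ _); apply/funext => x'.
apply/eqP; rewrite eq_le rearr1_ge0 andbT; apply: rearr1_le => // l l0.
rewrite (_ : level _ _ = set0) ?measure0 ?lte_fin//.
by apply/seteqP; split => // x [_]; rewrite ltNge (ltW l0).
Qed.

(** The pieces are superposed with weights [eps s] decaying geometrically in
    the distance of [s] to [k].  Dilating the argument by [eps s] costs a power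
    of [eps s], which the decay of [psi (2 ^- k) / phi (2 ^- minn s k)] beats. *)
Lemma block_superposition : exists K rho, [/\ 0 < K, 0 < rho < 1 &
  forall (F : m.-tuple R -> \bar R) (M : set (m.-tuple R))
    (g : m.-tuple nat -> m.-tuple R -> R[i]) (A : m.-tuple nat -> R) (Y : pred (m.-tuple nat)),
  measurable M -> lebesgue_tuple R m M = 0 ->
  (forall s, trig_degree (fun j => 2 ^ tnth s j)%N (g s)) -> (forall s, Defs.periodic (g s)) ->
  (forall s, 0 <= A s) -> (forall s, (aniso_norm X (g s) <= (A s)%:E)%E) ->
  (forall x, torus x -> ~ M x -> (F x <= \esum_(s in [set s | Y s]) (normc (g s x))%:E)%E) ->
  forall (k : m.-tuple nat) (t : 'I_m -> R),
  (forall j, 2 ^- (tnth k j).+1 < t j <= 2 ^- tnth k j) ->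
  ((\prod_j psi j (2 ^- tnth k j))%:E * torus_rearr F t <=
   ereal_sup (range (fun s : m.-tuple nat => (\prod_j rho ^+ dst (tnth s j) (tnth k j))%:E *
     (if Y s then (K * (\prod_j phi_ratio (psi j) (phi j) (tnth s j) * A s))%:E else 0))))%E].
Proof.
have [Cd [q [Cd0 q01 hq]]] := psi_phi_decay_uniform.
(* of the [2 * m.+1] factors, one makes up for the coefficient [(eps s)^-1], [m]
   for the dilation by [eps s], and the other [m.+1] remain in the kernel *)
have [eta /andP[eta0 eta1] heta] := exists_root_ge (2 * m.+1) q01.
have [CN CN0 nik] := @nikolskii R m.
pose E : R := (2 / (1 - eta)) ^+ m.
have e1 : 1 <= 2 / (1 - eta) by rewrite ler_pdivlMr ?mul1r; lra.
have E1 : 1 <= E by exact: exprn_ege1.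
(* [c0] normalizes the weights [eps], which add up to at most [1 / 2] *)
pose c0 : R := (2 * E)^-1.
have c00 : 0 < c0 by rewrite invr_gt0 mulr_gt0// (lt_le_trans _ E1).
have c01 : c0 <= 1 by rewrite invf_le1; lra.
pose K := CN * (2 ^+ m * c0 ^- m.+1 * Cd ^+ m).
have K0 : 0 < K by rewrite mulr_gt0// mulr_gt0 ?exprn_gt0// mulr_gt0 ?invr_gt0 ?exprn_gt0.
exists K, (eta ^+ m.+1); split => //.
  by rewrite exprn_gt0// exprn_ilt1// ltW.
move=> F M g A Y mM M0 tg pg A0 gA FY k t kt.
have t0 j : 0 < t j by case/andP: (kt j) => h _; rewrite (lt_trans _ h)// invr_gt0 exprn_gt0.
have t1 j : t j <= 1.
  by case/andP: (kt j) => _ h; rewrite (le_trans h)// invf_le1 ?exprn_gt0// exprn_ege1// ler1n.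
pose P (s : m.-tuple nat) : R := \prod_j eta ^+ dst (tnth s j) (tnth k j).
have P0 s : 0 < P s by apply: prodr_gt0 => j _; rewrite exprn_gt0.
have P1 s : P s <= 1.
  by apply: prodr_ile1 => j _; rewrite exprn_ge0 ?(ltW eta0)//= exprn_ile1// ltW.
pose eps s := c0 * P s.
have eps0 s : 0 < eps s by rewrite mulr_gt0.
have eps1 s : eps s <= 1 by rewrite mulr_ile1// ltW.
pose H s x : \bar R := if Y s then (normc (g s x))%:E else 0%E.
have H0 s x : (0 <= H s x)%E by rewrite /H; case: ifP; rewrite // lee_fin normc_ge0.
have sumP : (\esum_(s in [set: m.-tuple nat]) (P s)%:E <= E%:E)%E.
  have := @esum_tuple_prod R nat m (fun j s => eta ^+ dst s (tnth k j)) (fun=> 2 / (1 - eta)).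
  rewrite prodr_const card_ord; apply => [j s|j|j].
  - by rewrite exprn_ge0// ltW.
  - by rewrite (lt_le_trans _ e1).
  - by apply: esum_dst; rewrite eta0.
have sume : (\esum_(s in [set: m.-tuple nat]) (eps s)%:E < 1)%E.
  under eq_esum do rewrite /eps EFinM.
  apply: le_lt_trans (esumZl_le _ (ltW c00) _) _; first by move=> s; rewrite lee_fin ltW.
  apply: le_lt_trans (lee_wpmul2l _ sumP) _; first by rewrite lee_fin ltW.
  have E0 : 0 < E by rewrite (lt_le_trans _ E1).
  by rewrite -EFinM lte_fin /c0 invfM -mulrA mulVf ?gt_eqF// mulr1 invf_lt1// ltr1n.
have psi0 : 0 < \prod_j psi j (2 ^- tnth k j) by apply: prodr_gt0 => j _; rewrite Phi_pow2_gt0.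
have Fsup x : torus x -> ~ M x ->
    (F x <= ereal_sup (range (fun s => ((eps s)^-1)%:E * H s x)))%E.
  move=> tx Mx; apply: (le_trans (FY x tx Mx)).
  rewrite esum_mkcond; set S := ereal_sup _.
  have S0 : (0 <= S)%E.
    apply: le_trans (ereal_sup_ubound _); last by exists [tuple of nseq m 0%N].
    by rewrite mule_ge0// lee_fin invr_ge0 ltW.
  have HS s : (H s x <= (eps s)%:E * S)%E.
    have : (((eps s)^-1)%:E * H s x <= S)%E by apply: ereal_sup_ubound; exists s.
    move=> /(lee_wpmul2l (x := (eps s)%:E)); rewrite lee_fin (ltW (eps0 s)) => /(_ isT).
    by rewrite muleA -EFinM mulfV ?gt_eqF// mul1e.
  case: S S0 HS => [S| |] S0 HS //; last by rewrite leey.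
  apply: (@le_trans _ _ (\esum_(s in [set: m.-tuple nat]) (S%:E * (eps s)%:E)))%E.
    apply: le_esum => s _; rewrite muleC; apply: le_trans (HS s).
    rewrite /H; case: (boolP (Y s)) => Ys; first by rewrite mem_set.
    by rewrite memNset//; exact/negP.
  apply: le_trans (esumZl_le _ _ _) _ => //; first by move=> s; rewrite lee_fin ltW.
  by rewrite -[leRHS]mule1 lee_wpmul2l// ltW.
have eps0' s : 0 < (eps s)^-1 by rewrite invr_gt0.
have := torus_rearr_sup_le [tuple of nseq m 0%N] mM M0 eps0' eps0 sume t0 Fsup.
move=> /(lee_wpmul2l (x := (\prod_j psi j (2 ^- tnth k j))%:E)).
rewrite lee_fin (ltW psi0) => /(_ isT) /le_trans; apply.
rewrite -ereal_sup_pZl//; apply: ge_ereal_sup => _ [_ [s _ <-] <-].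
apply: le_trans (ereal_sup_ubound _); last by exists s.
have epst j : 0 < eps s * t j <= 1.
  by rewrite mulr_gt0//= mulr_ile1// ltW.
rewrite /H; case: (boolP (Y s)) => Ys; last first.
  by rewrite !mule0 torus_rearr0 ?mule0// => j; case/andP: (epst j).
have kscale j e v : 0 < e <= 1 -> 0 < v -> recip_Phi (phi j) (e * v) <= e^-1 * recip_Phi (phi j) v.
  exact: recip_Phi_scale.
have gw v : (forall j, 0 < v j <= 1) -> (torus_rearr (fun x => (normc (g s x))%:E) v <=
    (A s * \prod_j recip_Phi (phi j) (v j))%:E)%E.
  move=> v01; apply: le_trans (torus_rearr_le_aniso_norm hX hphi (gA s) v01) _.
  rewrite lee_fin ler_wpM2l// ler_prod// => j _; case/andP: (v01 j) => v0 v1.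
  by rewrite recip_PhiE// lexx andbT invr_ge0 Phi_ge0// ltW.
have Npos j : (0 < 2 ^ tnth s j)%N by rewrite expn_gt0.
have := nik _ _ (fun j => recip_Phi (phi j)) _ Npos (tg s) (pg s) (fun j v => recip_Phi_gt0 (hphi j))
  kscale (A0 s) gw _ epst.
move=> /(lee_wpmul2l (x := ((eps s)^-1)%:E)); rewrite lee_fin (ltW (eps0' s)) => /(_ isT).
move=> /(lee_wpmul2l (x := (\prod_j psi j (2 ^- tnth k j))%:E)).
rewrite lee_fin (ltW psi0) => /(_ isT) /le_trans; apply.
rewrite -!EFinM lee_fin.
have fac j : psi j (2 ^- tnth k j) * recip_Phi (phi j) (Num.max (eps s * t j) (2 ^ tnth s j)%:R^-1) <=
    (2 / eps s) * (Cd * q ^+ dst (tnth s j) (tnth k j) * phi_ratio (psi j) (phi j) (tnth s j)).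
  pose v : R := 2 ^- minn (tnth s j) (tnth k j).
  have v0 : 0 < v by rewrite invr_gt0 exprn_gt0.
  have v1 : v <= 1 by rewrite invf_le1 ?exprn_gt0// exprn_ege1// ler1n.
  have e2 : 0 < eps s / 2 <= 1 by rewrite divr_gt0//=; have := eps1 s; lra.
  have vle : (eps s / 2) * v <= Num.max (eps s * t j) (2 ^ tnth s j)%:R^-1.
    rewrite le_max; have [sk|ks] := leqP (tnth s j) (tnth k j).
      apply/orP; right; rewrite /v (minn_idPl sk) natrX ler_piMl ?invr_ge0 ?exprn_ge0//.
      by case/andP: e2.
    apply/orP; left; rewrite /v (minn_idPr (ltnW ks)) -mulrA ler_pM2l//.
    case/andP: (kt j) => /ltW h _; apply: le_trans h.
    by rewrite exprS invfM.
  have e20 : 0 < eps s / 2 * v by rewrite mulr_gt0// divr_gt0.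
  have h1 := recip_Phi_antitone (hphi j) e20 vle.
  have h2 := recip_Phi_scale (hphi j) e2 v0.
  have psik : 0 <= psi j (2 ^- tnth k j) by rewrite ltW// Phi_pow2_gt0.
  apply: le_trans (ler_wpM2l psik (le_trans h1 h2)) _.
  rewrite invfM invrK recip_PhiE// mulrCA [(eps s)^-1 * 2]mulrC ler_wpM2l ?hq//.
  by rewrite divr_ge0// ltW.
have -> : \prod_j psi j (2 ^- tnth k j) * ((eps s)^-1 * (CN * A s *
    \prod_j recip_Phi (phi j) (Num.max (eps s * t j) (2 ^ tnth s j)%:R^-1))) =
  (CN * A s * (eps s)^-1) * \prod_j (psi j (2 ^- tnth k j) *
     recip_Phi (phi j) (Num.max (eps s * t j) (2 ^ tnth s j)%:R^-1)).
  by rewrite big_split/=; ring.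
have cA0 : 0 <= CN * A s * (eps s)^-1 by rewrite !mulr_ge0// ltW.
apply: (@le_trans _ _ (CN * A s / eps s * \prod_j ((2 / eps s) *
    (Cd * q ^+ dst (tnth s j) (tnth k j) * phi_ratio (psi j) (phi j) (tnth s j))))); last first.
  set Mu := \prod_j phi_ratio (psi j) (phi j) (tnth s j).
  pose Q := \prod_j q ^+ dst (tnth s j) (tnth k j).
  have -> : \prod_j ((2 / eps s) *
      (Cd * q ^+ dst (tnth s j) (tnth k j) * phi_ratio (psi j) (phi j) (tnth s j))) =
      (2 / eps s) ^+ m * (Cd ^+ m * Q * Mu).
    have split2 (u v w z : 'I_m -> R) : \prod_j (u j * (v j * w j * z j)) =
        (\prod_j u j) * ((\prod_j v j) * (\prod_j w j) * \prod_j z j).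
      by rewrite -!big_split.
    by rewrite (split2 (fun=> 2 / eps s) (fun=> Cd)) !prodr_const card_ord.
  have Mu0 : 0 <= Mu.
    by apply: prodr_ge0 => j _; rewrite /phi_ratio divr_ge0// ltW// Phi_pow2_gt0.
  have QP : Q <= P s ^+ m.+1 * \prod_j (eta ^+ m.+1) ^+ dst (tnth s j) (tnth k j).
    rewrite /P -prodrXl -big_split/=; apply: ler_prod => j _.
    have /andP[q0 _] := q01.
    rewrite exprn_ge0 ?(ltW q0)//= -!exprM -exprD.
    apply: le_trans (lerXn2r _ _ _ heta) _; rewrite ?nnegrE ?exprn_ge0 ?(ltW q0) ?(ltW eta0)//.
    by rewrite -exprM (mulnC (dst _ _) m.+1) addnn -mul2n mulnA.
  set P' := \prod_j (eta ^+ m.+1) ^+ _ in QP *.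
  have QP' : Q / P s ^+ m.+1 <= P' by rewrite ler_pdivrMr ?exprn_gt0// mulrC.
  have -> : CN * A s / eps s * ((2 / eps s) ^+ m * (Cd ^+ m * Q * Mu)) =
      (CN * A s * Mu * 2 ^+ m * Cd ^+ m * c0 ^- m.+1) * (Q / P s ^+ m.+1).
    rewrite /eps expr_div_n exprMn !exprS; move: (P0 s) c00 => p0 c00'.
    have pm := expf_neq0 m (lt0r_neq0 p0); have cm := expf_neq0 m (lt0r_neq0 c00').
    move: (P s ^+ m) (c0 ^+ m) pm cm => pm cm pm0 cm0; field.
    by rewrite pm0 cm0 !gt_eqF.
  have -> : P' * (K * (Mu * A s)) = (CN * A s * Mu * 2 ^+ m * Cd ^+ m * c0 ^- m.+1) * P'.
    by rewrite /K; ring.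
  by rewrite ler_wpM2l// !mulr_ge0// ?invr_ge0 ?exprn_ge0// ltW.
apply: ler_wpM2l => //; apply: ler_prod => j _; apply/andP; split; last exact: fac.
rewrite mulr_ge0//; first by rewrite ltW// Phi_pow2_gt0.
rewrite ltW// recip_Phi_gt0// lt_max; by case/andP: (epst j) => ->.
Qed.

End superposition.

(** * The best approximation *)

Section approximation.
Context {R : realType} {m : nat}.
Local Notation normc := (@Normc.normc R).
Local Notation harmonic := Defs.harmonic.

Lemma aniso_norm_ge0 (X : 'I_m -> symmetric_space R) (phi : 'I_m -> R -> R) f :
  (forall j, fundamental_function (X j) (phi j)) -> (forall j, Phi_function (phi j)) ->
  (0 <= aniso_norm X f)%E.
Proof.
move=> hX hphi.
have := @mixed_sym_enorm_ge R m X phi (torus_rearrangement f) 0 (fun=> 1) 0 hX hphi (lexx _).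
rewrite mul0r; apply => [j|t _]; first by rewrite ler01 lexx.
by rewrite torus_rearrangementE torus_rearr_ge0// => x; rewrite lee_fin normc_ge0.
Qed.

Definition besov_seq (X : 'I_m -> symmetric_space R) (r : 'I_m -> R) (f : m.-tuple R -> R[i])
    (s : m.-tuple nat) : \bar R :=
  ((\prod_j 2 `^ ((tnth s j)%:R * r j))%:E * aniso_norm X (delta_block s f))%E.

Lemma besov_seq_ge0 X (phi : 'I_m -> R -> R) r f s :
  (forall j, fundamental_function (X j) (phi j)) -> (forall j, Phi_function (phi j)) ->
  (0 <= besov_seq X r f s)%E.
Proof.
move=> hX hphi; rewrite mule_ge0//; last exact: aniso_norm_ge0 hX hphi.
by rewrite lee_fin prodr_ge0// => j _; exact: powR_ge0.
Qed.

(** The partial Fourier sum over the hyperbolic cross competes in the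
    infimum. The superposition of the blocks bounds the rearrangement of the
    remainder on the dyadic cells, on which the Lorentz norm is discretized,
    and the geometric kernel is absorbed by the convolution inequality. What
    is left in both cases of the theorem is an inequality between sequence
    norms. *)
Lemma best_approx_le (gamma th tau r : 'I_m -> R) (X : 'I_m -> symmetric_space R)
    (phi psi : 'I_m -> R -> R) :
  (forall j, 0 < gamma j) -> (forall j, 1 <= th j) -> (forall j, 1 <= tau j) ->
  (forall j, 0 < r j) -> (forall j, Phi_function (phi j)) ->
  (forall j, fundamental_function (X j) (phi j)) -> (forall j, Phi_function (psi j)) ->
  (forall j, (1 < lower_dilation (psi j))%E) ->
  (forall j, (upper_dilation (psi j) < lower_dilation (phi j))%E) ->
  (forall j, (upper_dilation (phi j) < 2%:E)%E) ->
  exists2 C : R, 0 < C & forall n f, besov_class X r (fun j => (th j)%:E) f ->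
    (lseq_norm (fun j => (th j)%:E) (besov_seq X r f) <= 1)%E /\
    (best_approx gamma n psi tau f <= C%:E * lseq_norm (fun j => (tau j)%:E) (fun s =>
       if (n%:R <= weight gamma s)%R then
         (\prod_j (2 `^ (- ((tnth s j)%:R * r j)) * phi_ratio (psi j) (phi j) (tnth s j)))%:E *
         besov_seq X r f s
       else 0))%E.
Proof.
move=> gamma0 th1 tau1 r0 hphi hX hpsi lpsi dil uphi.
have [K [rho [K0 rho01 hK]]] := block_superposition hX hphi hpsi lpsi dil.
have [C' C'0 conv] := lseq_convolution_le tau1 rho01.
exists (C' * K); first exact: mulr_gt0.
have th0 j : 0 < th j by rewrite (lt_le_trans _ (th1 j)).
have tau0 j : 0 < tau j by rewrite (lt_le_trans _ (tau1 j)).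
move=> n f [sf fB].
have B0 s := besov_seq_ge0 r f s hX hphi.
have a0 g := @aniso_norm_ge0 X phi g hX hphi.
have f1 : (aniso_norm X f <= 1)%E by apply: le_trans fB; rewrite leeDl// lseq_ge0.
have B1 : (lseq_norm (fun j => (th j)%:E) (besov_seq X r f) <= 1)%E.
  by apply: le_trans fB; rewrite leeDr.
split => //.
pose w (s : m.-tuple nat) : R := \prod_j 2 `^ (- ((tnth s j)%:R * r j)).
have wE s : w s = (\prod_j 2 `^ ((tnth s j)%:R * r j))^-1.
  by rewrite -prodfV; apply: eq_bigr => j _; rewrite powRN.
have W0 s : 0 < \prod_j 2 `^ ((tnth s j)%:R * r j) :> R.
  by apply: prodr_gt0 => j _; exact: powR_gt0.
have aE s : aniso_norm X (delta_block s f) = ((w s)%:E * besov_seq X r f s)%E.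
  by rewrite /besov_seq muleA -EFinM wE mulVf ?gt_eqF// mul1e.
have fs s : (aniso_norm X (delta_block s f) <= (w s)%:E)%E.
  rewrite aE -[leRHS]mule1 lee_wpmul2l//; first by rewrite lee_fin wE invr_ge0 ltW.
  exact: le_trans (lseq_ge_term s th0 B0) B1.
pose A s : R := fine (aniso_norm X (delta_block s f)).
have AE s : aniso_norm X (delta_block s f) = (A s)%:E.
  by rewrite fineK// ge0_fin_numE//; exact: le_lt_trans (fs s) (ltry _).
have A0 s : 0 <= A s by rewrite -lee_fin -AE.
have [M [mM M0 tail]] := @fourier_tail_bound R m gamma r X phi f n gamma0 r0 hX hphi uphi sf f1 fs.
pose T x := \sum_(k \in @hyperbolic_cross R m gamma n) fourier_coef f k * harmonic k x.
apply: (@le_trans _ _ (aniso_lorentz_norm psi tau (f \- T))).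
  apply: ereal_inf_lbound; exists T => //.
  by exists (fourier_coef f).
pose Y s := (n%:R <= weight gamma s)%R.
pose c s : \bar R := if Y s then (K * (\prod_j phi_ratio (psi j) (phi j) (tnth s j) * A s))%:E else 0%E.
have mu0 s : 0 <= \prod_j phi_ratio (psi j) (phi j) (tnth s j).
  by apply: prodr_ge0 => j _; rewrite divr_ge0// ltW// Phi_pow2_gt0.
have c0 s : (0 <= c s)%E.
  by rewrite /c; case: ifP => // _; rewrite lee_fin mulr_ge0 ?(ltW K0)// mulr_ge0.
pose S k : \bar R := ereal_sup (range (fun s : m.-tuple nat =>
   (\prod_j rho ^+ dst (tnth s j) (tnth k j))%:E * c s))%E.
have S0 k : (0 <= S k)%E.
  apply: le_trans (ereal_sup_ubound _); last by exists [tuple of nseq m 0%N].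
  rewrite mule_ge0// lee_fin prodr_ge0// => j _; rewrite exprn_ge0//.
  by case/andP: rho01 => /ltW.
have p0 (k : m.-tuple nat) : 0 < \prod_j psi j (2 ^- tnth k j).
  by apply: prodr_gt0 => j _; rewrite Phi_pow2_gt0.
pose F x := (normc ((f \- T) x))%:E.
have gA s : (aniso_norm X (delta_block s f) <= (A s)%:E)%E by rewrite AE.
have cellF k t : (forall j, 2 ^- (tnth k j).+1 < tnth t j <= 2 ^- tnth k j) ->
    (torus_rearrangement (f \- T)%R t <= ((\prod_j psi j (2 ^- tnth k j))^-1)%:E * S k)%E.
  move=> kt; rewrite torus_rearrangementE.
  have := hK F M (fun s => delta_block s f) A Y mM M0 (fun s => delta_block_degree s f)
    (fun s => delta_block_periodic s f) A0 gA tail k (tnth t) kt.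
  move=> /(lee_wpmul2l (x := ((\prod_j psi j (2 ^- tnth k j))^-1)%:E)).
  rewrite lee_fin invr_ge0 (ltW (p0 k)) => /(_ isT).
  by rewrite muleA -EFinM mulVf ?gt_eqF// mul1e.
apply: le_trans (mixed_lorentz_norm_le 0 hpsi tau0 _ _ cellF) _.
- move=> t; rewrite torus_rearrangementE torus_rearr_ge0// => x.
  by rewrite lee_fin normc_ge0.
- by move=> k; rewrite mule_ge0// lee_fin invr_ge0 ltW.
apply: (@le_trans _ _ (lseq_norm (fun j => (tau j)%:E) S)).
  apply: le_lseq => // k; last by rewrite muleA -EFinM mulfV ?gt_eqF// mul1e.
  by rewrite muleA -EFinM mulfV ?gt_eqF// mul1e.
apply: le_trans (conv c c0) _.
rewrite EFinM -muleA lee_wpmul2l//; first by rewrite lee_fin ltW.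
set d := (X in (_ <= _ * lseq_norm _ X)%E).
have cd s : c s = (K%:E * d s)%E.
  rewrite /c /d /Y; case: ifP => _; last by rewrite mule0.
  have -> : \prod_j (2 `^ (- ((tnth s j)%:R * r j)) * phi_ratio (psi j) (phi j) (tnth s j)) =
      \prod_j phi_ratio (psi j) (phi j) (tnth s j) * w s.
    by rewrite /w -big_split/=; apply: eq_bigr => j _; exact: mulrC.
  by rewrite [X in (_ * (X * _))%E]EFinM -[X in (_ * X)%E]muleA -aE AE -!EFinM.
have d0 s : (0 <= d s)%E.
  rewrite /d; case: ifP => // _; rewrite mule_ge0// lee_fin prodr_ge0// => j _.
  by rewrite mulr_ge0 ?powR_ge0// divr_ge0// ltW// Phi_pow2_gt0.
rewrite (_ : c = (fun s => K%:E * d s)%E); last by apply/funext.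
exact: lseqZ_le tau0 (ltW K0) d0.
Qed.

End approximation.

Lemma eps_exponentE (R : realType) (t s : R) : 0 < s -> s < t ->
  eps_exponent t%:E s = (s * t / (t - s))%:E.
Proof.
move=> s0 st; have ts0 : 0 < t - s by rewrite subr_gt0.
have t0 : 0 < t by exact: lt_trans st.
rewrite /eps_exponent leNgt lte_fin st /= /hoelder_conjugate -EFinM.
have q0 : t / s - 1 != 0 by rewrite subr_eq0 gt_eqF// ltr_pdivlMr// mul1r.
rewrite /= eqe gt_eqF ?divr_gt0//= -EFinB inver (negbTE q0) -!EFinM; congr (_%:E).
by field; rewrite !gt_eqF//= subr_gt0.
Qed.

Theorem theorem5 (R : realType) (m : nat) (hm : (0 < m)%N)
    (gamma : 'I_m -> R) (hgamma : forall j, 0 < gamma j)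
    (theta : 'I_m -> \bar R) (htheta : forall j, (1 <= theta j)%E)
    (tau : 'I_m -> R) (htau : forall j, 1 <= tau j)
    (r : 'I_m -> R) (hr : forall j, 0 < r j)
    (X : 'I_m -> symmetric_space R) (phi psi : 'I_m -> R -> R)
    (hphi : forall j, Phi_function (phi j))
    (hX : forall j, fundamental_function (X j) (phi j))
    (hpsi : forall j, Phi_function (psi j))
    (hdil : forall j,
      [/\ (1 < lower_dilation (psi j))%E,
          (lower_dilation (psi j) <= upper_dilation (psi j))%E,
          (upper_dilation (psi j) < lower_dilation (phi j))%E,
          (lower_dilation (phi j) <= upper_dilation (phi j))%E
        & (upper_dilation (phi j) < 2%:E)%E])
    (hsum : forall j,
      (Lnorm counting (eps_exponent (theta j) (tau j))
         (fun s : nat => (phi_ratio (psi j) (phi j) s *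
                          2 `^ (- (s%:R * r j)))%:E) < +oo)%E) :
  exists2 C : R, 0 < C & forall n : nat, (0 < n)%N ->
    ((forall j, ((tau j)%:E < theta j < +oo)%E) ->
      (class_best_approx gamma n psi tau (besov_class X r theta) <=
       C%:E * lseq_norm (fun j => eps_exponent (theta j) (tau j))
         (fun s : m.-tuple nat =>
            if (n%:R <= weight gamma s)%R
            then (\prod_(j < m) (2 `^ (- ((tnth s j)%:R * r j)) *
                    phi_ratio (psi j) (phi j) (tnth s j)))%:E
            else 0))%E) /\
    ((forall j, (theta j <= (tau j)%:E)%E) ->
      (class_best_approx gamma n psi tau (besov_class X r theta) <=
       C%:E * ereal_sup
         [set (\prod_(j < m) (2 `^ (- ((tnth s j)%:R * r j)) *
                 phi_ratio (psi j) (phi j) (tnth s j)))%:E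
         | s in [set s : m.-tuple nat | (n%:R <= weight gamma s)%R]])%E).
Proof.
(* equal to [theta j] when this is finite, as it is in both cases *)
pose th j : R := Num.max 1 (fine (theta j)).
have th1 j : 1 <= th j by rewrite le_max lexx.
have thE j : (theta j < +oo)%E -> theta j = (th j)%:E.
  move=> toy; have f : theta j \is a fin_num by rewrite ge0_fin_numE// (le_trans _ (htheta j)).
  have : 1 <= fine (theta j) by rewrite -lee_fin fineK.
  by move=> h; rewrite /th max_r// fineK.
have tau0 j : 0 < tau j by rewrite (lt_le_trans _ (htau j)).
have th0 j : 0 < th j by rewrite (lt_le_trans _ (th1 j)).
have [C C0 hC] := @best_approx_le R m gamma th tau r X phi psi hgamma th1 htau hr hphi hX hpsi
  (fun j => let: And5 h _ _ _ _ := hdil j in h) (fun j => let: And5 _ _ h _ _ := hdil j in h)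
  (fun j => let: And5 _ _ _ _ h := hdil j in h).
have B0 f s := besov_seq_ge0 r f s hX hphi.
pose w (s : m.-tuple nat) : R :=
  \prod_(j < m) (2 `^ (- ((tnth s j)%:R * r j)) * phi_ratio (psi j) (phi j) (tnth s j)).
have w0 s : 0 <= w s.
  by apply: prodr_ge0 => j _; rewrite mulr_ge0 ?powR_ge0// divr_ge0// ltW// Phi_pow2_gt0.
exists C => // n n0; split => [ht|ht].
  have thetaE : theta = (fun j => (th j)%:E).
    by apply/funext => j; apply: thE; case/andP: (ht j).
  have st j : tau j < th j by have /andP[+ _] := ht j; rewrite thetaE lte_fin.
  pose e j := tau j * th j / (th j - tau j).
  have -> : (fun j => eps_exponent (theta j) (tau j)) = (fun j => (e j)%:E).
    by apply/funext => j; rewrite thetaE eps_exponentE.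
  apply: ge_ereal_sup => _ [f Bf <-]; rewrite thetaE in Bf.
  have [B1 /le_trans] := hC n f Bf; apply.
  rewrite lee_wpmul2l//; first by rewrite lee_fin ltW.
  set v := (X in (_ <= lseq_norm _ X)%E).
  have v0 s : (0 <= v s)%E by rewrite /v; case: ifP; rewrite // lee_fin w0.
  have e0 j : 0 < e j by rewrite divr_gt0 ?mulr_gt0// subr_gt0.
  have ee j : (tau j)^-1 = (e j)^-1 + (th j)^-1.
    have ts : 0 < th j - tau j by rewrite subr_gt0.
    by rewrite /e; field; rewrite !gt_eqF.
  rewrite -[leRHS]mule1; apply: (@le_trans _ _ (lseq_norm (fun j => (e j)%:E) v *
      lseq_norm (fun j => (th j)%:E) (besov_seq X r f))%E); last first.
    by rewrite lee_wpmul2l// lseq_ge0.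
  apply: le_trans (hoelder_lseq tau0 e0 th0 ee v0 (B0 f)).
  apply: le_lseq => // s; first by case: ifP => // _; rewrite mule_ge0// lee_fin w0.
  by rewrite /v /=; case: ifP => // _; rewrite mul0e.
have thetaE : theta = (fun j => (th j)%:E).
  by apply/funext => j; apply: thE; exact: le_lt_trans (ht j) (ltry _).
have st j : th j <= tau j by have := ht j; rewrite thetaE lee_fin.
apply: ge_ereal_sup => _ [f Bf <-]; rewrite thetaE in Bf.
have [B1 /le_trans] := hC n f Bf; apply.
rewrite lee_wpmul2l//; first by rewrite lee_fin ltW.
set S := ereal_sup _.
have ub s : (n%:R <= weight gamma s)%R -> ((w s)%:E <= S)%E.
  by move=> hs; apply: ereal_sup_ubound; exists s.
(* multi-indices far out on one axis show that the supremum is not over the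
   empty set *)
have S0 : (0 <= S)%E.
  pose j0 : 'I_m := Ordinal hm.
  pose s0 := [tuple of nseq m (Num.truncn (n%:R / gamma j0)).+1].
  apply: le_trans (ub s0 _); first by rewrite lee_fin.
  have s0E j : tnth s0 j = (Num.truncn (n%:R / gamma j0)).+1.
    by rewrite (tnth_nth 0%N) /= nth_nseq ltn_ord.
  rewrite /weight (bigD1 j0)//= s0E ler_wpDr//.
    by apply: sumr_ge0 => j _; rewrite mulr_ge0// ltW.
  by rewrite -ler_pdivrMr// ltW// truncnS_gt.
case: S S0 ub => [S| |] S0 ub //; last by rewrite leey.
apply: (@le_trans _ _ (lseq_norm (fun j => (tau j)%:E) (fun s => S%:E * besov_seq X r f s)%E)).
  apply: le_lseq => // s; first by case: ifP => // _; rewrite mule_ge0// lee_fin w0.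
  by case: ifP => [/ub h|_]; rewrite ?lee_wpmul2r// mule_ge0.
apply: le_trans (lseqZ_le tau0 _ (B0 f)) _; first by rewrite -lee_fin.
rewrite -[leRHS]mule1 lee_wpmul2l//; apply: le_trans B1.
exact: lseq_antitone th0 st (B0 f).
Qed.
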